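(* Let $\Omega$ be a domain of $\mathbb{R}^N$, $m>N$, and let $g:\Omega\times\mathbb{R}^2\to\mathbb{R}$ be such that $|g(x,t_1,t_2)|\le C|t_1|^p$ for all $(x,t_1,t_2)\in\Omega\times\mathbb{R}^2$, with $p>1$ and $C>0$. If $u\in W^{4,m}_{\mathrm{loc}}(\Omega)$ solves $$\Delta^2u=g(x,u,\Delta u)\qquad\text{in }\Omega,$$ and $u$ vanishes with infinite order at a point $x_0\in\Omega$, then $u\equiv0$ in $\Omega$.
   Context: The equation is understood to hold at almost every point of $\Omega$. A measurable function $u$ defined in $\Omega$ vanishes with infinite order at the point $x_0\in\Omega$ provided that for some $\varepsilon>0$ one has $\int_{B_r(x_0)}|u|^{\varepsilon}\,dx=o(r^k)$ as $r\to0^+$, for every $k>0$. *)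

(* Defs.v *)
From HB Require Import structures.
From mathcomp Require Import all_boot all_order all_algebra.
From mathcomp Require Import all_classical all_reals all_analysis.
Import Order.TTheory GRing.Theory Num.Theory.
Import numFieldNormedType.Exports.

Set Implicit Arguments.
Unset Strict Implicit.
Unset Printing Implicit Defensive.

Local Open Scope classical_set_scope.
Local Open Scope ring_scope.

(* The product sigma-algebra on 'rV[R]_n is put on an alias: 'rV[R]_n itself
   carries no measurable structure, so the sigma-algebra in use is always
   explicit. *)
Section borel.
Variable R : realType.

Definition coordinate_preimages n : set (set 'rV[R]_n) :=
  [set A | exists i : 'I_n, exists2 B : set R,
    measurable B & A = [set x : 'rV[R]_n | B (x 0 i)]].

Definition borel_space n := g_sigma_algebraType (@coordinate_preimages n).

Definition cons_row n (p : measurableTypeR R * borel_space n) :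
  borel_space n.+1 := row_mx (const_mx p.1 : 'rV[R]_1) (p.2 : 'rV[R]_n).

Lemma measurable_cons_row n : measurable_fun setT (@cons_row n).
Proof.
apply: (@measurability _ _ _ (borel_space n.+1) _ _
  (@coordinate_preimages n.+1) erefl).
move=> _ [_ [i [B mB ->]] <-]; rewrite setTI.
case: (split_ordP (i : 'I_(1 + n))) => j ij.
  have -> : @cons_row n @^-1` [set x : 'rV[R]_n.+1 | B (x 0 i)] = fst @^-1` B.
    apply/seteqP; split => -[a x] /=;
      by rewrite /cons_row/= ij (@row_mxEl _ 1 1 n) mxE.
  by rewrite -[X in measurable X]setTI; exact: measurable_fst.
have -> : @cons_row n @^-1` [set x : 'rV[R]_n.+1 | B (x 0 i)] =
    snd @^-1` ([set x : 'rV[R]_n | B (x 0 j)] : set (borel_space n)).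
  by apply/seteqP; split => -[a x] /=; rewrite /cons_row/= ij (@row_mxEr _ 1 1 n).
rewrite -[X in measurable X]setTI; apply: measurable_snd => //.
by apply: sub_sigma_algebra; exists j, B.
Qed.

Definition uncons_row n (x : borel_space n.+1) :
    measurableTypeR R * borel_space n :=
  ((x : 'rV[R]_(1 + n)) 0 (lshift n 0), rsubmx (x : 'rV[R]_(1 + n))).

Lemma uncons_rowK n : cancel (@uncons_row n) (@cons_row n).
Proof.
move=> x; rewrite /cons_row /uncons_row /=.
suff E : const_mx ((x : 'rV[R]_(1 + n)) 0 (lshift n 0)) =
    lsubmx (x : 'rV[R]_(1 + n))
  by rewrite E; exact: (@hsubmxK _ 1 1 n x).
by apply/rowP => i; rewrite !mxE (ord1 i).
Qed.

Lemma cons_rowK n : cancel (@cons_row n) (@uncons_row n).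
Proof.
by case=> a x; rewrite /cons_row /uncons_row /= (@row_mxEl _ 1 1 n) mxE row_mxKr.
Qed.

Lemma measurable_uncons_row n : measurable_fun setT (@uncons_row n).
Proof.
apply/measurable_fun_pairP; split.
  move=> _ B mB; rewrite setTI; apply: sub_sigma_algebra.
  by exists (lshift n 0 : 'I_(1 + n)), B.
apply: (@measurability _ _ _ (borel_space n) _ _ (@coordinate_preimages n) erefl).
move=> _ [_ [i [B mB ->]] <-]; rewrite setTI; apply: sub_sigma_algebra.
exists (rshift 1 i : 'I_(1 + n)), B => //.
by apply/seteqP; split => x /=; rewrite mxE.
Qed.

Section push.
Variables (n : nat) (mu : {sigma_finite_measure set (borel_space n) -> \bar R}).

Definition cons_measure : set (borel_space n.+1) -> \bar R :=
  pushforward (lebesgue_measure \x mu)%E (@cons_row n).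

Let cons_measure0 : cons_measure set0 = 0%E.
Proof. by rewrite /cons_measure /pushforward preimage_set0 measure0. Qed.

Let cons_measure_ge0 A : (0 <= cons_measure A)%E.
Proof. exact: (measure_ge0 (lebesgue_measure \x mu)%E). Qed.

Let cons_measure_sigma_additive : semi_sigma_additive cons_measure.
Proof.
move=> F mF tF _; rewrite /cons_measure /pushforward preimage_bigcup.
have mpre k : measurable (@cons_row n @^-1` F k).
  by rewrite -[X in measurable X]setTI; exact: measurable_cons_row.
apply: (@measure_semi_sigma_additive _ _ _ (lebesgue_measure \x mu)%E) => //.
  apply/trivIsetP => i j _ _ ij; rewrite -preimage_setI.
  by move/trivIsetP : tF => /(_ _ _ _ _ ij) ->//; rewrite preimage_set0.
exact: bigcup_measurable.
Qed.

HB.instance Definition _ := isMeasure.Build _ _ _ cons_measure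
  cons_measure0 cons_measure_ge0 cons_measure_sigma_additive.

Let cons_measure_sigma_finite : sigma_finite setT cons_measure.
Proof.
have [F FT Ffin] : sigma_finite setT (@lebesgue_measure R \x mu)%E.
  have /sigma_finiteP[F [TF ndF Foo]] := sigma_finiteT (@lebesgue_measure R).
  have /sigma_finiteP[G [TG ndG Goo]] := sigma_finiteT mu.
  exists (fun k => F k `*` G k).
    rewrite -setXTT TF TG predeqE => -[x y]; split.
      move=> [/= [k _ Fkx] [l _ Gly]]; exists (maxn k l) => //; split.
      - by move: x Fkx; exact/subsetPset/ndF/leq_maxl.
      - by move: y Gly; exact/subsetPset/ndG/leq_maxr.
    by move=> [k _ []/= ? ?]; split; exists k.
  move=> k; have [? ?] := Foo k; have [? ?] := Goo k.
  split; first exact: measurableX.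
  by rewrite product_measure1E// lte_mul_pinfty// ge0_fin_numE.
exists (fun k => @uncons_row n @^-1` F k).
  by rewrite -preimage_bigcup -FT preimage_setT.
move=> k; have [mF Fk] := Ffin k; split.
  by rewrite -[X in measurable X]setTI; exact: measurable_uncons_row.
rewrite /cons_measure /pushforward -comp_preimage.
suff -> : @uncons_row n \o @cons_row n = id by [].
by apply/funext => p; exact: cons_rowK.
Qed.

HB.instance Definition _ := Measure_isSigmaFinite.Build _ _ _ cons_measure
  cons_measure_sigma_finite.

End push.

(* The n-fold product of the Lebesgue measure of the line. *)
Fixpoint borel_lebesgue n : {sigma_finite_measure set (borel_space n) -> \bar R} :=
  match n with
  | 0 => @dirac _ (borel_space 0) (0 : 'rV[R]_0) R
  | k.+1 => cons_measure (borel_lebesgue k)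
  end.

(* Its completion: 'rV[R]_n with the sigma-algebra of Lebesgue measurable
   sets. *)
Definition lebesgue_space n := caratheodory_type ((borel_lebesgue n)^*)%mu.

Definition lebesgue n : {measure set (lebesgue_space n) -> \bar R} :=
  @completed_measure_extension _ _ _ (borel_lebesgue n).

End borel.

Section sobolev.
Variables (R : realType) (n : nat).
Local Notation V := 'rV[R]_n.
Local Notation mu := (lebesgue R n).
Implicit Types (Omega : set V) (u v phi : V -> R) (a : {ffun 'I_n -> nat}).

Definition lebesgue_measurable_fun Omega u :=
  measurable_fun (Omega : set (lebesgue_space R n))
    (u : lebesgue_space R n -> measurableTypeR R).

Definition partial (i : 'I_n) phi : V -> R :=
  fun x => 'D_(delta_mx 0 i) phi x.

Fixpoint class_C (k : nat) phi : Prop :=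
  continuous phi /\
  if k is j.+1 then
    (forall i x, derivable phi x (delta_mx 0 i)) /\
    (forall i, class_C j (partial i phi))
  else True.

Definition test_function Omega phi :=
  [/\ forall k, class_C k phi,
      compact (closure [set x | phi x != 0]) &
      closure [set x | phi x != 0] `<=` Omega].

Definition multi_order a := (\sum_(i < n) a i)%N.

Definition multi_partial a phi : V -> R :=
  foldr (fun i f => iter (a i) (partial i) f) phi (enum 'I_n).

Definition Lp_loc Omega (p : R) u :=
  lebesgue_measurable_fun Omega u /\
  forall K : set V, compact K -> K `<=` Omega ->
    (\int[mu]_(x in K) (`|u x| `^ p)%:E < +oo)%E.

Definition is_weak_partial Omega a u v :=
  [/\ Lp_loc Omega 1 u, Lp_loc Omega 1 v &
      forall phi, test_function Omega phi ->
        \int[mu]_(x in Omega) (u x * multi_partial a phi x) =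
        (-1) ^+ multi_order a * \int[mu]_(x in Omega) (v x * phi x)].

Definition sobolev_loc Omega (k : nat) (m : R) u :=
  forall a, (multi_order a <= k)%N ->
    exists2 v, is_weak_partial Omega a u v & Lp_loc Omega m v.

(* A representative of the weak derivative, which is unique up to equality
   almost everywhere in Omega; the zero function if there is none. *)
Definition weak_partial Omega a u : V -> R :=
  xget (fun=> 0) [set v | is_weak_partial Omega a u v].

Definition weak_laplacian Omega u : V -> R :=
  fun x => \sum_(i < n) weak_partial Omega [ffun j => (j == i).*2] u x.

(* The norm of the library on 'rV[R]_n is the maximum norm, hence an explicit
   Euclidean ball. *)
Definition euclidean_ball (x : V) (r : R) : set V :=
  [set y | \sum_(i < n) (y 0 i - x 0 i) ^+ 2 < r ^+ 2].

(* The limit is taken in \bar R, so that it forces the integrals to be finite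
   for small r. *)
Definition vanishes_infinite_order u (x0 : V) :=
  exists2 e : R, 0 < e & forall k : R, 0 < k ->
    ((\int[mu]_(x in euclidean_ball x0 r) (`|u x| `^ e)%:E)
       * ((r `^ k)^-1)%:E)%E @[r --> 0^'+] --> 0%E.

End sobolev.

(* Main.v *)
(* As m > N, the solution u has a continuous representative, so locally the equation yields
   |Delta^2 u| <= M |u|, and the claim becomes strong unique continuation for this differential
   inequality.

   The core is a Carleman inequality for the weight a = (s + e)^-n exp (n s), s = |x - c|^2,
     n^3 int a f^2 <= int a (Delta f)^2 + (an integral over the small ball (s + e)^2 < 2 e),
   read off an exact identity which is obtained by integrating divergences. It is applied to chi f
   and to chi Delta f for a cutoff chi; the commutators with chi are absorbed by an interior
   estimate of Delta f, grad f and grad Delta f in terms of f and Delta^2 f only. With n fixed, the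
   last integral disappears in the limit e -> 0 since u vanishes with infinite order; then n -> oo
   shows that u = 0 on a ball around c. The radius of that ball depends only on the distance from c
   to the complement of Omega, which is what connectedness needs.

   The weak equation is accessed through the mollifications u_d of u. The difference
   eta_d - eta_(d/2) of two mollifiers is a divergence, so the weak first derivatives of u, being in
   L^m with m > N, give |u_d - u_(d/2)| <= K d^(1 - N/m): the u_d converge locally uniformly, to u
   almost everywhere, and |Delta^2 u_d| <= M |u| + o(1). *)
From HB Require Import structures.
Require Import Defs.
From mathcomp Require Import all_boot all_order all_algebra.
From mathcomp Require Import all_classical all_reals all_analysis measurable_realfun.
From mathcomp Require Import ring lra.
Import Order.TTheory GRing.Theory Num.Theory.
Import numFieldNormedType.Exports.
Set Implicit Arguments.
Unset Strict Implicit.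
Unset Printing Implicit Defensive.
Local Open Scope classical_set_scope.
Local Open Scope ring_scope.

(** The factor exp (n s) is what makes the weight work. For the pure power s^-n the zero-order
    coefficient of the multiplier is constant in s, and the identity says nothing about f^2. With
    exp (n s) its derivative in s is n (1 - e (s + e)^-2), and the coefficient of a f^2 becomes of
    order n^2; completing the square against Delta f gains the third power of n. The parameter e
    keeps the weight smooth at c; its price is the small ball, where 1 - e (s + e)^-2 may be
    negative.

    Each use of the inequality trades n^3 for one Laplacian, so the two uses put n^6 in front of
    u^2, which absorbs the term in M^2 u^2. The commutators live in an annulus where the weight is
    smaller than near c by a factor 4^n. The error of the small ball grows like a power of 1/e whose
    exponent depends on n, so e must tend to 0 before n grows.

    Mollifications control only f and Delta^2 f. Hence every estimate of smooth functions is brought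
    to a form free of grad f, Delta f and grad Delta f before it passes to the limit. *)

Lemma is_derive_comp11 (R : realType) (f h : R -> R) (t df dh : R) :
  is_derive t 1 f df -> is_derive (f t) 1 h dh ->
  is_derive t 1 (fun s => h (f s)) (dh * df).
Proof.
move=> [fd fe] [hd he]; apply: DeriveDef.
  by apply/derivable1_diffP; apply: (differentiable_comp (f := f) (g := h));
    exact/derivable1_diffP.
by rewrite -derive1E (derive1_comp fd hd) !derive1E fe he.
Qed.

Section directional_derivative.
Variables (R : realType) (V : normedModType R).
Implicit Types (f g : V -> R) (x v : V).

(** Reduces a derivative along [v] to one in a single real variable, so that the scalar chain rule
    and the mean value theorem apply in any normed space. *)
Lemma is_derive_line f x v (df : R) :
  is_derive x v f df <-> is_derive (0 : R) 1 (fun t : R => f (t *: v + x)) df.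
Proof.
have E : 'D_v f x = 'D_1 (fun t : R => f (t *: v + x)) 0.
  rewrite -derive1E /derive1; under [in RHS]eq_fun do rewrite scale0r add0r addr0.
  by [].
split => -[d e].
  by apply: DeriveDef; [exact/(derivable1P f x v).1|exact: etrans (esym E) e].
by apply: DeriveDef; [exact/(derivable1P f x v).2|exact: etrans E e].
Qed.

Lemma is_derive_comp1 f (h : R -> R) x v (df dh : R) :
  is_derive x v f df -> is_derive (f x) 1 h dh ->
  is_derive x v (fun y => h (f y)) (dh * df).
Proof.
move=> /is_derive_line df0 hd; apply/is_derive_line.
apply: (is_derive_comp11 (f := fun t : R => f (t *: v + x))) => //.
by rewrite scale0r add0r.
Qed.

Lemma is_derive_continuous1 (h : R -> R) (t dh : R) :
  is_derive t (1 : R) h dh -> {for t, continuous h}.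
Proof.
by move=> [/derivable1_diffP d _]; exact: differentiable_continuous.
Qed.

End directional_derivative.

Lemma is_derive_affine (R : realType) (V : normedModType R) (f : V -> R) (a : R) (b x v : V) (df : R) :
  is_derive (a *: x + b) v f df -> is_derive x v (fun y => f (a *: y + b)) (a * df).
Proof.
move=> /is_derive_line H; apply/is_derive_line.
have -> : (fun t : R => f (a *: (t *: v + x) + b)) =
    (fun t : R => (fun t => f (t *: v + (a *: x + b))) (a * t)).
  by apply/funext => t; rewrite scalerDr scalerA addrA.
have e : is_derive (0:R) 1 (fun t : R => a * t) a.
  have := @is_deriveZ _ _ _ id a (0:R) 1 1 _.
  by rewrite /GRing.scale /= mulr1; apply.
rewrite mulrC.
have H' : is_derive (a * (0:R)) 1 (fun t : R => f (t *: v + (a *: x + b))) df by rewrite mulr0.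
exact: (is_derive_comp1 e H').
Qed.

(** * Calculus of smooth functions on R^N *)

Section smooth_calculus.
Variables (R : realType) (N : nat).
Local Notation V := 'rV[R]_N.
Local Notation "''e_' i" := (delta_mx 0 i : V) (at level 8, i at level 2, format "''e_' i").
Implicit Types (f g : V -> R) (i j : 'I_N) (x v : V).

Definition smooth f := forall k, class_C k f.

(** Replaces the specific functions [partial i f] by any family of derivatives, so that regularity
    is proved by exhibiting formulas and inducting on [k]. *)
Lemma class_CP k f : class_C k.+1 f <->
  continuous f /\ exists2 d : 'I_N -> V -> R,
    (forall i x, is_derive x 'e_i f (d i x)) & (forall i, class_C k (d i)).
Proof.
split=> [[cf [df Cf]]|[cf [d df Cf]]].
  by split => //; exists (fun i => partial i f) => // i x; apply/derivableP/df.
split => //; split => [i x|i]; first by case: (df i x).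
by rewrite (_ : partial i f = d i)//; apply/funext => x; rewrite /partial; case: (df i x).
Qed.

Lemma class_C_continuous k f : class_C k f -> continuous f.
Proof. by case: k => [|k] []. Qed.

Lemma class_C_leS k f : class_C k.+1 f -> class_C k f.
Proof.
elim: k f => [f []//|k IH f /class_CP[cf [d df Cd]]].
by apply/class_CP; split => //; exists d => // i; apply/IH/Cd.
Qed.

Lemma class_C_cst k (c : R) : class_C k (fun _ : V => c).
Proof.
elim: k c => [|k IH] c; first by split => [x|//]; exact: cst_continuous.
apply/class_CP; split; first by move=> x; exact: cst_continuous.
by exists (fun _ (_ : V) => 0) => [i x|i]; [exact: is_derive_cst|exact: IH].
Qed.

Lemma class_CD k f g : class_C k f -> class_C k g -> class_C k (fun x => f x + g x).
Proof.
elim: k f g => [f g [cf _] [cg _]|k IH f g /class_CP[cf [d df Cd]] /class_CP[cg [e eg Ce]]].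
  by split => [x|//]; exact: (cvgD (cf x) (cg x)).
apply/class_CP; split; first by move=> x; exact: (cvgD (cf x) (cg x)).
exists (fun i x => d i x + e i x) => [i x|i]; first exact: is_deriveD.
exact: IH.
Qed.

Lemma class_CM k f g : class_C k f -> class_C k g -> class_C k (fun x => f x * g x).
Proof.
elim: k f g => [f g [cf _] [cg _]|k IH f g Cf Cg].
  by split => [x|//]; exact: (cvgM (cf x) (cg x)).
have [cf [d df Cd]] := (class_CP _ _).1 Cf; have [cg [e eg Ce]] := (class_CP _ _).1 Cg.
apply/class_CP; split; first by move=> x; exact: (cvgM (cf x) (cg x)).
exists (fun i x => f x * e i x + g x * d i x) => [i x|i]; first exact: is_deriveM.
by apply: class_CD; apply: IH => //; exact: class_C_leS.
Qed.

(* [Phi] is a family of functions stable under derivation on the range of f *)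
Lemma class_C_comp (T : Type) (Phi : T -> R -> R) (dT : T -> T) (P : R -> Prop) k f p :
  (forall p t, P t -> is_derive t 1 (Phi p) (Phi (dT p) t)) -> (forall x, P (f x)) ->
  class_C k f -> class_C k (fun x => Phi p (f x)).
Proof.
move=> dPhi Pf; elim: k f p Pf => [|k IH] f p Pf Cf; have cf := class_C_continuous Cf.
  split => [x|//]; apply: (continuous_comp (f := f)); first exact: cf.
  exact: is_derive_continuous1 (dPhi _ _ _).
apply/class_CP; split.
  move=> x; apply: (continuous_comp (f := f)); first exact: cf.
  exact: is_derive_continuous1 (dPhi _ _ _).
have [_ [d df Cd]] := (class_CP _ _).1 Cf.
exists (fun i x => Phi (dT p) (f x) * d i x) => [i x|i].
  by apply: is_derive_comp1 => //; exact: dPhi.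
by apply: class_CM => //; apply: IH => //; exact: class_C_leS.
Qed.

Lemma affine_continuous (a : R) (b : V) : continuous (fun x : V => a *: x + b).
Proof.
move=> x; apply: (@continuousD _ _ _ (fun x : V => a *: x) (fun=> b) x).
  exact: scaler_continuous.
exact: cst_continuous.
Qed.

Lemma class_C_affine k f (a : R) (b : V) :
  class_C k f -> class_C k (fun x => f (a *: x + b)).
Proof.
elim: k f => [|k IH] f Cf; have cf := class_C_continuous Cf.
  split => [x|//]; apply: (continuous_comp (f := fun x => a *: x + b)); last exact: cf.
  exact: affine_continuous.
apply/class_CP; split.
  move=> x; apply: (continuous_comp (f := fun x => a *: x + b)); last exact: cf.
  exact: affine_continuous.
have [_ [d df Cd]] := (class_CP _ _).1 Cf.
exists (fun i x => a * d i (a *: x + b)) => [i x|i]; first exact: is_derive_affine.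
by apply: (@class_CM _ (fun _ : V => a)); [exact: class_C_cst|exact: IH].
Qed.

Lemma is_derive_coord i j x : is_derive x 'e_j (fun x : V => x 0 i) ((i == j)%:R : R).
Proof.
apply/is_derive_line; have -> : (fun t : R => (t *: 'e_j + x) 0 i) = (fun t : R => (i == j)%:R * t + x 0 i).
  by apply/funext => t; rewrite !mxE eqxx/= mulrC.
rewrite -[X in is_derive _ _ _ X]addr0; apply: is_deriveD.
have := @is_deriveZ _ _ _ id ((i == j)%:R) (0:R) 1 1 _.
by rewrite /GRing.scale /= mulr1; apply.
Qed.

Lemma class_C_coord k i : class_C k (fun x : V => x 0 i).
Proof.
case: k => [|k]; first by split => //; exact: coord_continuous.
apply/class_CP; split; first exact: coord_continuous.
exists (fun j (_ : V) => (i == j)%:R) => [j x|j]; first exact: is_derive_coord.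
exact: class_C_cst.
Qed.

Lemma smooth_continuous f : smooth f -> continuous f.
Proof. by move=> /(_ 0%N) []. Qed.

Lemma smooth_partial i f : smooth f -> smooth (partial i f).
Proof. by move=> sf k; have [_ [_ H]] := sf k.+1; exact: H. Qed.

Lemma smooth_is_derive i f x : smooth f -> is_derive x 'e_i f (partial i f x).
Proof. by move=> sf; have [_ [d _]] := sf 1%N; exact: derivableP (d i x). Qed.

Lemma partial_eq i f x (d : R) : is_derive x 'e_i f d -> partial i f x = d.
Proof. by case. Qed.

Lemma smooth_cst (c : R) : smooth (fun _ : V => c).
Proof. by move=> k; exact: class_C_cst. Qed.

Lemma smoothD f g : smooth f -> smooth g -> smooth (fun x => f x + g x).
Proof. by move=> sf sg k; exact: class_CD. Qed.

Lemma smoothM f g : smooth f -> smooth g -> smooth (fun x => f x * g x).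
Proof. by move=> sf sg k; exact: class_CM. Qed.

Lemma smoothZ (c : R) f : smooth f -> smooth (fun x => c * f x).
Proof. by move=> sf; apply: smoothM => //; exact: smooth_cst. Qed.

Lemma smoothN f : smooth f -> smooth (fun x => - f x).
Proof.
move=> sf; have -> : (fun x => - f x) = (fun x => (-1) * f x).
  by apply/funext => x; rewrite mulN1r.
exact: smoothZ.
Qed.

Lemma smoothB f g : smooth f -> smooth g -> smooth (fun x => f x - g x).
Proof. by move=> sf sg; apply: smoothD => //; exact: smoothN. Qed.

Lemma smoothX f n : smooth f -> smooth (fun x => f x ^+ n).
Proof.
move=> sf; elim: n => [|n IH]; first exact: (smooth_cst 1).
rewrite (_ : (fun x => _) = (fun x => f x * f x ^+ n)); first exact: smoothM.
by apply/funext => x; rewrite exprS.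
Qed.

Lemma smooth_sum (I : Type) (s : seq I) (P : pred I) (F : I -> V -> R) :
  (forall k, P k -> smooth (F k)) -> smooth (fun x => \sum_(k <- s | P k) F k x).
Proof.
move=> sF; elim: s => [|k s IH].
  rewrite (_ : (fun x => _) = (fun=> 0)); first exact: smooth_cst.
  by apply/funext => x; rewrite big_nil.
rewrite (_ : (fun x => _) = (fun x => (if P k then F k x else 0) + \sum_(k <- s | P k) F k x)).
  by apply: smoothD => //; case Pk : (P k); [exact: sF|exact: smooth_cst].
by apply/funext => x; rewrite big_cons; case: ifP => // _; rewrite add0r.
Qed.

Lemma smooth_prod (I : Type) (s : seq I) (F : I -> V -> R) :
  (forall k, smooth (F k)) -> smooth (fun x => \prod_(k <- s) F k x).
Proof.
move=> sF; elim: s => [|k s IH].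
  rewrite (_ : (fun x => _) = (fun=> 1)); first exact: smooth_cst.
  by apply/funext => x; rewrite big_nil.
rewrite (_ : (fun x => _) = (fun x => F k x * \prod_(k <- s) F k x)); first exact: smoothM.
by apply/funext => x; rewrite big_cons.
Qed.

Lemma smooth_affine f (a : R) (b : V) : smooth f -> smooth (fun x => f (a *: x + b)).
Proof. by move=> sf k; exact: class_C_affine. Qed.

Lemma smooth_coord i : smooth (fun x : V => x 0 i).
Proof. by move=> k; exact: class_C_coord. Qed.

Lemma smooth_comp (T : Type) (Phi : T -> R -> R) (dT : T -> T) (P : R -> Prop) f p :
  (forall p t, P t -> is_derive t 1 (Phi p) (Phi (dT p) t)) -> (forall x, P (f x)) ->
  smooth f -> smooth (fun x => Phi p (f x)).
Proof. by move=> dPhi Pf sf k; exact: (class_C_comp _ dPhi). Qed.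

Lemma smooth_expR f : smooth f -> smooth (fun x => expR (f x)).
Proof.
by move=> sf; apply: (@smooth_comp unit (fun _ => @expR R) id (fun=> True) f tt).
Qed.

Lemma is_deriveXV (n : nat) (t : R) : t != 0 ->
  is_derive t 1 (fun t : R => (t ^+ n)^-1) (- n%:R * (t ^+ n.+1)^-1).
Proof.
move=> t0.
have H : is_derive t 1 (fun t : R => t ^+ n) (n%:R * t ^+ n.-1).
  by apply: DeriveDef; [exact: exprn_derivable|rewrite exp_derive /GRing.scale/= mulr1].
have H1 : is_derive (t ^+ n) 1 (fun t : R => t^-1) (- (t ^+ n) ^- 2).
  have tn0 : t ^+ n != 0 by rewrite expf_neq0.
  apply: DeriveDef; first exact: (@derivableV _ _ id).
  by rewrite (@deriveV _ _ id)// derive_id /GRing.scale /= mulr1.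
apply: (is_derive_eq (is_derive_comp1 H H1)).
case: n {H H1} => [|n]; first by rewrite !(mul0r,mulr0) oppr0 mul0r.
rewrite /= !exprS; field.
by rewrite ?expf_neq0 t0.
Qed.

Lemma smoothXV f n : (forall x, f x != 0) -> smooth f -> smooth (fun x => (f x ^+ n)^-1).
Proof.
move=> f0 sf.
(* The functions c t^-k form a family stable under derivation on t != 0; the index records the
   coefficient and the exponent, as [smooth_comp] requires. *)
pose Phi (p : R * nat) (t : R) := p.1 * (t ^+ p.2)^-1.
have -> : (fun x => (f x ^+ n)^-1) = (fun x => Phi (1, n) (f x)).
  by apply/funext => x; rewrite /Phi mul1r.
apply: (@smooth_comp _ Phi (fun p => (p.1 * - p.2%:R, p.2.+1)) (fun t => t != 0)) => //.
move=> [c k] t t0; rewrite /Phi /= -mulrA.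
exact: is_deriveZ (is_deriveXV _ t0).
Qed.

Lemma smoothV f : (forall x, f x != 0) -> smooth f -> smooth (fun x => (f x)^-1).
Proof. by move=> f0 sf; have := smoothXV 1 f0 sf. Qed.

End smooth_calculus.

Section partial_rules.
Variables (R : realType) (N : nat).
Local Notation V := 'rV[R]_N.
Local Notation "''e_' i" := (delta_mx 0 i : V) (at level 8, i at level 2, format "''e_' i").
Implicit Types (f g : V -> R) (i j : 'I_N) (x v : V).

Lemma partial_cst i (c : R) x : partial i (fun _ : V => c) x = 0.
Proof. exact: partial_eq (is_derive_cst _ _ _). Qed.

Lemma partialD i f g x : smooth f -> smooth g ->
  partial i (fun x => f x + g x) x = partial i f x + partial i g x.
Proof.
move=> sf sg; apply: partial_eq.
exact: is_deriveD (smooth_is_derive i x sf) (smooth_is_derive i x sg).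
Qed.

Lemma partialM i f g x : smooth f -> smooth g ->
  partial i (fun x => f x * g x) x = f x * partial i g x + g x * partial i f x.
Proof.
move=> sf sg; apply: partial_eq.
exact: is_deriveM (smooth_is_derive i x sf) (smooth_is_derive i x sg).
Qed.

Lemma partialZ i (c : R) f x : smooth f -> partial i (fun x => c * f x) x = c * partial i f x.
Proof.
by move=> sf; apply: partial_eq; exact: is_deriveZ (smooth_is_derive i x sf).
Qed.

Lemma partialN i f x : smooth f -> partial i (fun x => - f x) x = - partial i f x.
Proof.
by move=> sf; apply: partial_eq; exact: is_deriveN (smooth_is_derive i x sf).
Qed.

Lemma partialB i f g x : smooth f -> smooth g ->
  partial i (fun x => f x - g x) x = partial i f x - partial i g x.
Proof. by move=> sf sg; rewrite partialD ?partialN//; exact: smoothN. Qed.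

Lemma partialX i n f x : smooth f ->
  partial i (fun x => f x ^+ n) x = n%:R * f x ^+ n.-1 * partial i f x.
Proof.
move=> sf; apply: partial_eq.
apply: (is_derive_comp1 (h := fun t => t ^+ n)) (smooth_is_derive i x sf) _.
by apply: DeriveDef; [exact: exprn_derivable|rewrite exp_derive /GRing.scale/= mulr1].
Qed.

Lemma partial_coord i j x : partial j (fun x : V => x 0 i) x = (i == j)%:R.
Proof. exact: partial_eq (is_derive_coord _ _ _). Qed.

Lemma partial_affine i f (a : R) (b : V) x : smooth f ->
  partial i (fun x => f (a *: x + b)) x = a * partial i f (a *: x + b).
Proof.
by move=> sf; apply: partial_eq; apply: is_derive_affine; exact: smooth_is_derive.
Qed.

Lemma partial_comp i f (h : R -> R) (dh : R) x : smooth f -> is_derive (f x) 1 h dh ->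
  partial i (fun x => h (f x)) x = dh * partial i f x.
Proof.
move=> sf hd; apply: partial_eq.
exact: is_derive_comp1 (smooth_is_derive i x sf) hd.
Qed.

Lemma partial_sum i (I : Type) (s : seq I) (P : pred I) (F : I -> V -> R) x :
  (forall k, smooth (F k)) ->
  partial i (fun x => \sum_(k <- s | P k) F k x) x = \sum_(k <- s | P k) partial i (F k) x.
Proof.
move=> sF; elim: s => [|k s IH].
  rewrite big_nil (_ : (fun x => _) = (fun=> 0)) ?partial_cst//.
  by apply/funext => y; rewrite big_nil.
rewrite big_cons; case Pk : (P k).
  rewrite (_ : (fun x => _) = (fun x => F k x + \sum_(k <- s | P k) F k x)).
    by rewrite partialD ?IH//; exact: smooth_sum.
  by apply/funext => y; rewrite big_cons Pk.
rewrite -IH; congr partial; apply/funext => y; by rewrite big_cons Pk.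
Qed.

Lemma is_derive_along i f x (t : R) : smooth f ->
  is_derive t 1 (fun t : R => f (t *: 'e_i + x)) (partial i f (t *: 'e_i + x)).
Proof.
move=> sf; have /is_derive_line H := smooth_is_derive i (t *: 'e_i + x) sf.
have -> : (fun t : R => f (t *: 'e_i + x)) =
    (fun s : R => (fun s : R => f (s *: 'e_i + (t *: 'e_i + x))) (1 *: s + (- t))).
  by apply/funext => s; rewrite scale1r addrA -scalerDl subrK.
rewrite -[X in is_derive _ _ _ X]mul1r; apply: (@is_derive_affine _ _ (fun s : R => f (s *: 'e_i + (t *: 'e_i + x)))).
by rewrite scale1r subrr.
Qed.

Lemma MVT_along i f x (h : R) : smooth f -> 0 < h ->
  exists2 t : R, 0 < t < h &
    f (h *: 'e_i + x) - f x = h * partial i f (t *: 'e_i + x).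
Proof.
move=> sf h0; have c : continuous (fun t : R => f (t *: 'e_i + x)).
  by move=> t; exact: is_derive_continuous1 (is_derive_along i x t sf).
have [t th E] := @MVT R (fun t => f (t *: 'e_i + x))
  (fun t => partial i f (t *: 'e_i + x)) 0 h h0
  (fun t _ => is_derive_along i x t sf) (continuous_subspaceT c).
exists t; first by move: th; rewrite in_itv.
by move: E; rewrite scale0r add0r subr0 mulrC.
Qed.

(** The mean value theorem is used twice: along ['e_i] for the increment of [f] in direction ['e_j],
    then along ['e_j] for [partial i f]. *)
Lemma second_difference i j f x (h : R) : smooth f -> 0 < h ->
  exists a b : R, [/\ 0 < a < h, 0 < b < h &
   f (h *: 'e_i + h *: 'e_j + x) - f (h *: 'e_i + x) - (f (h *: 'e_j + x) - f x) =
   h ^+ 2 * partial j (partial i f) (b *: 'e_j + (a *: 'e_i + x))].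
Proof.
move=> sf h0; pose F y := f (1 *: y + h *: 'e_j) - f y.
have s1 : smooth (fun y => f (1 *: y + h *: 'e_j)) by exact: smooth_affine.
have sF : smooth F by exact: smoothB.
have [a a0 Ea] := MVT_along i x sF h0.
have [b b0 Eb] := MVT_along j (a *: 'e_i + x) (smooth_partial i sf) h0.
exists a, b; split=> //; move: Ea; rewrite /F partialB// partial_affine//.
rewrite !scale1r mul1r (addrC (a *: _ + x)) Eb => Ea.
rewrite expr2 -mulrA -Ea.
by congr (f _ - f _ - (f _ - f _)); rewrite addrC ?addrA// addrAC addrC addrA.
Qed.

Lemma norm_delta_le1 i : `|'e_i| <= 1.
Proof.
rewrite [`|_|]mx_normrE; apply: bigmax_le => // -[a b] _ /=.
by rewrite mxE normr_nat lern1 leq_b1.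
Qed.

(** Schwarz's theorem. The second difference is symmetric in [i] and [j], so dividing by h^2 shows
    that the two mixed derivatives take a common value at points tending to [x] with [h]; continuity
    concludes. *)
Lemma partialC i j f : smooth f -> partial i (partial j f) = partial j (partial i f).
Proof.
move=> sf; apply/funext => x; apply/eqP; rewrite eq_le.
wlog suff H : i j / partial i (partial j f) x <= partial j (partial i f) x.
  by apply/andP; split; exact: H.
apply/ler_addgt0Pr => e e0.
have e2 : 0 < e / 2 by rewrite divr_gt0.
have near0 k l : \forall h \near (0:R)^'+, forall a b : R, 0 < a < h -> 0 < b < h ->
    `|partial k (partial l f) x - partial k (partial l f) (a *: 'e_k + (b *: 'e_l + x))| < e / 2.
  have /cvgrPdist_lt/(_ _ e2) := smooth_continuous (smooth_partial k (smooth_partial l sf)) (x := x).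
  case/nbhs_ballP => r /= r0 H; near=> h => a b a0 b0.
  apply: H; rewrite -ball_normE /= addrA opprD addrCA subrr addr0 normrN.
  have [/andP[ap ah] /andP[bp bh]] := (a0, b0).
  apply: (le_lt_trans (ler_normD _ _)); rewrite !normrZ (gtr0_norm ap) (gtr0_norm bp).
  have hr : h < r / 2 by near: h; apply: nbhs_right_lt; rewrite divr_gt0.
  have := ler_wpM2l (ltW ap) (norm_delta_le1 k).
  have := ler_wpM2l (ltW bp) (norm_delta_le1 l).
  by rewrite !mulr1; lra.
have [h [N1 [N2 h0]]] : exists h : R, (forall a b : R, 0 < a < h -> 0 < b < h ->
      `|partial j (partial i f) x - partial j (partial i f) (a *: 'e_j + (b *: 'e_i + x))| < e / 2) /\
    (forall a b : R, 0 < a < h -> 0 < b < h ->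
      `|partial i (partial j f) x - partial i (partial j f) (a *: 'e_i + (b *: 'e_j + x))| < e / 2) /\
    0 < h.
  exact: filter_ex (filterI (near0 j i) (filterI (near0 i j) (nbhs_right_gt 0))).
have [a [b [a0 b0 E]]] := second_difference i j x sf h0.
have [c [d [c0 d0 F]]] := second_difference j i x sf h0.
have := N1 _ _ b0 a0; have := N2 _ _ d0 c0.
have -> : partial i (partial j f) (d *: 'e_i + (c *: 'e_j + x)) =
    partial j (partial i f) (b *: 'e_j + (a *: 'e_i + x)).
  have h2 : h ^+ 2 != 0 by rewrite expf_neq0// gt_eqF.
  apply: (mulfI h2); apply: etrans (esym F) (etrans _ E); rewrite (addrC (h *: 'e_j)).
  by move: (f _) (f _) (f _) (f _) => A B C D; ring.
move: (partial i (partial j f) x) (partial j (partial i f) x) => A B.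
move: (partial j (partial i f) _) => X.
rewrite !ltr_norml => /andP[? ?] /andP[? ?].
by clear E F N1 N2 near0; lra.
Unshelve. all: by end_near. Qed.

End partial_rules.

(** * Smooth cutoffs *)

Section flat_function.
Variable R : realType.
Implicit Types (t : R) (k : nat).

(** The derivatives of exp (-1/t) are combinations of t^-k exp (-1/t); carrying [k] as a parameter
    makes the family closed under derivation, including at 0. *)
Definition flat k t : R := if 0 < t then (t ^+ k)^-1 * expR (- t^-1) else 0.

Lemma flat_ge0 k t : 0 <= flat k t.
Proof.
by rewrite /flat; case: ifP => // t0; rewrite mulr_ge0 ?expR_ge0// invr_ge0 exprn_ge0// ltW.
Qed.

Lemma flat_gt0 k t : 0 < t -> 0 < flat k t.
Proof. by move=> t0; rewrite /flat t0 mulr_gt0 ?expR_gt0// invr_gt0 exprn_gt0. Qed.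

Lemma flat_eq0 k t : t <= 0 -> flat k t = 0.
Proof. by rewrite leNgt /flat => /negbTE ->. Qed.

(** With y = 1/t this is y^k <= k! exp y, a single term of the exponential series. *)
Lemma flat_bound k t : flat k t <= (k`!)%:R.
Proof.
rewrite /flat; case: ifP => [t0|_]; last by rewrite ler0n.
rewrite expRN -exprVn ler_pdivrMr ?expR_gt0//.
have y0 : 0 <= t^-1 by rewrite invr_ge0 ltW.
case: k => [|k]; first by rewrite expr0 fact0 mul1r -expR0 ler_expR.
rewrite -ler_pdivrMl ?ltr0n ?fact_gt0// mulrC.
by apply: le_trans (expR_ge1Dxn k y0); rewrite lerDr.
Qed.

Lemma flatS k t : t * flat k.+1 t = flat k t.
Proof.
rewrite /flat; case: ifP => t0; last by rewrite mulr0.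
by rewrite exprS invfM !mulrA divff ?mul1r// gt_eqF.
Qed.

Lemma is_derive_flat k t :
  is_derive t 1 (flat k) (- k%:R * flat k.+1 t + flat k.+2 t).
Proof.
have [t0|t0|->] := ltgtP t 0.
- rewrite !flat_eq0 ?(ltW t0)// mulr0 addr0.
  have E : \near t, (fun _ : R => 0 : R) t = flat k t.
    near=> s; rewrite flat_eq0//; apply/ltW.
    by near: s; exact: lt_nbhsl.
  exact: (near_eq_is_derive E (is_derive_cst _ _ _)).
- pose h (t : R) := (t ^+ k)^-1 * expR (- t^-1).
  have E : \near t, h t = flat k t.
    near=> s; rewrite /h /flat ifT//; near: s; exact: lt_nbhsr.
  have H1 := is_deriveXV k (lt0r_neq0 t0).
  have H2 : is_derive t 1 (fun t : R => - t^-1) ((t ^+ 2)^-1).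
    have := is_deriveN (is_deriveXV 1 (lt0r_neq0 t0)).
    by rewrite mulN1r opprK.
  have H3 := is_derive_comp11 H2 (is_derive_expR (- t^-1)).
  apply: (near_eq_is_derive E); apply: (is_derive_eq (is_deriveM H1 H3)).
  rewrite /flat t0 /GRing.scale /=.
  rewrite !exprS; field.
  by rewrite expf_neq0 gt_eqF.
- rewrite !flat_eq0// mulr0 addr0.
  (* At 0 the difference quotient is [flat k.+1 h = h * flat k.+2 h], which tends to 0 because
     [flat k.+2] is bounded. *)
  have L : h^-1 *: (flat k (h + 0) - flat k 0) @[h --> (0:R)^'] --> (0:R).
    apply/cvgr0Pnorm_lt => e e0.
    have c0 : 0 < (k.+2`!)%:R :> R by rewrite ltr0n fact_gt0.
    have ec0 : 0 < e / (k.+2`!)%:R by rewrite divr_gt0.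
    near=> h.
    have h0 : h != 0 by near: h; exact: nbhs_dnbhs_neq.
    rewrite addr0 [flat k 0]flat_eq0// subr0 /GRing.scale/= -(flatS k h) mulKf// -(flatS _ h).
    rewrite normrM (ger0_norm (flat_ge0 _ _)).
    apply: (@le_lt_trans _ _ (`|h| * (k.+2`!)%:R)); first by rewrite ler_wpM2l// flat_bound.
    rewrite -ltr_pdivlMr//; near: h; apply: cvg_within.
    by have := @nbhs0_lt R R _ ec0.
  apply: DeriveDef; last by rewrite -derive1E; exact: cvg_lim L.
  apply/cvg_ex; exists 0; move: L; apply: cvg_trans; apply: near_eq_cvg.
  by apply: nearW => h; rewrite /= /GRing.scale/= mulr1.
Unshelve. all: by end_near. Qed.
End flat_function.

Section cutoffs.
Variables (R : realType).
Implicit Types t : R.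

Section smooth_flat_comp.
Variable N : nat.
Local Notation V := 'rV[R]_N.
Implicit Types (f g : V -> R).

Lemma smooth_flat k f : smooth f -> smooth (fun x => flat k (f x)).
Proof.
move=> sf m; elim: m k => [|m IH] k.
  split => // x; apply: (continuous_comp (f := f)); first exact: smooth_continuous.
  exact: is_derive_continuous1 (is_derive_flat _ _).
apply/class_CP; split.
  move=> x; apply: (continuous_comp (f := f)); first exact: smooth_continuous.
  exact: is_derive_continuous1 (is_derive_flat _ _).
exists (fun i x => (- k%:R * flat k.+1 (f x) + flat k.+2 (f x)) * partial i f x).
  by move=> i x; apply: is_derive_comp1 (smooth_is_derive i x sf) (is_derive_flat k (f x)).
move=> i; apply: class_CM; last exact: smooth_partial.
by apply: class_CD => //; apply: (@class_CM _ _ _ (fun=> - k%:R)); [exact: class_C_cst|exact: IH].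
Qed.

End smooth_flat_comp.

(** The thresholds 1 and 4 are the squares of 1 and 2: applied to |x - c|^2 / r^2, this gives a
    cutoff equal to 1 up to radius r and to 0 beyond 2r. *)
Definition step (t : R) : R := flat 0 (4 - t) / (flat 0 (4 - t) + flat 0 (t - 1)).

Lemma step_den_gt0 t : 0 < flat 0 (4 - t) + flat 0 (t - 1) :> R.
Proof.
have [t4|t4] := ltP t 4.
  by apply: ltr_pwDl; [rewrite flat_gt0// subr_gt0|exact: flat_ge0].
by apply: ltr_wpDl; [exact: flat_ge0|rewrite flat_gt0//; lra].
Qed.

Lemma step_ge0 t : 0 <= step t.
Proof. by rewrite divr_ge0 ?flat_ge0// ltW// step_den_gt0. Qed.

Lemma step_le1 t : step t <= 1.
Proof. by rewrite ler_pdivrMr ?step_den_gt0// mul1r lerDl flat_ge0. Qed.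

Lemma step_eq1 t : t <= 1 -> step t = 1.
Proof.
move=> t1; rewrite /step; have := step_den_gt0 t; rewrite (@flat_eq0 _ 0 (t - 1)) ?addr0.
  by move=> h; rewrite divff// gt_eqF.
by lra.
Qed.

Lemma step_eq0 t : 4 <= t -> step t = 0.
Proof. by move=> t4; rewrite /step flat_eq0 ?mul0r//; lra. Qed.

Lemma smooth_step N (f : 'rV[R]_N -> R) : smooth f -> smooth (fun x => step (f x)).
Proof.
move=> sf.
have s1 : smooth (fun x => flat 0 (4 - f x)).
  by apply: smooth_flat; apply: smoothB => //; exact: smooth_cst.
have s2 : smooth (fun x => flat 0 (f x - 1)).
  by apply: smooth_flat; apply: smoothB => //; exact: smooth_cst.
apply: smoothM => //; apply: smoothV; last exact: smoothD.
by move=> x; rewrite gt_eqF// step_den_gt0.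
Qed.

End cutoffs.

(** * Lebesgue integrals of compactly supported functions *)

Section borel_topology.
Variables (R : realType) (N : nat).
Local Notation V := 'rV[R]_N.
Implicit Types (f g : V -> R) (x y : V) (A : set V).

Lemma rowDE x y i : (x + y) 0 i = x 0 i + y 0 i. Proof. by rewrite mxE. Qed.
Lemma rowZE (a : R) x i : (a *: x) 0 i = a * x 0 i. Proof. by rewrite mxE. Qed.
Lemma rowNE x i : (- x) 0 i = - x 0 i. Proof. by rewrite mxE. Qed.
Lemma rowBE x y i : (x - y) 0 i = x 0 i - y 0 i. Proof. by rewrite !mxE. Qed.

Lemma ball_coordP x (e : R) y : 0 < e ->
  ball x e y <-> forall i, `|x 0 i - y 0 i| < e.
Proof.
move=> e0; split => [[_ H] i|H].
  by have := H 0 i; rewrite -ball_normE.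
by split => // a i; rewrite (ord1 a) -ball_normE /=.
Qed.

Lemma norm_coord_le x i : `|x 0 i| <= `|x|.
Proof.
rewrite [`|x|]mx_normrE.
exact: (le_bigmax _ (fun k : 'I_1 * 'I_N => `|x k.1 k.2|) (0, i)).
Qed.

Lemma norm_leP x (r : R) : 0 <= r -> `|x| <= r <-> forall i, `|x 0 i| <= r.
Proof.
move=> r0; split => [xr i|H]; first exact: le_trans (norm_coord_le x i) xr.
rewrite [`|x|]mx_normrE; apply: bigmax_le => // -[a i] _ /=; by rewrite (ord1 a).
Qed.

Definition box (c : {ffun 'I_N -> R * R}) : set V :=
  [set x | forall i, (c i).1 < x 0 i < (c i).2].

Lemma measurable_coordinate i (B : set R) : measurable B ->
  measurable ([set x : V | B (x 0 i)] : set (borel_space R N)).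
Proof. by move=> mB; apply: sub_sigma_algebra; exists i, B. Qed.

Lemma measurable_forall_coordinate (B : 'I_N -> set R) : (forall i, measurable (B i)) ->
  measurable ([set x : V | forall i, B i (x 0 i)] : set (borel_space R N)).
Proof.
move=> mB; rewrite [X in measurable X](_ : _ =
  \bigcap_(i in [set: 'I_N]) ([set x : V | B i (x 0 i)] : set (borel_space R N))).
  apply: fin_bigcap_measurable; first exact: finite_finset.
  by move=> i _; exact: measurable_coordinate.
by apply/seteqP; split => x /= H i => [_|]; exact: H.
Qed.

Lemma measurable_box c : measurable (box c : set (borel_space R N)).
Proof.
rewrite /box; have := @measurable_forall_coordinate (fun i => `](c i).1, (c i).2[%classic)
  (fun i => measurable_itv _).
congr measurable; apply/seteqP; split => x /= H i; have := H i; by rewrite in_itv.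
Qed.

(** Boxes with rational corners are countably many, and those contained in [A] already cover it. *)
Lemma open_borel A : open A -> measurable (A : set (borel_space R N)).
Proof.
move=> oA.
pose Q (c : {ffun 'I_N -> rat * rat}) : set (borel_space R N) :=
  if pselect (box [ffun i => (ratr (c i).1, ratr (c i).2)] `<=` A)
  then box [ffun i => (ratr (c i).1, ratr (c i).2)] else set0.
have -> : A = \bigcup_(c in setT) Q c.
  apply/seteqP; split => [x Ax|x [c _]]; last first.
    by rewrite /Q; case: pselect => [H|H //]; exact: H.
  have /nbhs_ballP[e /= e0 xeA] : nbhs x A by exact: open_nbhs_nbhs.
  have H i : exists p : rat * rat,
      [/\ x 0 i - e < ratr p.1, ratr p.1 < x 0 i, x 0 i < ratr p.2 & ratr p.2 < x 0 i + e].
    have [p pl] := @rat_in_itvoo R (x 0 i - e) (x 0 i) ltac:(lra).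
    have [q ql] := @rat_in_itvoo R (x 0 i) (x 0 i + e) ltac:(lra).
    by exists (p, q); move: pl ql; rewrite !in_itv => /andP[? ?] /andP[? ?].
  pose c := [ffun i => sval (cid (H i))].
  have cE i : c i = sval (cid (H i)) by rewrite ffunE.
  exists c => //; rewrite /Q; case: pselect => [_ i|nA].
    rewrite ffunE cE; case: cid => p [/= ? ? ? ?]; exact/andP.
  exfalso; apply: nA => y yb; apply: xeA; apply/(ball_coordP _ _ e0) => i.
  have := yb i; rewrite ffunE cE; case: cid => p [/= h1 h2 h3 h4] /andP[h5 h6].
  by rewrite ltr_norml; apply/andP; split; lra.
apply: countable_bigcupT_measurable => [|c]; first exact: countableP.
rewrite /Q; case: pselect => [H|H]; [exact: measurable_box|exact: measurable0].
Qed.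

Lemma continuous_borel f : continuous f ->
  measurable_fun setT (f : borel_space R N -> measurableTypeR R).
Proof.
move=> /continuousP cf; apply: (measurability _ (RGenOpens.measurableE R)).
move=> _ [_ [a [b ->] <-]]; rewrite setTI; apply: open_borel.
exact/cf/interval_open.
Qed.

End borel_topology.

Section borel_integral.
Variables (R : realType).
Local Notation lam := (@lebesgue_measure R).

Lemma ge0_integral_cons n (f : borel_space R n.+1 -> \bar R) :
  measurable_fun setT f -> (forall x, 0 <= f x)%E ->
  (\int[borel_lebesgue R n.+1]_x f x =
   \int[lam]_a \int[borel_lebesgue R n]_y f (cons_row (a, y)))%E.
Proof.
move=> mf f0.
rewrite [LHS](@ge0_integral_pushforward _ _ _ (borel_space R n.+1) R (@cons_row R n)
  (@measurable_cons_row R n) (lam \x borel_lebesgue R n)%E setT f)//.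
rewrite preimage_setT (fubini_tonelli1 (m1 := lam) (m2 := borel_lebesgue R n) (f \o @cons_row R n))//.
  by apply: measurableT_comp => //; exact: measurable_cons_row.
by move=> x; exact: f0.
Qed.

Lemma integral_cons n (f : borel_space R n.+1 -> \bar R) :
  (borel_lebesgue R n.+1).-integrable setT f ->
  (\int[borel_lebesgue R n.+1]_x f x =
   \int[lam]_a \int[borel_lebesgue R n]_y f (cons_row (a, y)))%E.
Proof.
move=> intf; have mf : measurable_fun setT f by case/integrableP : intf.
have intf' : (lam \x borel_lebesgue R n)%E.-integrable setT (f \o @cons_row R n).
  apply/integrableP; split.
    by apply: measurableT_comp => //; exact: measurable_cons_row.
  case/integrableP : intf => _; apply: le_lt_trans.
  rewrite [leRHS](@ge0_integral_pushforward _ _ _ (borel_space R n.+1) R (@cons_row R n)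
    (@measurable_cons_row R n) (lam \x borel_lebesgue R n)%E setT)//.
  by apply: measurableT_comp.
rewrite [LHS](@integral_pushforward _ _ _ (borel_space R n.+1) R (@cons_row R n)
  (@measurable_cons_row R n) (lam \x borel_lebesgue R n)%E setT f)//.
by rewrite preimage_setT -integral12_prod_meas1.
Qed.

(** The first coordinate is integrated innermost here, the order in which a derivative in that
    coordinate can be integrated. *)
Lemma integral_cons' n (f : borel_space R n.+1 -> \bar R) :
  (borel_lebesgue R n.+1).-integrable setT f ->
  (\int[borel_lebesgue R n.+1]_x f x =
   \int[borel_lebesgue R n]_y \int[lam]_a f (cons_row (a, y)))%E.
Proof.
move=> intf; have mf : measurable_fun setT f by case/integrableP : intf.
have intf' : (lam \x borel_lebesgue R n)%E.-integrable setT (f \o @cons_row R n).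
  apply/integrableP; split.
    by apply: measurableT_comp => //; exact: measurable_cons_row.
  case/integrableP : intf => _; apply: le_lt_trans.
  rewrite [leRHS](@ge0_integral_pushforward _ _ _ (borel_space R n.+1) R (@cons_row R n)
    (@measurable_cons_row R n) (lam \x borel_lebesgue R n)%E setT)//.
  by apply: measurableT_comp.
by rewrite integral_cons// (Fubini intf').
Qed.

Lemma cons_row0 n (a : R) (y : 'rV[R]_n) : (cons_row (a, y) : 'rV[R]_n.+1) 0 ord0 = a.
Proof.
rewrite /cons_row /= (_ : ord0 = lshift n (0 : 'I_1)); last exact: val_inj.
by rewrite (@row_mxEl _ 1 1 n) mxE.
Qed.

Lemma cons_rowS n (a : R) (y : 'rV[R]_n) i :
  (cons_row (a, y) : 'rV[R]_n.+1) 0 (lift ord0 i) = y 0 i.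
Proof.
rewrite /cons_row /= (_ : lift ord0 i = rshift 1 i); last exact: val_inj.
by rewrite (@row_mxEr _ 1 1 n).
Qed.

Lemma measurable_prod_coordinate n (f : 'I_n -> R -> R) :
  (forall i, measurable_fun setT (f i)) ->
  measurable_fun setT (fun x : borel_space R n => (\prod_i f i ((x : 'rV[R]_n) 0%R i))%:E).
Proof.
move=> mf; apply/measurable_EFinP; apply: measurable_prod => i _.
apply: (measurableT_comp (mf i)); apply: continuous_borel; exact: coord_continuous.
Qed.

(** Tonelli by induction on the dimension, the measure of dimension 0 being a Dirac mass. It yields
    both the volume of a cube and the mass of a product mollifier. *)
Lemma integral_prod n (f : 'I_n -> R -> R) (c : 'I_n -> R) :
  (forall i, measurable_fun setT (f i)) -> (forall i t, 0 <= f i t) ->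
  (forall i, \int[lam]_t (f i t)%:E = (c i)%:E)%E ->
  (\int[borel_lebesgue R n]_x (\prod_i f i ((x : 'rV[R]_n) 0%R i))%:E = (\prod_i c i)%:E)%E.
Proof.
elim: n f c => [|n IH] f c mf f0 fc.
  rewrite big_ord0 /= integral_dirac//; last first.
    by apply/measurable_EFinP; apply: continuous_borel => x; under eq_fun do rewrite big_ord0; exact: cst_continuous.
  by rewrite diracE in_setT mul1e big_ord0.
rewrite ge0_integral_cons; last 2 first.
- exact: measurable_prod_coordinate.
- by move=> x; rewrite lee_fin prodr_ge0.
under eq_integral => a _.
  under eq_integral => y _.
    rewrite big_ord_recl cons_row0 EFinM.
    under eq_bigr do rewrite cons_rowS.
    over.
  rewrite ge0_integralZl//; last 3 first.
  - exact: (@measurable_prod_coordinate _ (fun i => f (lift ord0 i))).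
  - by move=> y _; rewrite lee_fin prodr_ge0.
  - by rewrite lee_fin.
  rewrite (IH (fun i => f (lift ord0 i)) (fun i => c (lift ord0 i)))//.
  over.
rewrite ge0_integralZr//; last 3 first.
- by apply/measurable_EFinP; exact: mf.
- by move=> y _; rewrite lee_fin.
- rewrite lee_fin prodr_ge0// => i _; rewrite -lee_fin -fc integral_ge0// => t _; by rewrite lee_fin.
by rewrite fc big_ord_recl.
Qed.

End borel_integral.

Lemma lipschitz_continuous (R : realType) (V W : normedModType R) (F : V -> W) (M : R) :
  (forall x y, `|F x - F y| <= M * `|x - y|) -> continuous F.
Proof.
move=> H x; apply/cvgrPdist_lt => e e0.
have M1 : 0 < `|M| + 1 by rewrite ltr_wpDl.
near=> y; apply: le_lt_trans (H x y) _.
apply: (@le_lt_trans _ _ ((`|M| + 1) * `|x - y|)).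
  by apply: ler_wpM2r => //; have := ler_norm M; lra.
rewrite -ltr_pdivlMl//; near: y; have := @cvg_id _ (nbhs x) => /cvgrPdist_lt.
by apply; rewrite mulr_gt0// invr_gt0.
Unshelve. all: by end_near. Qed.

Lemma nonexpansive_continuous (R : realType) (V W : normedModType R) (F : V -> W) :
  (forall x y, `|F x - F y| <= `|x - y|) -> continuous F.
Proof. by move=> H; apply: (@lipschitz_continuous _ _ _ _ 1) => x y; rewrite mul1r. Qed.

Section compactly_supported.
Variable (R : realType).
Local Notation lam := (@lebesgue_measure R).

Definition bounded_support N (f : 'rV[R]_N -> R) := exists r : R, forall x, r < `|x| -> f x = 0.

(** Such functions are Borel, bounded, and carried by a cube of finite measure, hence integrable;
    this class discharges every integrability condition in the calculus with [bint]. *)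
Definition cc N (f : 'rV[R]_N -> R) := continuous f /\ bounded_support f.

(** The Borel measure is used for smooth integrands since it is an iterated product, to which Fubini
    applies one coordinate at a time; [lint_bint] returns to the completed measure. *)
Definition bint N (f : 'rV[R]_N -> R) : R :=
  \int[borel_lebesgue R N]_x (f : borel_space R N -> R) x.

Definition cube N (a b : 'I_N -> R) : set (borel_space R N) :=
  [set x : 'rV[R]_N | forall i, x 0 i \in `[a i, b i]].

Lemma measurable_cube N (a b : 'I_N -> R) : measurable (cube a b).
Proof.
exact: (@measurable_forall_coordinate R N (fun i => `[a i, b i]%classic) (fun i => measurable_itv _)).
Qed.

Lemma borel_lebesgue_cube N (a b : 'I_N -> R) : (forall i, a i <= b i) ->
  borel_lebesgue R N (cube a b) = (\prod_i (b i - a i))%:E.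
Proof.
move=> ab.
have mA := measurable_cube a b.
rewrite -[LHS]mul1e -[LHS](integral_cst (borel_lebesgue R N) mA 1%E) integral_mkcond.
have := @integral_prod R N (fun i => \1_(`[a i, b i]%classic)) (fun i => b i - a i).
move=> /(_ (fun i => measurable_indic (measurable_itv _))) <-; last 2 first.
- by move=> i t; rewrite indicE ler0n.
- move=> i; transitivity (lebesgue_measure `[a i, b i]%classic).
    by rewrite integral_indic// setIT.
  rewrite lebesgue_measure_itv/= lte_fin.
  by have := ab i; rewrite le_eqVlt => /predU1P[->|->//]; rewrite ltxx subrr.
apply: eq_integral => x _; rewrite patchE; case: ifPn => [|].
  rewrite inE /= => H; rewrite big1// => i _; rewrite indicE mem_set//=.
rewrite notin_setE /= => H.
have [i Hi] : exists i, x 0 i \notin `[a i, b i].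
  by apply: contrapT => H2; apply: H => i; apply: contrapT => /negP H3; apply: H2; exists i.
rewrite (bigD1 i)//= indicE memNset ?mul0r//=.
exact/negP.
Qed.

Lemma norm_cubeP N (r : R) (x : 'rV[R]_N) : 0 <= r ->
  `|x| <= r <-> (forall i, x 0 i \in `[-r, r]).
Proof.
move=> r0; rewrite norm_leP//; split => H i; by have := H i; rewrite in_itv /= ler_norml.
Qed.

Lemma cube_finite N (a b : 'I_N -> R) : (borel_lebesgue R N (cube a b) < +oo)%E.
Proof.
apply: (@le_lt_trans _ _ (borel_lebesgue R N (cube a (fun i => Num.max (a i) (b i))))).
  apply: le_measure; rewrite ?inE; [exact: measurable_cube|exact: measurable_cube|].
  move=> x H i; have := H i; rewrite !in_itv /= => /andP[-> xb] /=.
  by rewrite le_max xb orbT.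
by rewrite borel_lebesgue_cube ?ltry// => i; rewrite le_max lexx.
Qed.

Lemma continuous_ball_bounded N (f : 'rV[R]_N -> R) (r : R) : continuous f ->
  exists2 M, 0 <= M & forall x, `|x| <= r -> `|f x| <= M.
Proof.
move=> cf.
have cK : compact [set x : 'rV[R]_N | `|x| <= r].
  apply: bounded_closed_compact.
    by exists r; split; [exact: num_real|move=> y ry x /= xr; exact: le_trans xr (ltW ry)].
  rewrite (_ : [set x | _] = (fun x : 'rV[R]_N => `|x|) @^-1` [set y | y <= r])//.
  by apply: closed_comp => [x _|]; [exact: norm_continuous|exact: closed_le].
have := continuous_compact (continuous_subspaceT cf) cK.
move/compact_bounded => [M [_ HM]].
exists (`|M| + 1); first by rewrite addr_ge0.
move=> x xr; apply: (HM (`|M| + 1)); last by exists x.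
by rewrite ltr_pwDr// ler_norm.
Qed.

Lemma cc_bounded N (f : 'rV[R]_N -> R) : cc f -> exists2 M, 0 <= M & forall x, `|f x| <= M.
Proof.
move=> [cf [r fr]]; have [M M0 HM] := continuous_ball_bounded r cf.
exists M => // x; have [xr|xr] := leP `|x| r; first exact: HM.
by rewrite fr// normr0.
Qed.

Lemma bounded_integrable N (f : 'rV[R]_N -> R) (M : R) :
  measurable_fun setT (f : borel_space R N -> R) -> (forall x, `|f x| <= M) ->
  bounded_support f -> (borel_lebesgue R N).-integrable setT (EFin \o (f : borel_space R N -> R)).
Proof.
move=> mf fM [r fr].
pose A : set (borel_space R N) := cube (fun=> - `|r|) (fun=> `|r|).
have mA : measurable A by exact: measurable_cube.
have -> : (EFin \o (f : borel_space R N -> R)) = ((EFin \o (f : borel_space R N -> R)) \_ A).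
  apply/funext => x; rewrite patchE; case: ifPn => //.
  rewrite notin_setE /= => nA; rewrite fr//.
  rewrite (le_lt_trans (ler_norm r))// ltNge; apply/negP => h.
  by apply: nA; exact/(norm_cubeP _ (normr_ge0 r)).
apply: (integrable_mkcond _ mA).1.
apply: measurable_bounded_integrable => //; first exact: cube_finite.
  exact: measurable_funTS.
by exists M; split; [exact: num_real|move=> y My x _; exact: le_trans (fM x) (ltW My)].
Qed.

Lemma cc_integrable N (f : 'rV[R]_N -> R) : cc f ->
  (borel_lebesgue R N).-integrable setT (EFin \o (f : borel_space R N -> R)).
Proof.
move=> ccf; have [M _ fM] := cc_bounded ccf; have [cf bf] := ccf.
by apply: (bounded_integrable (M := M)) => //; exact: continuous_borel.
Qed.

Lemma integral_derive1 (phi psi : R -> R) (r a b : R) : continuous psi ->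
  (forall t : R, is_derive t 1 phi (psi t)) -> (forall t, r < t -> phi t = b) ->
  (forall t, t < - r -> phi t = a) ->
  (forall t, r < `|t| -> psi t = 0) -> (\int[lam]_t (psi t)%:E = (b - a)%:E)%E.
Proof.
move=> cpsi dphi phib phia psi0; pose s : R := `|r| + 1.
have s0 : 0 < s by rewrite ltr_wpDl.
have rs : r < s by rewrite /s (le_lt_trans (ler_norm r))// ltrDl.
rewrite [LHS](_ : _ = \int[lam]_(t in [set` `[- s, s]%R]) (psi t)%:E)%E.
  have cphi : continuous phi by move=> t; exact: is_derive_continuous1 (dphi t).
  rewrite (@continuous_FTC2 _ psi phi).
  - by rewrite phib// phia ?ltrN2// EFinB.
  - by rewrite (lt_trans _ s0)// oppr_lt0.
  - exact: continuous_subspaceT.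
  - split.
    + by move=> x _; case: (dphi x).
    + exact/cvg_at_right_filter/cphi.
    + exact/cvg_at_left_filter/cphi.
  - by move=> x _; rewrite derive1E; case: (dphi x).
rewrite [RHS]integral_mkcond; apply: eq_integral => t _; rewrite patchE; case: ifPn => //.
rewrite notin_setE /= in_itv /= => /negP h; rewrite psi0//; apply: (lt_le_trans rs).
by rewrite leNgt ltr_norml; apply: contra h => /andP[h1 h2]; rewrite !ltW.
Qed.

Lemma integral_derive1_0 (phi psi : R -> R) (r : R) : continuous psi ->
  (forall t : R, is_derive t 1 phi (psi t)) -> (forall t, r < `|t| -> phi t = 0) ->
  (forall t, r < `|t| -> psi t = 0) -> (\int[lam]_t (psi t)%:E = 0)%E.
Proof.
move=> cpsi dphi phi0 psi0.
rewrite (@integral_derive1 phi psi r 0 0 cpsi dphi) ?subr0// => t h; apply: phi0.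
  by apply: lt_le_trans h _; exact: ler_norm.
by rewrite -normrN; apply: lt_le_trans (ler_norm _); rewrite ltrNr.
Qed.

Lemma norm_cons_ge n (a : R) (y : 'rV[R]_n) :
  `|a| <= `|cons_row (a, y) : 'rV[R]_n.+1| /\ `|y| <= `|cons_row (a, y) : 'rV[R]_n.+1|.
Proof.
split; first by rewrite -[a in leLHS](cons_row0 a y); exact: norm_coord_le.
by apply/norm_leP => // i; rewrite -(cons_rowS a y i); exact: norm_coord_le.
Qed.

Lemma cons_row_add n (a b : R) (y z : 'rV[R]_n) :
  cons_row (a + b, y + z) = (cons_row (a, y) : 'rV[R]_n.+1) + (cons_row (b, z) : 'rV[R]_n.+1).
Proof.
by apply/rowP => i; rewrite ?(rowDE,rowZE); case: (unliftP ord0 i) => [j ->|->];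
  rewrite ?cons_rowS ?cons_row0 ?rowDE ?rowZE ?mxE.
Qed.

Lemma cons_row_scale n (t a : R) (y : 'rV[R]_n) :
  cons_row (t * a, t *: y) = t *: (cons_row (a, y) : 'rV[R]_n.+1).
Proof.
by apply/rowP => i; rewrite ?(rowDE,rowZE); case: (unliftP ord0 i) => [j ->|->];
  rewrite ?cons_rowS ?cons_row0 ?rowDE ?rowZE ?mxE.
Qed.

Lemma cons_row_delta0 n : cons_row (1, 0) = (delta_mx 0 ord0 : 'rV[R]_n.+1).
Proof.
by apply/rowP => i; rewrite ?(rowDE,rowZE); case: (unliftP ord0 i) => [j ->|->];
  rewrite ?cons_rowS ?cons_row0 ?rowDE ?rowZE ?mxE.
Qed.

Lemma cons_row_deltaS n i : cons_row (0, delta_mx 0 i) = (delta_mx 0 (lift ord0 i) : 'rV[R]_n.+1).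
Proof.
by apply/rowP => k; rewrite ?(rowDE,rowZE); case: (unliftP ord0 k) => [j ->|->];
  rewrite ?cons_rowS ?cons_row0 ?rowDE ?rowZE ?mxE.
Qed.

Lemma cons_row_continuous2 n (a : R) :
  continuous (fun y : 'rV[R]_n => (cons_row (a, y) : 'rV[R]_n.+1)).
Proof.
apply: nonexpansive_continuous => y z; apply/norm_leP => // i.
rewrite rowBE; case: (unliftP ord0 i) => [j ->|->].
  by rewrite !cons_rowS; rewrite -rowBE; exact: norm_coord_le.
by rewrite !cons_row0 subrr normr0.
Qed.

Lemma cons_row_continuous1 n (y : 'rV[R]_n) :
  continuous (fun a : R => (cons_row (a, y) : 'rV[R]_n.+1)).
Proof.
apply: nonexpansive_continuous => a b; apply/norm_leP => // i.
rewrite rowBE; case: (unliftP ord0 i) => [j ->|->].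
  by rewrite !cons_rowS subrr normr0.
by rewrite !cons_row0.
Qed.

(** Induction on the dimension. A derivative in a later coordinate is handled on each slice by the
    induction hypothesis; one in the first coordinate by Fubini and the fundamental theorem of
    calculus. *)
Lemma integral_derive_0 n i (f d : 'rV[R]_n -> R) : cc d -> bounded_support f ->
  (forall x, is_derive x (delta_mx 0 i) f (d x)) ->
  (\int[borel_lebesgue R n]_x ((d : borel_space R n -> R) x)%:E = 0)%E.
Proof.
elim: n i f d => [[]//|n IH i f d ccd [r fr] fd].
have [cd [s ds]] := ccd.
case: (unliftP ord0 i) fd => [j ->|->] fd.
  rewrite (integral_cons (cc_integrable ccd)); apply: integral0_eq => a _.
  apply: (IH j (fun y => f (cons_row (a, y))) (fun y => d (cons_row (a, y)))).
  - split; first by move=> y; apply: continuous_comp; [exact: cons_row_continuous2|exact: cd].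
    by exists s => y sy; apply: ds; apply: lt_le_trans sy _; case: (norm_cons_ge a y).
  - by exists r => y ry; apply: fr; apply: lt_le_trans ry _; case: (norm_cons_ge a y).
  - move=> y; apply/is_derive_line; have /is_derive_line := fd (cons_row (a, y)).
    rewrite (_ : (fun t : R => _) = (fun t : R => f (cons_row (a, t *: delta_mx 0 j + y))))//.
    apply/funext => t; congr f.
    by rewrite -cons_row_deltaS -cons_row_scale -cons_row_add mulr0 add0r.
rewrite (integral_cons' (cc_integrable ccd)); apply: integral0_eq => y _.
apply: (@integral_derive1_0 (fun a => f (cons_row (a, y))) (fun a => d (cons_row (a, y))) (Num.max r s)).
- by move=> a; apply: continuous_comp; [exact: cons_row_continuous1|exact: cd].
- move=> a; apply/is_derive_line; have /is_derive_line := fd (cons_row (a, y)).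
  rewrite (_ : (fun t : R => _) = (fun t : R => f (cons_row (t *: 1 + a, y))))//.
  apply/funext => t; congr f.
  by rewrite -cons_row_delta0 -cons_row_scale -cons_row_add scaler0 add0r.
- move=> a; rewrite gt_max => /andP[ra _]; apply: fr; apply: lt_le_trans ra _.
  by case: (norm_cons_ge a y).
- move=> a; rewrite gt_max => /andP[_ ra]; apply: ds; apply: lt_le_trans ra _.
  by case: (norm_cons_ge a y).
Qed.

End compactly_supported.

Section bounded_support_theory.
Variables (R : realType) (N : nat).
Local Notation V := 'rV[R]_N.
Local Notation "''e_' i" := (delta_mx 0 i : V) (at level 8, i at level 2, format "''e_' i").
Implicit Types (f g : V -> R) (i j : 'I_N) (x v : V).

Lemma bounded_supportMl f g : bounded_support f -> bounded_support (fun x => f x * g x).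
Proof. by move=> [r H]; exists r => x /H ->; rewrite mul0r. Qed.

Lemma bounded_supportMr f g : bounded_support g -> bounded_support (fun x => f x * g x).
Proof. by move=> [r H]; exists r => x /H ->; rewrite mulr0. Qed.

Lemma bounded_support2 (h : R -> R -> R) f g : h 0 0 = 0 -> bounded_support f -> bounded_support g ->
  bounded_support (fun x => h (f x) (g x)).
Proof.
move=> h0 [r H] [s H']; exists (Num.max r s) => x; rewrite gt_max => /andP[/H -> /H' ->].
exact: h0.
Qed.

Lemma near_far (r : R) x : r < `|x| -> \forall y \near x, r < `|y|.
Proof.
move=> rx; have := @norm_continuous _ _ x.
by move/cvgrPdist_lt => /(_ (`|x| - r)); rewrite subr_gt0 => /(_ rx); apply: filterS => y;
  rewrite ltr_norml => /andP[_]; rewrite ltrBlDr addrC -ltrBlDr opprB addrC subrK.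
Qed.

Lemma bounded_support_partial i f : bounded_support f -> bounded_support (partial i f).
Proof.
move=> [r H]; exists r => x rx; rewrite /partial.
rewrite (near_eq_derive (g := fun=> 0)); first by case: (is_derive_cst (0:R) x 'e_i).
by near=> y; apply: H; near: y; exact: near_far.
Unshelve. all: by end_near. Qed.

Lemma ccP f : smooth f -> bounded_support f -> cc f.
Proof. by move=> sf bf; split => //; exact: smooth_continuous. Qed.

Lemma ccD f g : cc f -> cc g -> cc (fun x => f x + g x).
Proof.
move=> [cf bf] [cg bg]; split; last exact: (bounded_support2 (addr0 0)).
by move=> x; exact: cvgD (cf x) (cg x).
Qed.

Lemma ccMl f g : cc f -> continuous g -> cc (fun x => f x * g x).
Proof.
move=> [cf bf] cg; split; last exact: bounded_supportMl.
by move=> x; exact: cvgM (cf x) (cg x).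
Qed.

Lemma ccMr f g : continuous f -> cc g -> cc (fun x => f x * g x).
Proof.
move=> cf [cg bg]; split; last exact: bounded_supportMr.
by move=> x; exact: cvgM (cf x) (cg x).
Qed.

Lemma ccZ (c : R) f : cc f -> cc (fun x => c * f x).
Proof. by apply: ccMr; exact: cst_continuous. Qed.

Lemma ccN f : cc f -> cc (fun x => - f x).
Proof.
by move=> cf; rewrite (_ : (fun x => _) = (fun x => -1 * f x));
  [exact: ccZ|apply/funext => x; rewrite mulN1r].
Qed.

Lemma ccB f g : cc f -> cc g -> cc (fun x => f x - g x).
Proof. by move=> cf cg; apply: ccD => //; exact: ccN. Qed.

Lemma cc0 : cc (fun _ : V => 0 : R).
Proof. by split; [exact: cst_continuous|exists 0]. Qed.

Lemma cc_sum (I : Type) (s : seq I) (F : I -> V -> R) :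
  (forall k, cc (F k)) -> cc (fun x => \sum_(k <- s) F k x).
Proof.
move=> cF; elim: s => [|k s IH].
  rewrite (_ : (fun x => _) = (fun=> 0)); first exact: cc0.
  by apply/funext => x; rewrite big_nil.
rewrite (_ : (fun x => _) = (fun x => F k x + \sum_(k <- s) F k x)); first exact: ccD.
by apply/funext => x; rewrite big_cons.
Qed.

Lemma bintD f g : cc f -> cc g -> bint (fun x => f x + g x) = bint f + bint g.
Proof. by move=> cf cg; apply: RintegralD => //; exact: cc_integrable. Qed.

Lemma bintB f g : cc f -> cc g -> bint (fun x => f x - g x) = bint f - bint g.
Proof. by move=> cf cg; apply: RintegralB => //; exact: cc_integrable. Qed.

Lemma bintZ (c : R) f : cc f -> bint (fun x => c * f x) = c * bint f.
Proof. by move=> cf; apply: RintegralZl => //; exact: cc_integrable. Qed.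

Lemma le_bint f g : cc f -> cc g -> (forall x, f x <= g x) -> bint f <= bint g.
Proof. by move=> cf cg H; apply: le_Rintegral => //; exact: cc_integrable. Qed.

Lemma bint_ge0 f : (forall x, 0 <= f x) -> 0 <= bint f.
Proof. by move=> H; apply: Rintegral_ge0. Qed.

Lemma eq_bint f g : (forall x, f x = g x) -> bint f = bint g.
Proof. by move=> H; congr bint; exact/funext. Qed.

Lemma bint0 : bint (fun _ : V => 0 : R) = 0.
Proof. by rewrite /bint Rintegral_cst// mul0r. Qed.

Lemma bint_sum (I : Type) (s : seq I) (F : I -> V -> R) :
  (forall k, cc (F k)) -> bint (fun x => \sum_(k <- s) F k x) = \sum_(k <- s) bint (F k).
Proof.
move=> cF; elim: s => [|k s IH].
  by rewrite big_nil -[RHS]bint0; apply: eq_bint => x; rewrite big_nil.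
rewrite big_cons -IH -bintD//; last exact: cc_sum.
by apply: eq_bint => x; rewrite big_cons.
Qed.

Lemma bint_partial i f : smooth f -> bounded_support f -> bint (partial i f) = 0.
Proof.
move=> sf bf.
have cd : cc (partial i f) by apply: ccP; [exact: smooth_partial|exact: bounded_support_partial].
have E := integral_derive_0 cd bf (fun x => smooth_is_derive i x sf).
by rewrite /bint /Rintegral E.
Qed.

(** If [f x] were positive, continuity would keep [f] above [f x / 2] on a small cube around [x],
    which has positive measure. *)
Lemma bint_eq0 f : cc f -> (forall x, 0 <= f x) -> bint f = 0 -> forall x, f x = 0.
Proof.
move=> ccf f0 If x; apply/eqP; rewrite eq_le f0 andbT leNgt; apply/negP => fx.
have [cf _] := ccf.
have f2 : 0 < f x / 2 by rewrite divr_gt0.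
have /cvgrPdist_lt/(_ _ f2)/nbhs_ballP[d /= d0 Hd] := cf x.
pose a i := x 0 i - d / 2; pose b i := x 0 i + d / 2.
have mA := measurable_cube a b.
have bA (y : V) : cube a b y -> f x / 2 <= f y.
  move=> yA; have : ball x d y.
    apply/(ball_coordP _ _ d0) => i; have := yA i; rewrite in_itv /= /a /b => /andP[h1 h2].
    by rewrite ltr_norml; apply/andP; split; lra.
  by move/Hd => /=; rewrite ltr_norml => /andP[h1 h2]; lra.
have : (0 < \int[borel_lebesgue R N]_(y in setT) ((f : borel_space R N -> R) y)%:E)%E.
  apply: (@lt_le_trans _ _ (\int[borel_lebesgue R N]_(y in cube a b) (f x / 2)%:E)%E).
    have : (0 < borel_lebesgue R N (cube a b))%E.
      rewrite borel_lebesgue_cube; last by move=> i; rewrite /a /b; lra.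
      by rewrite lte_fin prodr_gt0// => i _; rewrite /a /b; lra.
    by rewrite integral_cst// => A0; rewrite mule_gt0 ?lte_fin.
  apply: (@le_trans _ _ (\int[borel_lebesgue R N]_(y in cube a b) ((f : borel_space R N -> R) y)%:E)%E).
    apply: ge0_le_integral => //.
    - by move=> y _; rewrite lee_fin ltW.
    - by apply/measurable_EFinP; apply: measurable_funTS; exact: continuous_borel.
  apply: ge0_subset_integral => //.
  - by apply/measurable_EFinP; exact: continuous_borel.
  - by move=> y _; rewrite lee_fin.
move: If; rewrite /bint /Rintegral => /eqP; rewrite fine_eq0; last first.
  exact: (integrable_fin_num _ (cc_integrable ccf)).
by move=> /eqP ->; rewrite ltxx.
Qed.

End bounded_support_theory.

(** * The Carleman inequality *)

Section differential_operators.
Variables (R : realType) (N : nat) (x0 : 'rV[R]_N).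
Local Notation V := 'rV[R]_N.
Implicit Types (f g h : V -> R) (i j : 'I_N) (x v : V).

Definition lap f : V -> R := fun x => \sum_i partial i (partial i f) x.
Definition grd f g : V -> R := fun x => \sum_i partial i f x * partial i g x.
Definition rad2 : V -> R := fun x => \sum_i (x 0 i - x0 0 i) ^+ 2.
(** The derivative along the dilation field x - x0; it is the leading part of the multiplier in the
    Carleman identity. *)
Definition euler f : V -> R := fun x => \sum_i (x 0 i - x0 0 i) * partial i f x.

Lemma smooth_lap f : smooth f -> smooth (lap f).
Proof. by move=> sf; apply: smooth_sum => i _; do 2 apply: smooth_partial. Qed.

Lemma smooth_grd f g : smooth f -> smooth g -> smooth (grd f g).
Proof.
by move=> sf sg; apply: smooth_sum => i _; apply: smoothM; exact: smooth_partial.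
Qed.

Lemma smooth_shift_coord i : smooth (fun x : V => x 0 i - x0 0 i).
Proof. by apply: smoothB; [exact: smooth_coord|exact: smooth_cst]. Qed.

Lemma smooth_rad2 : smooth rad2.
Proof. by apply: smooth_sum => i _; apply: smoothX; exact: smooth_shift_coord. Qed.

Lemma smooth_euler f : smooth f -> smooth (euler f).
Proof.
move=> sf; apply: smooth_sum => i _; apply: smoothM; first exact: smooth_shift_coord.
exact: smooth_partial.
Qed.

Lemma rad2_ge0 x : 0 <= rad2 x.
Proof. by apply: sumr_ge0 => i _; exact: sqr_ge0. Qed.

Lemma partial_shift_coord i j x : partial j (fun x : V => x 0 i - x0 0 i) x = (i == j)%:R.
Proof.
rewrite partialB ?partial_cst ?subr0 ?partial_coord//; [exact: smooth_coord|exact: smooth_cst].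
Qed.

Lemma partial_rad2 i x : partial i rad2 x = 2 * (x 0 i - x0 0 i).
Proof.
rewrite /rad2 partial_sum; last by move=> k; apply: smoothX; exact: smooth_shift_coord.
rewrite (bigD1 i)//= big1 ?addr0 => [|j ji].
  by rewrite partialX ?partial_shift_coord ?eqxx ?mulr1//; exact: smooth_shift_coord.
by rewrite partialX ?partial_shift_coord ?(negbTE ji) ?mulr0//; exact: smooth_shift_coord.
Qed.

Lemma bounded_supportX f n : (0 < n)%N -> bounded_support f ->
  bounded_support (fun x => f x ^+ n).
Proof. by move=> n0 [r H]; exists r => x /H ->; rewrite expr0n gtn_eqF. Qed.

Lemma partial0_open i f (U : set V) x : open U -> (forall y, U y -> f y = 0) -> U x ->
  partial i f x = 0.
Proof.
move=> oU f0 Ux; rewrite /partial (near_eq_derive (g := fun=> 0)).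
  by case: (is_derive_cst (0:R) x (delta_mx 0 i)).
have : nbhs x U by exact: open_nbhs_nbhs.
by apply: filterS => y; exact: f0.
Qed.

Lemma partial0_far i f (r : R) : (forall y, r < `|y| -> f y = 0) ->
  forall y, r < `|y| -> partial i f y = 0.
Proof.
move=> f0 y ry; apply: (@partial0_open i f [set y | r < `|y|]) => //.
by rewrite openE => z rz; exact: near_far.
Qed.

Lemma lapM f g x : smooth f -> smooth g ->
  lap (fun x => f x * g x) x = f x * lap g x + 2 * grd f g x + g x * lap f x.
Proof.
move=> sf sg; rewrite /lap /grd !mulr_sumr -!big_split/=; apply: eq_bigr => i _.
have -> : partial i (fun x => f x * g x) = fun x => f x * partial i g x + g x * partial i f x.
  by apply/funext => y; rewrite partialM.
have [sf' sg'] := (smooth_partial i sf, smooth_partial i sg).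
rewrite partialD; [|exact: smoothM|exact: smoothM].
rewrite !partialM//.
move: (f x) (g x) (partial i f x) (partial i g x) (partial i (partial i f) x) (partial i (partial i g) x) => *; ring.
Qed.

Lemma grdC f g x : grd f g x = grd g f x.
Proof. by apply: eq_bigr => i _; rewrite mulrC. Qed.

Lemma grdD f g h x : smooth g -> smooth h -> grd f (fun x => g x + h x) x = grd f g x + grd f h x.
Proof.
by move=> sg sh; rewrite /grd -big_split /=; apply: eq_bigr => i _; rewrite partialD// mulrDr.
Qed.

Lemma grdM f g h x : smooth g -> smooth h ->
  grd f (fun x => g x * h x) x = g x * grd f h x + h x * grd f g x.
Proof.
move=> sg sh; rewrite /grd !mulr_sumr -!big_split /=; apply: eq_bigr => i _.
rewrite partialM// mulrDr mulrCA; congr (_ + _); exact: mulrCA.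
Qed.

Lemma eulerM g h x : smooth g -> smooth h ->
  euler (fun x => g x * h x) x = g x * euler h x + h x * euler g x.
Proof.
move=> sg sh; rewrite /euler !mulr_sumr -!big_split /=; apply: eq_bigr => i _.
rewrite partialM// mulrDr mulrCA; congr (_ + _); exact: mulrCA.
Qed.

(** The commutation behind Pohozaev identities: the i-th derivative of [euler f] is [partial i f]
    plus [euler] of [partial i f]. Contracted with the gradient, the latter is half of
    [euler (grd f f)]. *)
Lemma grd_euler f x : smooth f ->
  2 * grd f (euler f) x = 2 * grd f f x + euler (grd f f) x.
Proof.
move=> sf; rewrite /grd /euler.
have E i : partial i (fun x => \sum_j (x 0 j - x0 0 j) * partial j f x) x =
    partial i f x + \sum_j (x 0 j - x0 0 j) * partial i (partial j f) x.
  rewrite partial_sum; last first.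
    by move=> j; apply: smoothM; [exact: smooth_shift_coord|exact: smooth_partial].
  rewrite (eq_bigr (fun j => (x 0 j - x0 0 j) * partial i (partial j f) x +
    partial j f x * (j == i)%:R)); last first.
    move=> j _; rewrite partialM ?partial_shift_coord//; [exact: smooth_shift_coord|exact: smooth_partial].
  rewrite big_split /= addrC; congr (_ + _).
  rewrite (bigD1 i)//= eqxx mulr1 big1 ?addr0// => j /negbTE ->; by rewrite mulr0.
under eq_bigr do rewrite E mulrDr.
rewrite big_split /= mulrDr; congr (_ + _).
have F j : partial j (fun x => \sum_i partial i f x * partial i f x) x =
    \sum_i 2 * (partial i f x * partial j (partial i f) x).
  rewrite partial_sum; last by move=> i; apply: smoothM; exact: smooth_partial.
  by apply: eq_bigr => i _; rewrite partialM ?mulr2n ?mulrDl ?mul1r//; exact: smooth_partial.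
under [RHS]eq_bigr do rewrite F mulr_sumr.
rewrite exchange_big /= mulr_sumr; apply: eq_bigr => i _.
rewrite !mulr_sumr; apply: eq_bigr => j _.
rewrite (partialC i j sf).
move: (partial i f x) (partial j (partial i f) x) (x 0 j - x0 0 j) => A B C; ring.
Qed.

Lemma euler_divergence h x : smooth h ->
  \sum_i partial i (fun x => (x 0 i - x0 0 i) * h x) x = N%:R * h x + euler h x.
Proof.
move=> sh; rewrite (eq_bigr (fun i => h x + (x 0 i - x0 0 i) * partial i h x)).
  by rewrite big_split /= sumr_const card_ord mulr_natl.
move=> i _; rewrite partialM//; last exact: smooth_shift_coord.
by rewrite partial_shift_coord eqxx mulr1 addrC.
Qed.

Lemma grd_divergence f h x : smooth f -> smooth h ->
  \sum_i partial i (fun x => partial i f x * h x) x = lap f x * h x + grd f h x.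
Proof.
move=> sf sh; rewrite /lap /grd mulr_suml -big_split /=; apply: eq_bigr => i _.
rewrite partialM//; last exact: smooth_partial.
by rewrite addrC [h x * _]mulrC.
Qed.

Lemma bounded_support_lap f : bounded_support f -> bounded_support (lap f).
Proof.
move=> [r H]; exists r => x rx; rewrite /lap big1// => i _.
apply: (@partial0_far i (partial i f) r) => //; exact: (@partial0_far i f r H).
Qed.

Lemma bint_divergence (X : 'I_N -> V -> R) (D : V -> R) :
  (forall i, smooth (X i)) -> (forall i, bounded_support (X i)) ->
  (forall x, D x = \sum_i partial i (X i) x) -> bint D = 0.
Proof.
move=> sX bX DE; rewrite (eq_bint DE) bint_sum; last first.
  move=> i; apply: ccP; [exact: smooth_partial|exact: bounded_support_partial].
by rewrite big1// => i _; exact: bint_partial.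
Qed.

End differential_operators.

Section carleman.
Variables (R : realType) (N : nat) (x0 : 'rV[R]_N) (n : nat) (eps : R).
Hypotheses (n0 : (0 < n)%N) (eps0 : 0 < eps) (eps2 : eps <= 1 / 2).
Local Notation V := 'rV[R]_N.
Implicit Types (f g h : V -> R) (i j : 'I_N) (x v : V).
Local Notation s := (rad2 x0).
Local Notation E := (euler x0).
Local Notation nu := (n%:R : R).

Definition cq x : R := (s x + eps)^-1.
Definition cweight x : R := (cq x) ^+ n * expR (nu * s x).
Local Notation q := cq.
Local Notation a := cweight.

(* [radial g g1] means g = G(|x-x0|^2), g1 = G'(|x-x0|^2) *)
Definition radial g g1 := smooth g /\ forall i x, partial i g x = 2 * (x 0 i - x0 0 i) * g1 x.

Lemma radial_euler g g1 x : radial g g1 -> E g x = 2 * s x * g1 x.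
Proof.
move=> [_ H]; rewrite /euler /rad2 mulr_sumr mulr_suml; apply: eq_bigr => i _.
by rewrite H expr2; ring.
Qed.

Lemma radial_grd f g g1 x : radial g g1 -> grd f g x = 2 * g1 x * E f x.
Proof.
move=> [_ H]; rewrite /euler /grd mulr_sumr; apply: eq_bigr => i _.
by rewrite H; ring.
Qed.

Lemma radialD g g1 h h1 : radial g g1 -> radial h h1 ->
  radial (fun x => g x + h x) (fun x => g1 x + h1 x).
Proof.
move=> [sg Hg] [sh Hh]; split; first exact: smoothD.
by move=> i x; rewrite partialD// Hg Hh; ring.
Qed.

Lemma radialM g g1 h h1 : radial g g1 -> radial h h1 ->
  radial (fun x => g x * h x) (fun x => g x * h1 x + h x * g1 x).
Proof.
move=> [sg Hg] [sh Hh]; split; first exact: smoothM.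
by move=> i x; rewrite partialM// Hg Hh; ring.
Qed.

Lemma radial_cst (c : R) : radial (fun=> c) (fun=> 0).
Proof. by split; [exact: smooth_cst|move=> i x; rewrite partial_cst mulr0]. Qed.

Lemma radial_rad2 : radial s (fun=> 1).
Proof. by split; [exact: smooth_rad2|move=> i x; rewrite partial_rad2 mulr1]. Qed.

Lemma rad2_eps_gt0 x : 0 < s x + eps.
Proof. by rewrite ltr_wpDl// rad2_ge0. Qed.

Lemma radial_q : radial q (fun x => - q x ^+ 2).
Proof.
have d0 x : s x + eps != 0 by rewrite gt_eqF// rad2_eps_gt0.
have sd : smooth (fun x => s x + eps) by apply: smoothD; [exact: smooth_rad2|exact: smooth_cst].
split; first exact: smoothV.
move=> i x; have := is_deriveXV 1 (d0 x) => H.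
rewrite /cq (partial_comp i (h := fun t => (t ^+ 1)^-1) sd H).
rewrite partialD; [|exact: smooth_rad2|exact: smooth_cst].
by rewrite partial_rad2 partial_cst addr0 exprVn mulN1r; ring.
Qed.

Lemma radial_weight : radial a (fun x => a x * (nu * (1 - q x))).
Proof.
have [sq Hq] := radial_q.
have se : smooth (fun x => nu * s x) by apply: smoothZ; exact: smooth_rad2.
split; first by apply: smoothM; [exact: smoothX|exact: smooth_expR].
move=> i x; rewrite /cweight partialM; [|exact: smoothX|exact: smooth_expR].
rewrite partialX// Hq (partial_comp i se (is_derive_expR _)) partialZ; last exact: smooth_rad2.
have -> : q x ^+ n = q x * q x ^+ n.-1 by rewrite -exprS prednK.
rewrite partial_rad2 expr2.
by move: (expR _) (q x ^+ _) => X Y; ring.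
Qed.

(** The logarithmic derivative of the weight with respect to s. *)
Definition cb x : R := nu * (1 - q x).
(** Chosen to cancel the gradient: integrating [lap f * a * E f] by parts produces a multiple of
    [a * grd f f] with exactly this coefficient, because [E a = 2 * s * a * cb]. The functions [cK1]
    and [cK2] are its first and second derivatives in s. *)
Definition cK x : R := N%:R / 2 - 1 + s x * cb x.
Definition cK1 x : R := cb x + s x * (nu * q x ^+ 2).
Definition cK2 x : R := 2 * nu * q x ^+ 2 * (1 - s x * q x).

Lemma radial_cb : radial cb (fun x => nu * q x ^+ 2).
Proof.
have := radialM (radial_cst nu) (radialD (radial_cst 1) (radialM (radial_cst (-1)) radial_q)).
rewrite (_ : (fun x => nu * _) = cb); last by apply/funext => x; rewrite mulN1r.
congr radial; apply/funext => x; ring.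
Qed.

Lemma radial_cK : radial cK cK1.
Proof.
have := radialD (radial_cst (N%:R / 2 - 1)) (radialM radial_rad2 radial_cb).
congr radial; apply/funext => x; rewrite /cK1; ring.
Qed.

Lemma radial_cK1 : radial cK1 cK2.
Proof.
have := radialD radial_cb (radialM radial_rad2 (radialM (radial_cst nu) (radialM radial_q radial_q))).
congr radial; apply/funext => x; rewrite /cK1 /cK2; ring.
Qed.

Definition cP f x := a x * (E f x + cK x * f x).

(** The multiplier method: [lap f] is tested against [cP f], and the integrand is an exact
    divergence. By the choice of [cK] no gradient term survives; the derivative of the weight
    produces [2 * a * cb * (E f)^2], which is completed to a square, and the rest is a multiple of
    f^2. *)
Lemma carleman_identity f : smooth f -> bounded_support f ->
  bint (fun x => lap f x * cP f x + 2 * (a x * cb x) * (E f x + cK x * f x) ^+ 2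
     - a x * (cK1 x * (N%:R - 2 * cK x) + 2 * s x * cK2 x) * f x ^+ 2) = 0.
Proof.
move=> sf bf.
have [[sa _] [sK _] [sK1 _] [sb _]] :=
  And4 radial_weight radial_cK radial_cK1 radial_cb.
have sE := smooth_euler x0 sf.
have sG := smooth_grd sf sf.
have sEK : smooth (fun x => E f x + cK x * f x) by apply: smoothD => //; exact: smoothM.
have sP : smooth (cP f) by exact: smoothM.
(* The radial field with density [m * f ^+ 2] is added to the divergence. This [m] turns the terms
   in [f * E f] into the cross term [4 * a * cb * cK * f * E f] of the completed square. *)
pose m x := a x * (cb x * cK x - cK1 x).
have rm : radial m (fun x => a x * (cb x * cK1 x + cK x * (nu * q x ^+ 2) - cK2 x)
    + (cb x * cK x - cK1 x) * (a x * cb x)).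
  have := radialM radial_weight (radialD (radialM radial_cb radial_cK) (radialM (radial_cst (-1)) radial_cK1)).
  rewrite (_ : (fun x => a x * _) = m); last by apply/funext => x; rewrite /m mulN1r.
  congr radial; apply/funext => x; rewrite -/(cb x); ring.
have [sm _] := rm.
pose h1 x := 1 / 2 * (a x * grd f f x).
pose h2 x := m x * (f x * f x).
have sh1 : smooth h1 by apply: smoothZ; exact: smoothM.
have sh2 : smooth h2 by apply: smoothM => //; exact: smoothM.
apply: (@bint_divergence _ _ (fun i x => partial i f x * cP f x +
   ((x 0 i - x0 0 i) * h2 x - (x 0 i - x0 0 i) * h1 x))).
- move=> i; apply: smoothD; first by apply: smoothM => //; exact: smooth_partial.
  by apply: smoothB; apply: smoothM => //; exact: smooth_shift_coord.
- move=> i.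
  have b1 : bounded_support (grd f f).
    have [r H] := bf; exists r => x rx; rewrite /grd big1// => k _.
    by rewrite (@partial0_far _ _ k f r H)// mul0r.
  apply: (bounded_support2 (addr0 0)); first by apply: bounded_supportMl; exact: bounded_support_partial.
  apply: (@bounded_support2 _ _ (fun a b => a - b) _ _ (subr0 0)).
    by do 2 apply: bounded_supportMr; exact: bounded_supportMl.
  by do 3 apply: bounded_supportMr.
move=> x.
rewrite (eq_bigr (fun i => partial i (fun x => partial i f x * cP f x) x +
   (partial i (fun x => (x 0 i - x0 0 i) * h2 x) x - partial i (fun x => (x 0 i - x0 0 i) * h1 x) x))); last first.
  move=> i _.
  have c0 := smooth_shift_coord x0 i.
  have c1 := smoothM (smooth_partial i sf) sP.
  have c2 := smoothM c0 sh1.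
  have c3 := smoothM c0 sh2.
  by rewrite partialD// ?partialB//; exact: smoothB.
rewrite big_split /= sumrB grd_divergence// !euler_divergence//.
rewrite /h2 eulerM//; last exact: smoothM.
rewrite eulerM// (radial_euler _ rm).
have -> : E h1 x = 1 / 2 * (a x * E (grd f f) x + grd f f x * E a x).
  rewrite /h1 eulerM; [|exact: smooth_cst|exact: smoothM].
  rewrite eulerM//.
  have -> : E (fun=> 1/2) x = 0 by rewrite /euler big1// => i _; rewrite partial_cst mulr0.
  by rewrite mulr0 addr0.
rewrite (radial_euler _ radial_weight).
have -> : E (grd f f) x = 2 * grd f (E f) x - 2 * grd f f x by rewrite grd_euler//; ring.
rewrite /cP grdM// (radial_grd _ _ radial_weight) grdD//; last exact: smoothM.
rewrite grdM// (radial_grd _ _ radial_cK) /h1 /m.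
rewrite /cP /cK2 /cK1 -/(cb x).
move: (lap f x) (grd f (E f) x) (grd f f x) (E f x) (f x) (a x) => L GE G Ef fx ax.
rewrite /cK /cb; move: (q x) (s x) => qx sx.
by field.
Qed.

Lemma weight_gt0 x : 0 < a x.
Proof.
by rewrite mulr_gt0 ?expR_gt0// exprn_gt0// invr_gt0 rad2_eps_gt0.
Qed.

Lemma euler0_open f (U : set V) x : open U -> (forall y, U y -> f y = 0) -> U x -> E f x = 0.
Proof.
by move=> oU f0 Ux; rewrite /euler big1// => i _; rewrite (partial0_open _ oU f0)// mulr0.
Qed.

Lemma lap0_open f (U : set V) x : open U -> (forall y, U y -> f y = 0) -> U x -> lap f x = 0.
Proof.
move=> oU f0 Ux; rewrite /lap big1// => i _.
by apply: (partial0_open _ oU _ Ux) => y Uy; exact: (partial0_open _ oU f0).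
Qed.

(** The pointwise content of the Carleman inequality: [LL], [XX], [ff], [aa] stand for [lap f],
    [E f + cK * f], [f] and the weight. Where (ss + ee)^2 >= 2 ee the coefficient of [ff ^+ 2] is at
    least nn^2 / 4; elsewhere its possible loss is charged to [th], with [cc] bounding the
    weight. *)
Lemma carleman_scalar (nn ee ss aa LL XX ff th cc : R) :
  1 <= nn -> 0 < ee -> ee <= 1/2 -> 0 <= ss -> ss + ee <= 1/2 -> 0 < aa -> 0 <= th -> 0 <= cc ->
  aa <= cc -> ((ss + ee) ^+ 2 < 2 * ee -> 1 <= th) ->
  let qq := (ss + ee)^-1 in let bb := nn * (1 - qq) in
  let KK := N%:R / 2 - 1 + ss * bb in let K1 := bb + ss * (nn * qq ^+ 2) in
  let K2 := 2 * nn * qq ^+ 2 * (1 - ss * qq) in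
  nn ^+ 2 / 4 * (aa * ff ^+ 2) - (8 * nn)^-1 * (aa * LL ^+ 2)
    - 5 * nn ^+ 2 / ee * cc * (th * ff ^+ 2) <=
  aa * (K1 * (N%:R - 2 * KK) + 2 * ss * K2) * ff ^+ 2 - LL * (aa * XX) - 2 * (aa * bb) * XX ^+ 2.
Proof.
move=> n1 e0 e2 s0 se a0 th0 c0 ac thb /=.
set q0 := (ss + ee)^-1.
have d0 : 0 < ss + ee by lra.
have q2 : 2 <= q0 by rewrite /q0 -[2]invrK lef_pV2 ?posrE ?invr_gt0//; lra.
have sq1 : ss * q0 = 1 - ee * q0.
  by rewrite /q0 -[1](divff (lt0r_neq0 d0)) -mulrBl addrK.
have eq1 : 0 < ee * q0 by rewrite mulr_gt0// (lt_le_trans _ q2).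
have eq2 : ee * q0 <= 1 by rewrite ler_pdivrMr// mul1r; lra.
have -> : nn * (1 - q0) + ss * (nn * q0 ^+ 2) = nn * (1 - ee * q0 ^+ 2).
  have -> : ss * (nn * q0 ^+ 2) = nn * q0 * (ss * q0) by ring.
  rewrite sq1; ring.
have -> : N%:R - 2 * (N%:R / 2 - 1 + ss * (nn * (1 - q0))) = 2 + 2 * nn * (ss * q0 - ss).
  by field.
rewrite [1 - ss * q0](_ : _ = ee * q0); last by rewrite sq1; ring.
(* Since [q0 >= 2], the factor [nn * (1 - q0)] is at most [- nn], so the square enters with a
   favourable sign and absorbs the product with [LL]. *)
have XL : - LL * (aa * XX) - 2 * (aa * (nn * (1 - q0))) * XX ^+ 2 >= - (8 * nn)^-1 * (aa * LL ^+ 2).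
  have H : 0 <= aa * (nn * XX - LL / 4) ^+ 2 * 2 / nn.
    apply: divr_ge0; last lra.
    apply: mulr_ge0 => //; apply: mulr_ge0; [exact: ltW|exact: sqr_ge0].
  have H2 : 2 * (aa * (nn * (q0 - 1))) * XX ^+ 2 >= 2 * (aa * nn) * XX ^+ 2.
    apply: ler_wpM2r; first exact: sqr_ge0.
    by rewrite !mulrA ler_peMr ?mulr_ge0//; lra.
  have E1 : aa * (nn * XX - LL / 4) ^+ 2 * 2 / nn =
     2 * (aa * nn) * XX ^+ 2 - LL * (aa * XX) + (8 * nn)^-1 * (aa * LL ^+ 2).
    by field; lra.
  rewrite E1 in H; lra.
suff : nn ^+ 2 / 4 * (aa * ff ^+ 2) - 5 * nn ^+ 2 / ee * cc * (th * ff ^+ 2) <=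
   aa * (nn * (1 - ee * q0 ^+ 2) * (2 + 2 * nn * (ss * q0 - ss)) +
     2 * ss * (2 * nn * q0 ^+ 2 * (ee * q0))) * ff ^+ 2.
  by move: XL; lra.
have -> : nn ^+ 2 / 4 * (aa * ff ^+ 2) - 5 * nn ^+ 2 / ee * cc * (th * ff ^+ 2) =
  (nn ^+ 2 / 4 * aa - 5 * nn ^+ 2 / ee * cc * th) * ff ^+ 2 by ring.
apply: ler_wpM2r; first exact: sqr_ge0.
have K2p : 0 <= aa * (2 * ss * (2 * nn * q0 ^+ 2 * (ee * q0))).
  by rewrite !mulr_ge0 ?sqr_ge0//; lra.
suff : nn ^+ 2 / 4 * aa - 5 * nn ^+ 2 / ee * cc * th <=
   aa * (nn * (1 - ee * q0 ^+ 2) * (2 + 2 * nn * (ss * q0 - ss))) by move: K2p; lra.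
have sqs : 0 <= ss * q0 - ss by nra.
(* In the small ball [1 - ee * q0 ^+ 2] may be as low as -1/ee. The other factor is at most 4 nn, so
   the loss is 4 nn^2 / ee; the claimed nn^2 / 4 is at most nn^2 / ee, which makes 5. *)
have [bad|good] := ltP ((ss + ee) ^+ 2) (2 * ee).
  have th1 := thb bad.
  have ct : aa <= cc * th by apply: le_trans ac _; rewrite ler_peMr.
  have e1 : 1 - ee * q0 ^+ 2 >= - (1 / ee).
    have : ee * q0 ^+ 2 <= 1 / ee.
      rewrite ler_pdivlMr// [leLHS](_ : _ = (ee * q0) ^+ 2); last ring.
      by rewrite expr_le1// ltW.
    lra.
  have w0 : 0 <= 2 + 2 * nn * (ss * q0 - ss) by nra.
  have w1 : 2 + 2 * nn * (ss * q0 - ss) <= 4 * nn by nra.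
  have step : aa * (nn * (1 - ee * q0 ^+ 2) * (2 + 2 * nn * (ss * q0 - ss))) >= - (4 * nn ^+ 2 / ee * aa).
    have : nn * (1 - ee * q0 ^+ 2) * (2 + 2 * nn * (ss * q0 - ss)) >= - (4 * nn ^+ 2 / ee).
      have t1 : - (nn / ee) <= nn * (1 - ee * q0 ^+ 2).
        have := ler_wpM2l (ltW (lt_le_trans ltr01 n1)) e1; rewrite mulrN mul1r; lra.
      apply: (@le_trans _ _ (- (nn / ee) * (2 + 2 * nn * (ss * q0 - ss)))).
        have ne0 : 0 <= nn / ee by rewrite divr_ge0//; lra.
        have := ler_wpM2l ne0 w1.
        rewrite [X in _ <= X -> _](_ : _ = 4 * nn ^+ 2 / ee); last by field; lra.
        lra.
      exact: ler_wpM2r.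
    move/(ler_wpM2l (ltW a0)); lra.
  apply: le_trans step.
  have ee2 : nn ^+ 2 / 4 <= nn ^+ 2 / ee.
    apply: ler_wpM2l; first exact: sqr_ge0.
    by rewrite lef_pV2 ?posrE//; lra.
  have ne : 0 <= nn ^+ 2 / ee by rewrite divr_ge0 ?sqr_ge0//; lra.
  have := ler_wpM2l ne ct; have := ler_wpM2r (ltW a0) ee2; lra.
have cth : 0 <= 5 * nn ^+ 2 / ee * cc * th.
  by rewrite !mulr_ge0 ?sqr_ge0 ?invr_ge0//; lra.
suff : nn ^+ 2 / 4 * aa <= aa * (nn * (1 - ee * q0 ^+ 2) * (2 + 2 * nn * (ss * q0 - ss))).
  by move: cth; lra.
rewrite mulrC; apply: ler_wpM2l; first exact: ltW.
(* Outside the small ball both [ee * q0 ^+ 2] and [ee * q0] are at most 1/2, so each of the two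
   factors is at least nn / 2. *)
have g1 : 1 - ee * q0 ^+ 2 >= 1 / 2.
  have : ee * q0 ^+ 2 <= 1 / 2.
    rewrite /q0 exprVn ler_pdivrMr ?exprn_gt0//; lra.
  lra.
have g2 : ee * q0 <= 1 / 2.
  rewrite ler_pdivrMr//.
  have : (2 * ee) ^+ 2 <= (ss + ee) ^+ 2 by apply: le_trans good; nra.
  by rewrite ler_sqr ?nnegrE; [lra|lra|exact: ltW].
have g3 : 1 / 4 <= ss * q0 - ss.
  have : ss * q0 - ss = ss * q0 * (1 - (ss + ee)).
    by rewrite mulrBr mulr1 -mulrA mulVf ?mulr1// gt_eqF.
  move=> ->; rewrite sq1; nra.
have g4 : nn / 2 <= 2 + 2 * nn * (ss * q0 - ss) by nra.
have g5 : nn / 2 <= nn * (1 - ee * q0 ^+ 2) by nra.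
have g6 : 0 <= nn / 2 by lra.
by have := ler_pM g6 g6 g5 g4; rewrite expr2; lra.
Qed.

Lemma weight_le x : s x <= 1 -> a x <= eps ^- n * expR nu.
Proof.
move=> s1; apply: ler_pM.
- by rewrite exprn_ge0// invr_ge0 ltW// rad2_eps_gt0.
- exact: expR_ge0.
- have d0 := rad2_eps_gt0 x.
  have qe : q x <= eps^-1 by rewrite lef_pV2 ?posrE// lerDr rad2_ge0.
  by rewrite -exprVn lerXn2r// nnegrE invr_ge0 ltW.
- by rewrite ler_expR ler_piMr.
Qed.

(** The pointwise inequality [carleman_scalar] is integrated against [carleman_identity]. The
    function [th] stands for a cutoff dominating the small ball. *)
Lemma carleman_inequality f (th : V -> R) : smooth f -> bounded_support f ->
  continuous th -> (forall x, 0 <= th x) ->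
  (forall x, 1 / 2 < s x + eps -> f x = 0) ->
  (forall x, (s x + eps) ^+ 2 < 2 * eps -> 1 <= th x) ->
  nu ^+ 3 * bint (fun x => a x * f x ^+ 2) <=
  bint (fun x => a x * lap f x ^+ 2) +
  40 * nu ^+ 3 * (eps ^- n.+1 * expR nu) * bint (fun x => th x * f x ^+ 2).
Proof.
move=> sf bf cth th0 fout thin.
have [[sa _] [sK _] [sK1 _] [sb _]] :=
  And4 radial_weight radial_cK radial_cK1 radial_cb.
have sE := smooth_euler x0 sf.
have ca := smooth_continuous sa.
have nu1 : 1 <= nu by rewrite ler1n.
have cf2 : cc (fun x => f x ^+ 2).
  by apply: ccP; [exact: smoothX|exact: bounded_supportX].
have cl2 : cc (fun x => lap f x ^+ 2).
  apply: ccP; first exact/smoothX/smooth_lap.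
  by apply: bounded_supportX => //; exact: bounded_support_lap.
have c1 := ccMr ca cf2.
have c2 := ccMr ca cl2.
have c3 := ccMr cth cf2.
pose C := 5 * nu ^+ 2 / eps * (eps ^- n * expR nu).
pose G x := lap f x * cP f x + 2 * (a x * cb x) * (E f x + cK x * f x) ^+ 2
     - a x * (cK1 x * (N%:R - 2 * cK x) + 2 * s x * cK2 x) * f x ^+ 2.
have bE : bounded_support (E f).
  by have [r H] := bf; exists r => x rx; rewrite /euler big1// => i _; rewrite (@partial0_far _ _ i f r H)// mulr0.
have sX : smooth (fun x => E f x + cK x * f x) by apply: smoothD => //; exact: smoothM.
have bX : bounded_support (fun x => E f x + cK x * f x).
  by apply: (bounded_support2 (addr0 0)) => //; exact: bounded_supportMr.
have sK2 : smooth cK2.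
  have [sq _] := radial_q.
  apply: smoothM; first by apply: smoothZ; exact: smoothX.
  by apply: smoothB; [exact: smooth_cst|apply: smoothM => //; exact: smooth_rad2].
have cG : cc G.
  apply: ccB; first apply: ccD.
  - apply: ccMl; last by apply: smooth_continuous; exact: smoothM.
    by apply: ccP; [exact: smooth_lap|exact: bounded_support_lap].
  - apply: ccMr; first by apply: smooth_continuous; apply: smoothZ; exact: smoothM.
    by apply: ccP; [exact: smoothX|exact: bounded_supportX].
  - apply: ccMr => //; apply: smooth_continuous; apply: smoothM => //; apply: smoothD.
      by apply: smoothM => //; apply: smoothB; [exact: smooth_cst|exact: smoothZ].
    by apply: smoothM => //; apply: smoothZ; exact: smooth_rad2.
have IG : bint G = 0 := carleman_identity sf bf.
have le : bint (fun x => nu ^+ 2 / 4 * (a x * f x ^+ 2) - (8 * nu)^-1 * (a x * lap f x ^+ 2)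
    - C * (th x * f x ^+ 2)) <= bint (fun x => -1 * G x).
  apply: le_bint.
  - by apply: ccB; [apply: ccB; exact: ccZ|exact: ccZ].
  - exact: ccZ.
  (* The scalar inequality needs s + eps <= 1/2. Beyond that [f] vanishes on an open set, hence so
     do its derivatives and both sides. *)
  move=> x; have [out|ins] := ltP (1 / 2) (s x + eps).
    have oU : open [set x | 1 / 2 < s x + eps].
      rewrite (_ : [set x | _] = (fun x => s x + eps) @^-1` [set t | 1/2 < t])//.
      apply: open_comp => [y _|]; last exact: open_gt.
      by apply: smooth_continuous; apply: smoothD; [exact: smooth_rad2|exact: smooth_cst].
    rewrite /G (fout x out) (lap0_open oU fout out) (euler0_open oU fout out).
    by rewrite /cP !(expr0n, mulr0, mul0r, addr0, subr0).
  have := @carleman_scalar nu eps (s x) (a x) (lap f x) (E f x + cK x * f x) (f x) (th x)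
    (eps ^- n * expR nu) nu1 eps0 eps2 (rad2_ge0 _ _) ins (weight_gt0 x) (th0 x).
  move=> /(_ _ _ (thin x)); rewrite /= -/(cq x) -/(cb x) -/(cK x) -/(cK1 x) -/(cK2 x).
  move=> /(_ _ _)/le_trans; apply.
  - by rewrite mulr_ge0 ?expR_ge0// invr_ge0 exprn_ge0// ltW.
  - apply: weight_le; apply: (@le_trans _ _ (1 / 2)); last lra.
    by apply: le_trans ins; rewrite lerDl ltW.
  - rewrite /G /cP; move: (lap f x) (E f x) (f x) (a x) => L Ef fx ax; lra.
have := le; rewrite bintZ// IG mulr0 bintB; [|by apply: ccB; exact: ccZ|exact: ccZ].
rewrite bintB; [|exact: ccZ|exact: ccZ]; rewrite !bintZ//.
have D0 : 0 <= bint (fun x => a x * f x ^+ 2).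
  by apply: bint_ge0 => x; rewrite mulr_ge0 ?sqr_ge0// ltW// weight_gt0.
move: D0; move: (bint (fun x => a x * f x ^+ 2)) (bint (fun x => a x * lap f x ^+ 2))
  (bint (fun x => th x * f x ^+ 2)) => D B A D0.
(* Multiplying by [8 * nu] normalises the coefficient of the Laplacian term: nu^2 / 4 becomes 2
   nu^3, of which one nu^3 is given up, and 5 nu^2 / eps becomes 40 nu^3 / eps. *)
have n8 : 0 < 8 * nu by lra.
move=> H; have := ler_wpM2l (ltW n8) H; rewrite mulr0 !mulrBr mulVKf ?gt_eqF//.
rewrite (_ : 8 * nu * (nu ^+ 2 / 4 * D) = 2 * (nu ^+ 3 * D)); last by field.
rewrite (_ : 8 * nu * (C * A) = 40 * nu ^+ 3 * (eps ^- n.+1 * expR nu) * A); last first.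
  by have -> : eps ^- n.+1 = eps^-1 * eps ^- n; [rewrite exprS invfM|rewrite /C; ring].
have : 0 <= nu ^+ 3 * D by rewrite mulr_ge0// exprn_ge0//; lra.
move: (40 * _ * _ * _) (nu ^+ 3 * D) => P Q; lra.
Qed.

End carleman.

Lemma sum_cauchy_schwarz (R : realType) (n : nat) (a b : 'I_n -> R) :
  (\sum_i a i * b i) ^+ 2 <= (\sum_i a i * a i) * (\sum_i b i * b i).
Proof.
set H := \sum_i a i * b i; set A := \sum_i a i * a i; set B := \sum_i b i * b i.
have P t : 0 <= A - 2 * t * H + t ^+ 2 * B.
  have -> : A - 2 * t * H + t ^+ 2 * B = \sum_i (a i - t * b i) ^+ 2.
    rewrite /A /H /B !mulr_sumr -sumrB -big_split /=; apply: eq_bigr => i _; ring.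
  by apply: sumr_ge0 => i _; exact: sqr_ge0.
have B0 : 0 <= B by apply: sumr_ge0 => i _; rewrite -expr2; exact: sqr_ge0.
have A0 : 0 <= A by apply: sumr_ge0 => i _; rewrite -expr2; exact: sqr_ge0.
have [Bp|] := ltP 0 B.
  have := P (H / B); rewrite (_ : _ + _ = A - H ^+ 2 / B); last by field; rewrite gt_eqF.
  by rewrite subr_ge0 ler_pdivrMr.
move=> Bn; have B00 : B = 0 by apply/eqP; rewrite eq_le Bn.
have [->|H0] := eqVneq H 0; first by rewrite expr0n mulr_ge0.
(* With [B = 0] the polynomial is affine in t, and it equals -1 at this t, a contradiction. *)
have := P ((A + 1) / (2 * H)); rewrite B00 mulr0 addr0.
rewrite (_ : A - _ = -1); last by field.
by rewrite oppr_ge0 ler10.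
Qed.

(** * The interior estimate *)

Section gradient_algebra.
Variables (R : realType) (N : nat).
Local Notation V := 'rV[R]_N.
Implicit Types (f g h w zeta : V -> R) (i j : 'I_N) (x v : V).

Lemma grd_ge0 f x : 0 <= grd f f x.
Proof. by apply: sumr_ge0 => i _; rewrite -expr2; exact: sqr_ge0. Qed.

Lemma grd_cauchy_schwarz f g x : grd f g x ^+ 2 <= grd f f x * grd g g x.
Proof. exact: sum_cauchy_schwarz. Qed.

Lemma lapX f n x : smooth f -> lap (fun x => f x ^+ n.+2) x =
  n.+2%:R * (n.+1%:R * f x ^+ n * grd f f x + f x ^+ n.+1 * lap f x).
Proof.
move=> sf; rewrite /lap /grd !mulr_sumr -big_split mulr_sumr /=; apply: eq_bigr => i _.
have -> : partial i (fun x => f x ^+ n.+2) = fun x => n.+2%:R * (f x ^+ n.+1 * partial i f x).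
  by apply/funext => y; rewrite partialX// mulrA.
have sp := smooth_partial i sf.
have sX := smoothX n.+1 sf.
rewrite partialZ ?partialM ?partialX//; last exact: smoothM.
by move: (f x ^+ n) (f x ^+ n.+1) => P Q; rewrite /=; ring.
Qed.

Lemma grdX n f g x : smooth f -> grd (fun x => f x ^+ n.+1) g x = n.+1%:R * (f x ^+ n * grd f g x).
Proof.
move=> sf; rewrite /grd !mulr_sumr; apply: eq_bigr => i _.
by rewrite partialX//= !mulrA.
Qed.

Lemma grd_cst (c : R) f x : grd f (fun=> c) x = 0.
Proof. by rewrite /grd big1// => i _; rewrite partial_cst mulr0. Qed.

End gradient_algebra.

Lemma bint_rearrange (R : realType) (N : nat) (f g h : 'rV[R]_N -> R) : cc f -> cc g -> cc h ->
  bint (fun x => f x + g x - h x) = 0 -> bint f = bint (fun x => h x - g x).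
Proof.
move=> cf cg ch; rewrite bintB//; last exact: ccD.
by rewrite bintD// bintB// => /eqP; rewrite subr_eq0 => /eqP <-; rewrite addrK.
Qed.

#[local] Opaque partial lap grd euler rad2 bint.

Section interior_scalar.
Variable R : realType.
Implicit Types L X e ff vv gg : R.

Lemma cutoff_powers X e n : 0 <= X -> X <= e -> e <= 1 ->
  0 <= X ^+ n.+1 /\ X ^+ n.+1 <= e.
Proof.
move=> X0 Xe e1; split; first exact: exprn_ge0.
by rewrite exprS (le_trans _ Xe)// ler_piMr// exprn_ile1// (le_trans Xe).
Qed.

(** The letters are pointwise values: [X] of the cutoff [xi], [e] of the wider cutoff [eta], [ff],
    [vv], [gg] of f, Delta f, Delta^2 f, and [l6] of the Laplacian of xi^6. The product is split by
    Young's inequality as X^6 = X^2 X^4. *)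
Lemma energy_scalar_v L X e ff vv gg l6 : 1 <= L -> 0 <= X -> X <= e -> e <= 1 ->
  `|l6| <= 36 * L * X ^+ 4 ->
  1 / 2 * (vv ^+ 2 * l6) - X ^+ 6 * (vv * gg) <=
  19 * L * (X ^+ 4 * vv ^+ 2) + e * (ff ^+ 2 + gg ^+ 2).
Proof.
move=> L1 X0 Xe e1; rewrite ler_norml => /andP[_ l6b].
have [X8 X8e] := cutoff_powers 7 X0 Xe e1.
have e0 : 0 <= e by lra.
have h1 : vv ^+ 2 * l6 <= vv ^+ 2 * (36 * L * X ^+ 4) by rewrite ler_wpM2l// sqr_ge0.
have h2 : - (X ^+ 6 * (vv * gg)) <= 1 / 2 * (X ^+ 4 * vv ^+ 2) + 1 / 2 * (X ^+ 8 * gg ^+ 2).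
  have := sqr_ge0 (X ^+ 2 * vv + X ^+ 4 * gg).
  have -> : (X ^+ 2 * vv + X ^+ 4 * gg) ^+ 2 =
    X ^+ 4 * vv ^+ 2 + 2 * (X ^+ 6 * (vv * gg)) + X ^+ 8 * gg ^+ 2 by ring.
  lra.
have h3 : X ^+ 8 * gg ^+ 2 <= e * gg ^+ 2 by rewrite ler_wpM2r ?sqr_ge0.
have h4 : 0 <= e * ff ^+ 2 by rewrite mulr_ge0 ?sqr_ge0.
have h5 : 0 <= e * gg ^+ 2 by rewrite mulr_ge0 ?sqr_ge0.
have h6 : 0 <= X ^+ 4 * vv ^+ 2 by rewrite mulr_ge0 ?sqr_ge0 ?exprn_ge0.
have h7 : X ^+ 4 * vv ^+ 2 <= L * (X ^+ 4 * vv ^+ 2) by rewrite ler_peMl.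
have h8 : vv ^+ 2 * (36 * L * X ^+ 4) = 36 * (L * (X ^+ 4 * vv ^+ 2)) by ring.
rewrite -[19 * L * _]mulrA mulrDr; move: h1 h2 h3 h4 h5 h6 h7 h8; clear.
move: (L * (X ^+ 4 * vv ^+ 2)) (X ^+ 4 * vv ^+ 2) (e * gg ^+ 2) (e * ff ^+ 2)
  (vv ^+ 2 * l6) (X ^+ 6 * (vv * gg)) (X ^+ 8 * gg ^+ 2) (vv ^+ 2 * _) => *; lra.
Qed.

Lemma energy_scalar_f L X e ff vv gg l6 : 1 <= L -> 0 <= X -> X <= e -> e <= 1 ->
  `|l6| <= 36 * L * X ^+ 4 ->
  1 / 2 * (ff ^+ 2 * l6) - X ^+ 6 * (ff * vv) <=
  20 * L * (e * (ff ^+ 2 + gg ^+ 2)) + X ^+ 4 * vv ^+ 2.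
Proof.
move=> L1 X0 Xe e1; rewrite ler_norml => /andP[_ l6b].
have [X8 X8e] := cutoff_powers 7 X0 Xe e1.
have [X4 X4e] := cutoff_powers 3 X0 Xe e1.
have e0 : 0 <= e by lra.
have h0 : 36 * L * X ^+ 4 <= 36 * L * e by rewrite ler_wpM2l//; lra.
have h1 : ff ^+ 2 * l6 <= ff ^+ 2 * (36 * L * e).
  by rewrite ler_wpM2l ?sqr_ge0// (le_trans l6b).
have h2 : - (X ^+ 6 * (ff * vv)) <= 1 / 2 * (X ^+ 4 * vv ^+ 2) + 1 / 2 * (X ^+ 8 * ff ^+ 2).
  have := sqr_ge0 (X ^+ 2 * vv + X ^+ 4 * ff).
  have -> : (X ^+ 2 * vv + X ^+ 4 * ff) ^+ 2 =
    X ^+ 4 * vv ^+ 2 + 2 * (X ^+ 6 * (ff * vv)) + X ^+ 8 * ff ^+ 2 by ring.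
  lra.
have h3 : X ^+ 8 * ff ^+ 2 <= e * ff ^+ 2 by rewrite ler_wpM2r ?sqr_ge0.
have h4 : 0 <= e * ff ^+ 2 by rewrite mulr_ge0 ?sqr_ge0.
have h5 : 0 <= L * (e * gg ^+ 2) := mulr_ge0 (le_trans ler01 L1) (mulr_ge0 e0 (sqr_ge0 gg)).
have h6 : 0 <= X ^+ 4 * vv ^+ 2 by rewrite mulr_ge0 ?sqr_ge0.
have h7 : e * ff ^+ 2 <= L * (e * ff ^+ 2) by rewrite ler_peMl.
have h8 : ff ^+ 2 * (36 * L * e) = 36 * (L * (e * ff ^+ 2)) by ring.
rewrite -[20 * L * _]mulrA mulrDr [L * (_ + _)]mulrDr; move: h1 h2 h3 h4 h5 h6 h7 h8; clear.
move: (L * (e * ff ^+ 2)) (X ^+ 4 * vv ^+ 2) (L * (e * gg ^+ 2)) (e * ff ^+ 2)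
  (ff ^+ 2 * l6) (X ^+ 6 * (ff * vv)) (X ^+ 8 * ff ^+ 2) (ff ^+ 2 * _) => *; lra.
Qed.

(** Bounds the three terms of f times the Laplacian of xi^4 Delta f; [G] is the product of the
    gradients of [xi] and Delta f. Its share (80 L)^-1 of the gradient energy is small enough to be
    absorbed later, as that energy costs 19 L times the energy of Delta f. *)
Lemma energy_scalar_lap L X e ff vv gg l4 G Gv Gx : 1 <= L -> 0 <= X -> X <= e -> e <= 1 ->
  `|l4| <= 16 * L * X ^+ 2 * e -> G ^+ 2 <= Gx * Gv -> 0 <= Gv -> 0 <= Gx -> Gx <= L * e ->
  ff * (X ^+ 4 * gg + 8 * (X ^+ 3 * G) + vv * l4) <=
  (80 * L)^-1 * (X ^+ 6 * Gv) + 1 / 4 * (X ^+ 4 * vv ^+ 2) +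
  40 * 40 * L ^+ 2 * (e * (ff ^+ 2 + gg ^+ 2)).
Proof.
move=> L1 X0 Xe e1 l4b cs gv g0 gb.
have [_ X4] := cutoff_powers 3 X0 Xe e1.
have e0 : 0 <= e by lra.
have Lp : 0 < L by lra.
have t1 : ff * (X ^+ 4 * gg) <= 1 / 2 * (e * (ff ^+ 2 + gg ^+ 2)).
  have p0 : ff * gg <= 1 / 2 * (ff ^+ 2 + gg ^+ 2) by have := sqr_ge0 (ff - gg); rewrite sqrrB; lra.
  have -> : ff * (X ^+ 4 * gg) = X ^+ 4 * (ff * gg) by ring.
  apply: (@le_trans _ _ (X ^+ 4 * (1 / 2 * (ff ^+ 2 + gg ^+ 2)))); first by rewrite ler_wpM2l// exprn_ge0.
  have := ler_wpM2r (_ : 0 <= 1 / 2 * (ff ^+ 2 + gg ^+ 2)) X4.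
  by rewrite mulr_ge0 ?addr_ge0 ?sqr_ge0// => /(_ isT); lra.
have t2 : ff * (8 * (X ^+ 3 * G)) <= (80 * L)^-1 * (X ^+ 6 * Gv) + 16 * 80 * L ^+ 2 * (e * ff ^+ 2).
  (* (8 X^3 f G)^2 <= 4 * (X^6 Gv / (80 L)) * (16 * 80 L Gx f^2) *)
  pose P := (80 * L)^-1 * (X ^+ 6 * Gv); pose Q := 16 * 80 * L * (Gx * ff ^+ 2).
  have P0 : 0 <= P by rewrite mulr_ge0 ?mulr_ge0 ?exprn_ge0// invr_ge0; lra.
  have Q0 : 0 <= Q by apply: mulr_ge0; [lra|exact: mulr_ge0 g0 (sqr_ge0 ff)].
  have QL : Q <= 16 * 80 * L ^+ 2 * (e * ff ^+ 2).
    apply: (@le_trans _ _ (16 * 80 * L * (L * e * ff ^+ 2))).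
      apply: ler_wpM2l; first lra.
      by apply: ler_wpM2r => //; exact: sqr_ge0.
    by rewrite le_eqVlt; apply/orP; left; apply/eqP; ring.
  apply: (@le_trans _ _ (P + Q)); last by rewrite /P lerD2l.
  have PQ : (ff * (8 * (X ^+ 3 * G))) ^+ 2 <= (P + Q) ^+ 2.
    apply: (@le_trans _ _ (4 * (P * Q))); last first.
      by have := sqr_ge0 (P - Q); rewrite sqrrB sqrrD; lra.
    have -> : 4 * (P * Q) = 64 * (X ^+ 6 * ff ^+ 2 * (Gx * Gv)) by rewrite /P /Q; field; lra.
    have -> : (ff * (8 * (X ^+ 3 * G))) ^+ 2 = 64 * (X ^+ 6 * ff ^+ 2 * G ^+ 2) by ring.
    by rewrite ler_wpM2l// ler_wpM2l// mulr_ge0 ?sqr_ge0// exprn_ge0.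
  apply: le_trans (ler_norm _) _.
  by rewrite -[leRHS]ger0_norm ?addr_ge0// -ler_sqr ?nnegrE// !real_normK ?num_real.
have t3 : ff * (vv * l4) <= 1 / 4 * (X ^+ 4 * vv ^+ 2) + 16 * 16 * L ^+ 2 * (e * ff ^+ 2).
  have b1 : ff * (vv * l4) <= `|ff * vv| * (16 * L * X ^+ 2 * e).
    rewrite mulrA; apply: le_trans (ler_norm _) _; rewrite normrM.
    by apply: ler_wpM2l.
  apply: le_trans b1 _.
  have p0 := sqr_ge0 (1 / 2 * X ^+ 2 * `|vv| - 16 * L * e * `|ff|).
  have e2 : e ^+ 2 <= e by rewrite expr2 ler_piMr.
  have q1 : 16 * 16 * L ^+ 2 * (e ^+ 2 * ff ^+ 2) <= 16 * 16 * L ^+ 2 * (e * ff ^+ 2).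
    apply: ler_wpM2l; first by apply: mulr_ge0; [lra|exact: sqr_ge0].
    by apply: ler_wpM2r => //; exact: sqr_ge0.
  have E : (1 / 2 * X ^+ 2 * `|vv| - 16 * L * e * `|ff|) ^+ 2 =
    1 / 4 * (X ^+ 4 * `|vv| ^+ 2) - `|ff| * `|vv| * (16 * L * X ^+ 2 * e) + 16 * 16 * L ^+ 2 * (e ^+ 2 * `|ff| ^+ 2) by field.
  rewrite E !real_normK ?num_real// in p0.
  rewrite normrM; lra.
have L2 : 1 <= L ^+ 2 by rewrite expr_ge1//; lra.
have u1 : e * (ff ^+ 2 + gg ^+ 2) <= L ^+ 2 * (e * (ff ^+ 2 + gg ^+ 2)).
  by rewrite ler_peMl// mulr_ge0// addr_ge0 ?sqr_ge0.
have u2 : L ^+ 2 * (e * ff ^+ 2) <= L ^+ 2 * (e * (ff ^+ 2 + gg ^+ 2)).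
  by rewrite ler_wpM2l ?sqr_ge0// ler_wpM2l// lerDl sqr_ge0.
rewrite -(mulrA (40 * 40)) (mulrDr ff) (mulrDr ff).
rewrite -(mulrA (16 * 80)) in t2; rewrite -(mulrA (16 * 16)) in t3.
have u3 : 0 <= L ^+ 2 * (e * (ff ^+ 2 + gg ^+ 2)).
  by apply: mulr_ge0 (sqr_ge0 L) (mulr_ge0 e0 (addr_ge0 (sqr_ge0 ff) (sqr_ge0 gg))).
move: t1 t2 t3 u1 u2 u3; clear.
move: (ff * (X ^+ 4 * gg)) (ff * (8 * _)) (ff * (vv * l4)) ((80 * L)^-1 * _) (X ^+ 4 * vv ^+ 2)
  (L ^+ 2 * (e * ff ^+ 2)) (e * (ff ^+ 2 + gg ^+ 2)) (L ^+ 2 * _) => *; lra.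
Qed.

(** Closes the loop between the two energies: as 19/80 < 1/4, substituting the bound on [B] leaves
    at most half of [A] on the right. *)
Lemma laplacian_energy_scalar L (W A B : R) : 1 <= L -> 0 <= W -> 0 <= A -> B <= 19 * L * A + W ->
  A <= (80 * L)^-1 * B + 1 / 4 * A + 40 * 40 * L ^+ 2 * W -> A <= 40 * 100 * L ^+ 2 * W.
Proof.
move=> L1 W0 A0 GV ineq.
have L0 : 0 < 80 * L by lra.
have H : (80 * L)^-1 * B <= 1 / 4 * A + W.
  rewrite ler_pdivrMl//; apply: le_trans GV _.
  have h1 : W <= 80 * L * W by rewrite ler_peMl//; lra.
  have h2 : 0 <= L * A by rewrite mulr_ge0//; lra.
  rewrite mulrDr -!mulrA; rewrite -mulrA in h1; move: h1 h2; clear.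
  move: (L * W) => LW; rewrite [L * (1 * _)]mulrCA mul1r [L * (4^-1 * _)]mulrCA; move: (L * A) => LA *; lra.
have h3 : W <= L ^+ 2 * W by rewrite ler_peMl// expr_ge1//; lra.
move: ineq H h3; rewrite -!(mulrA _ (L ^+ 2)); move: A0 W0; clear.
move: (L ^+ 2 * W) ((80 * L)^-1 * _) => P Q *; lra.
Qed.

Lemma interior_energy_scalar L (W A B D : R) : 1 <= L -> 0 <= W -> 0 <= A ->
  A <= 40 * 100 * L ^+ 2 * W -> B <= 19 * L * A + W -> D <= 20 * L * W + A ->
  [/\ A <= 80 * 100 * 10 * L ^+ 3 * W, B <= 80 * 100 * 10 * L ^+ 3 * W &
     D <= 80 * 100 * 10 * L ^+ 3 * W].
Proof.
move=> L1 W0 A0 a1 a2 a3.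
have Lp : 0 <= L by lra.
have b1 : W <= L * W by rewrite ler_peMl.
have b2 : L * W <= L ^+ 2 * W by rewrite expr2 -mulrA ler_peMl// mulr_ge0.
have b3 : L ^+ 2 * W <= L ^+ 3 * W.
  by rewrite (exprS L 2) -mulrA ler_peMl// mulr_ge0// exprn_ge0.
have b4 : L * A <= 40 * 100 * (L ^+ 3 * W).
  apply: (@le_trans _ _ (L * (40 * 100 * L ^+ 2 * W))); first by rewrite ler_wpM2l.
  by rewrite (_ : L * _ = 40 * 100 * (L ^+ 3 * W))//; ring.
rewrite -(mulrA _ (L ^+ 3)); rewrite -(mulrA _ (L ^+ 2)) in a1; rewrite -(mulrA _ L) in a2.
rewrite -(mulrA _ L) in a3; move: W0 A0 a1 a2 a3 b1 b2 b3 b4; clear.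
move: (L ^+ 3 * W) (L ^+ 2 * W) (L * W) (L * A) => P3 P2 P1 LA *; split; lra.
Qed.

End interior_scalar.

Section interior_estimate.
Variables (R : realType) (N : nat).
Local Notation V := 'rV[R]_N.
Implicit Types (f g h w zeta : V -> R) (i j : 'I_N) (x v : V).

(** The integrand is the divergence of zeta w grad w - (w^2 / 2) grad zeta. *)
Lemma gradient_identity w zeta : smooth w -> smooth zeta -> bounded_support zeta ->
  bint (fun x => zeta x * grd w w x + zeta x * (w x * lap w x) - 1 / 2 * (w x ^+ 2 * lap zeta x)) = 0.
Proof.
move=> sw sz bz.
have szw : smooth (fun x => zeta x * w x) by exact: smoothM.
have sw2 : smooth (fun x => 1 / 2 * (w x * w x)) by apply: smoothZ; exact: smoothM.
apply: (@bint_divergence _ _ (fun i x => partial i w x * (zeta x * w x) - partial i zeta x * (1 / 2 * (w x * w x)))).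
- move=> i; apply: smoothB; apply: smoothM => //; exact: smooth_partial.
- move=> i; apply: (@bounded_support2 _ _ (fun a b => a - b) _ _ (subr0 0)).
    by apply: bounded_supportMr; exact: bounded_supportMl.
  by apply: bounded_supportMl; exact: bounded_support_partial.
move=> x; rewrite (eq_bigr (fun i => partial i (fun x => partial i w x * (zeta x * w x)) x -
    partial i (fun x => partial i zeta x * (1 / 2 * (w x * w x))) x)); last first.
  by move=> i _; rewrite partialB//; apply: smoothM => //; exact: smooth_partial.
rewrite sumrB !grd_divergence// grdM// [grd zeta _ x]grdM; [|exact: smooth_cst|exact: smoothM].
rewrite grdM// [grd w zeta x]grdC grd_cst.
move: (zeta x) (w x) (grd w w x) (lap w x) (grd zeta w x) (lap zeta x) => *; by field.
Qed.

Lemma green_identity f h : smooth f -> smooth h -> bounded_support h ->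
  bint (fun x => h x * lap f x - f x * lap h x) = 0.
Proof.
move=> sf sh bh.
apply: (@bint_divergence _ _ (fun i x => partial i f x * h x - partial i h x * f x)).
- move=> i; apply: smoothB; apply: smoothM => //; exact: smooth_partial.
- move=> i; apply: (@bounded_support2 _ _ (fun a b => a - b) _ _ (subr0 0)).
    exact: bounded_supportMr.
  by apply: bounded_supportMl; exact: bounded_support_partial.
move=> x; rewrite (eq_bigr (fun i => partial i (fun x => partial i f x * h x) x -
    partial i (fun x => partial i h x * f x) x)); last first.
  by move=> i _; rewrite partialB//; apply: smoothM => //; exact: smooth_partial.
rewrite sumrB !grd_divergence// [grd h f x]grdC.
move: (h x) (f x) (lap h x) (lap f x) (grd f h x) => *; ring.
Qed.

Variables (xi eta : V -> R) (L : R).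
Hypotheses (sxi : smooth xi) (bxi : bounded_support xi) (ceta : cc eta).
Hypotheses (xi0 : forall x, 0 <= xi x) (xieta : forall x, xi x <= eta x).
Hypotheses (eta1 : forall x, eta x <= 1) (L1 : 1 <= L).
Hypotheses (gxi : forall x, grd xi xi x <= L * eta x).
Hypotheses (lxi : forall x, `|lap xi x| <= L * eta x).

Let xi1 x : xi x <= 1. Proof. exact: le_trans (xieta x) (eta1 x). Qed.
Let eta0 x : 0 <= eta x. Proof. exact: le_trans (xi0 x) (xieta x). Qed.
Let xiX n x : 0 <= xi x ^+ n. Proof. exact: exprn_ge0. Qed.
Let xiX1 n x : xi x ^+ n <= 1. Proof. exact: exprn_ile1. Qed.
Let xiXeta n x : (0 < n)%N -> xi x ^+ n <= eta x.
Proof.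
case: n => // n _; rewrite exprS; apply: le_trans (xieta x).
by rewrite ler_piMr.
Qed.

(** High powers of the cutoff are used because two derivatives remove at most two factors: the error
    of the xi^6 energy still carries xi^4, the weight of the energy of Delta f. *)
Lemma lap_xi6 x : `|lap (fun x => xi x ^+ 6) x| <= 36 * L * xi x ^+ 4.
Proof.
rewrite (@lapX _ _ xi 4)//.
have Leta : L * eta x <= L by rewrite ler_piMr// (le_trans ler01).
have a1 := le_trans (gxi x) Leta; have a2 := le_trans (lxi x) Leta.
have g0 := grd_ge0 xi x.
have -> : 6%:R * (5%:R * xi x ^+ 4 * grd xi xi x + xi x ^+ 5 * lap xi x) =
  (30 * grd xi xi x + 6 * (xi x * lap xi x)) * xi x ^+ 4 :> R by rewrite exprS; ring.
rewrite normrM (ger0_norm (xiX 4 x)); apply: ler_wpM2r => //.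
apply: (le_trans (ler_normD _ _)).
rewrite ger0_norm ?mulr_ge0// !normrM (ger0_norm (xi0 x)) (ger0_norm (ler0n _ 6)).
have : xi x * `|lap xi x| <= L by apply: le_trans a2; rewrite ler_piMl.
lra.
Qed.

Lemma lap_xi4 x : `|lap (fun x => xi x ^+ 4) x| <= 16 * L * xi x ^+ 2 * eta x.
Proof.
rewrite (@lapX _ _ xi 2)//.
have g0 := grd_ge0 xi x.
have -> : 4%:R * (3%:R * xi x ^+ 2 * grd xi xi x + xi x ^+ 3 * lap xi x) =
  (12 * grd xi xi x + 4 * (xi x * lap xi x)) * xi x ^+ 2 :> R by rewrite exprS; ring.
rewrite normrM (ger0_norm (xiX 2 x)) [leRHS]mulrAC; apply: ler_wpM2r => //.
apply: (le_trans (ler_normD _ _)).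
rewrite ger0_norm ?mulr_ge0// !normrM (ger0_norm (xi0 x)) (ger0_norm (ler0n _ 4)).
have : xi x * `|lap xi x| <= L * eta x by apply: le_trans (lxi x); rewrite ler_piMl.
have := gxi x; rewrite -!mulrA; move: (L * eta x) => P; lra.
Qed.

Section estimate.
Variable f : V -> R.
Hypothesis sf : smooth f.
Let v := lap f.
Let g := lap v.
Let sv : smooth v. Proof. exact: smooth_lap. Qed.
Let sg : smooth g. Proof. exact: smooth_lap. Qed.

Let cxi n w : continuous w -> (0 < n)%N -> cc (fun x => xi x ^+ n * w x).
Proof.
by move=> cw n0; apply: ccMl => //; apply: ccP; [exact: smoothX|exact: bounded_supportX].
Qed.

Let W := bint (fun x => eta x * (f x ^+ 2 + g x ^+ 2)).
Let A := bint (fun x => xi x ^+ 4 * v x ^+ 2).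
Let gradient_energy w := bint (fun x => xi x ^+ 6 * grd w w x).

Let cW : cc (fun x => eta x * (f x ^+ 2 + g x ^+ 2)).
Proof.
by apply: ccMl => //; apply: smooth_continuous; apply: smoothD; exact: smoothX.
Qed.

Let cA : cc (fun x => xi x ^+ 4 * v x ^+ 2).
Proof. by apply: cxi => //; apply: smooth_continuous; exact: smoothX. Qed.

Let cB w : smooth w -> cc (fun x => xi x ^+ 6 * grd w w x).
Proof. by move=> sw; apply: cxi => //; apply: smooth_continuous; exact: smooth_grd. Qed.

Let W0 : 0 <= W.
Proof. by apply: bint_ge0 => x; rewrite mulr_ge0// addr_ge0// sqr_ge0. Qed.

Let A0 : 0 <= A.
Proof. by apply: bint_ge0 => x; rewrite mulr_ge0// sqr_ge0. Qed.

Lemma gradient_energy_eq w : smooth w -> gradient_energy w =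
  bint (fun x => 1 / 2 * (w x ^+ 2 * lap (fun x => xi x ^+ 6) x) - xi x ^+ 6 * (w x * lap w x)).
Proof.
move=> sw; have sx6 := smoothX 6 sxi.
have bx6 : bounded_support (fun x => xi x ^+ 6) by exact: bounded_supportX.
have c1 : cc (fun x => 1 / 2 * (w x ^+ 2 * lap (fun x => xi x ^+ 6) x)).
  apply: ccZ; apply: ccMr; first by apply: smooth_continuous; exact: smoothX.
  by apply: ccP; [exact: smooth_lap|exact: bounded_support_lap].
have c2 : cc (fun x => xi x ^+ 6 * (w x * lap w x)).
  apply: cxi => //; apply: smooth_continuous; exact: (smoothM sw (smooth_lap sw)).
exact: (bint_rearrange (cB sw) c2 c1 (gradient_identity sw sx6 bx6)).
Qed.

(** A Caccioppoli inequality for Delta f: both derivatives fall on the cutoff, and Young's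
    inequality handles the product with Delta^2 f. *)
Lemma gradient_energy_v : gradient_energy v <= 19 * L * A + W.
Proof.
have C : cc (fun x => 19 * L * (xi x ^+ 4 * v x ^+ 2) + eta x * (f x ^+ 2 + g x ^+ 2)).
  exact: (ccD (ccZ (19 * L) cA) cW).
rewrite (gradient_energy_eq sv) -(bintZ (19 * L) cA) -(bintD (ccZ (19 * L) cA) cW).
apply: le_bint => //.
  apply: ccB.
    apply: ccZ; apply: ccMr; first by apply: smooth_continuous; exact: smoothX.
    apply: ccP; first exact/smooth_lap/smoothX.
    by apply: bounded_support_lap; exact: bounded_supportX.
  apply: cxi => //; apply: smooth_continuous; exact: (smoothM sv sg).
move=> x; rewrite -/(g x).
exact: (energy_scalar_v _ _ _ L1 (xi0 x) (xieta x) (eta1 x) (lap_xi6 x)).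
Qed.

Lemma gradient_energy_f : gradient_energy f <= 20 * L * W + A.
Proof.
have C : cc (fun x => 20 * L * (eta x * (f x ^+ 2 + g x ^+ 2)) + (xi x ^+ 4 * v x ^+ 2)).
  exact: (ccD (ccZ (20 * L) cW) cA).
rewrite (gradient_energy_eq sf) -(bintZ (20 * L) cW) -(bintD (ccZ (20 * L) cW) cA).
apply: le_bint => //.
  apply: ccB.
    apply: ccZ; apply: ccMr; first by apply: smooth_continuous; exact: smoothX.
    apply: ccP; first exact/smooth_lap/smoothX.
    by apply: bounded_support_lap; exact: bounded_supportX.
  apply: cxi => //; apply: smooth_continuous; exact: (smoothM sf sv).
move=> x; rewrite -/(v x).
exact: (energy_scalar_f _ _ _ L1 (xi0 x) (xieta x) (eta1 x) (lap_xi6 x)).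
Qed.

(** One Laplacian is moved off [f] by Green's identity, so that [A] is the integral of [f * lap h]
    with h = xi^4 Delta f. This involves the gradient of Delta f, which is in turn bounded by
    [A]. *)
Lemma laplacian_energy : A <= 40 * 100 * L ^+ 2 * W.
Proof.
pose h x := xi x ^+ 4 * v x.
have sx4 := smoothX 4 sxi.
have sh : smooth h by exact: smoothM.
have bh : bounded_support h by apply: bounded_supportMl; exact: bounded_supportX.
have lh x : lap h x = xi x ^+ 4 * g x + 8 * (xi x ^+ 3 * grd xi v x) + v x * lap (fun x => xi x ^+ 4) x.
  rewrite /h lapM// -/g; congr (_ + _ + _).
  rewrite grdX//; move: (xi x ^+ 3) (grd xi v x) => *; ring.
have AE : A = bint (fun x => f x * lap h x).
  have c1 : cc (fun x => h x * lap f x).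
    exact: (ccMl (ccP sh bh) (smooth_continuous sv)).
  have c2 : cc (fun x => f x * lap h x).
    apply: ccMr; first exact: smooth_continuous.
    by apply: ccP; [exact: smooth_lap|exact: bounded_support_lap].
  have := green_identity sf sh bh; rewrite bintB// => /eqP; rewrite subr_eq0 => /eqP <-.
  by apply: eq_bint => x; rewrite /h -/v; ring.
have ineq : A <= (80 * L)^-1 * gradient_energy v + 1 / 4 * A + 40 * 40 * L ^+ 2 * W.
  rewrite [leLHS]AE; rewrite /gradient_energy /A /W.
  have z1 := ccZ (80 * L)^-1 (cB sv); have z2 := ccZ (1 / 4) cA; have z3 := ccZ (40 * 40 * L ^+ 2) cW.
  rewrite -(bintZ _ (cB sv)) -(bintZ _ cA) -(bintZ _ cW) -(bintD z1 z2) -(bintD (ccD z1 z2) z3).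
  apply: le_bint; [|exact: (ccD (ccD z1 z2) z3)|].
    apply: ccMr; first exact: smooth_continuous.
    by apply: ccP; [exact: smooth_lap|exact: bounded_support_lap].
  move=> x; rewrite lh.
  exact: (energy_scalar_lap _ _ _ L1 (xi0 x) (xieta x) (eta1 x) (lap_xi4 x)
    (grd_cauchy_schwarz xi v x) (grd_ge0 v x) (grd_ge0 xi x) (gxi x)).
have GV := gradient_energy_v.
exact: (laplacian_energy_scalar L1 W0 A0 GV ineq).
Qed.

Lemma interior_estimate :
  [/\ bint (fun x => xi x ^+ 4 * v x ^+ 2) <= 80 * 100 * 10 * L ^+ 3 * W,
      bint (fun x => xi x ^+ 6 * grd v v x) <= 80 * 100 * 10 * L ^+ 3 * W &
      bint (fun x => xi x ^+ 6 * grd f f x) <= 80 * 100 * 10 * L ^+ 3 * W].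
Proof.
exact: (interior_energy_scalar L1 W0 A0 laplacian_energy gradient_energy_v gradient_energy_f).
Qed.

End estimate.
End interior_estimate.

#[local] Transparent partial lap grd euler rad2 bint.

(** * Cutoffs of balls and their commutators with the Laplacian *)

Section cutoff.
Variables (R : realType) (N : nat).
Local Notation V := 'rV[R]_N.
Implicit Types (f g h w : V -> R) (i j : 'I_N) (x v c : V) (r : R).

Definition cutoff c r x : R := step (r ^- 2 * rad2 c x).

Lemma smooth_cutoff c r : smooth (cutoff c r).
Proof. by apply: smooth_step; apply: smoothZ; exact: smooth_rad2. Qed.

Lemma cutoff_ge0 c r x : 0 <= cutoff c r x. Proof. exact: step_ge0. Qed.
Lemma cutoff_le1 c r x : cutoff c r x <= 1. Proof. exact: step_le1. Qed.

Lemma cutoff_eq1 c r x : 0 < r -> rad2 c x <= r ^+ 2 -> cutoff c r x = 1.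
Proof. by move=> r0 h; rewrite /cutoff step_eq1// ler_pdivrMl ?exprn_gt0// mulr1. Qed.

Lemma cutoff_eq0 c r x : 0 < r -> (2 * r) ^+ 2 <= rad2 c x -> cutoff c r x = 0.
Proof.
by move=> r0; rewrite exprMn => h; rewrite /cutoff step_eq0// ler_pdivlMl ?exprn_gt0//; lra.
Qed.

Lemma norm_le_rad2 c x : `|x - c| ^+ 2 <= rad2 c x.
Proof.
rewrite -[leRHS]sqr_sqrtr ?rad2_ge0// ler_sqr ?nnegrE// ?sqrtr_ge0//.
apply/norm_leP => [|i]; first exact: sqrtr_ge0.
rewrite -sqrtr_sqr ler_wsqrtr// rowBE /rad2 (bigD1 i)//= lerDl.
by apply: sumr_ge0 => j _; exact: sqr_ge0.
Qed.

Lemma bounded_support_cutoff c r : 0 < r -> bounded_support (cutoff c r).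
Proof.
move=> r0; exists (`|c| + 2 * r) => x xr; apply: cutoff_eq0 => //.
apply: le_trans (norm_le_rad2 c x); rewrite ler_sqr ?nnegrE// ?mulr_ge0 ?ltW//.
have := lerB_normD x (- c); rewrite normrN => h; have := ler_normB x c ; lra.
Qed.

Lemma cc_cutoff c r : 0 < r -> cc (cutoff c r).
Proof. by move=> r0; apply: ccP; [exact: smooth_cutoff|exact: bounded_support_cutoff]. Qed.

Lemma cutoff_affine c r x : 0 < r -> cutoff c r x = cutoff 0 1 (r^-1 *: x + - (r^-1 *: c)).
Proof.
move=> r0; rewrite /cutoff expr1n invr1 mul1r; congr step.
rewrite /rad2 mulr_sumr; apply: eq_bigr => i _.
by rewrite rowDE rowNE !rowZE mxE subr0 -mulrBr exprMn exprVn.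
Qed.

Lemma grd_affine f (a : R) (b : V) x : smooth f ->
  grd (fun x => f (a *: x + b)) (fun x => f (a *: x + b)) x = a ^+ 2 * grd f f (a *: x + b).
Proof.
move=> sf; rewrite /grd mulr_sumr; apply: eq_bigr => i _.
by rewrite partial_affine//; move: (partial _ _ _) => P; ring.
Qed.

Lemma lap_affine f (a : R) (b : V) x : smooth f ->
  lap (fun x => f (a *: x + b)) x = a ^+ 2 * lap f (a *: x + b).
Proof.
move=> sf; rewrite /lap mulr_sumr; apply: eq_bigr => i _.
have -> : partial i (fun x => f (a *: x + b)) = fun x => a * partial i f (a *: x + b).
  by apply/funext => y; rewrite partial_affine.
have sp := smooth_partial i sf.
by rewrite partialZ ?partial_affine//; [rewrite mulrA expr2|exact: smooth_affine].
Qed.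

(** All cutoffs are rescalings of the one of centre 0 and radius 1, whence a constant independent of
    [c] and [r]. *)
Lemma cutoff_derivative_bound : exists2 L : R, 1 <= L & forall c r x, 0 < r ->
  grd (cutoff c r) (cutoff c r) x <= L / r ^+ 2 /\ `|lap (cutoff c r) x| <= L / r ^+ 2.
Proof.
have s1 := smooth_cutoff 0 1.
have b1 := bounded_support_cutoff 0 (@ltr01 R).
have [M M0 HM] : exists2 M, 0 <= M & forall x, `|grd (cutoff 0 1) (cutoff 0 1) x| <= M.
  apply: cc_bounded; apply: ccP; first exact: smooth_grd.
  have [r H] := b1; exists r => x rx; rewrite /grd big1// => k _.
  by rewrite (@partial0_far _ _ k _ r H)// mul0r.
have [P P0 HP] : exists2 M, 0 <= M & forall x, `|lap (cutoff 0 1) x| <= M.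
  by apply: cc_bounded; apply: ccP; [exact: smooth_lap|exact: bounded_support_lap].
exists (1 + M + P); first lra.
move=> c r x r0.
have -> : cutoff c r = fun x => cutoff 0 1 (r^-1 *: x + - (r^-1 *: c)).
  by apply/funext => y; exact: cutoff_affine.
rewrite grd_affine// lap_affine// normrM.
have r2 : 0 < r ^- 2 by rewrite invr_gt0 exprn_gt0.
rewrite exprVn (ger0_norm (ltW r2)) ![_ * r ^- 2]mulrC; split; apply: ler_wpM2l; rewrite ?(ltW r2)//.
  by apply: le_trans (ler_norm _) _; apply: le_trans (HM _) _; lra.
by apply: le_trans (HP _) _; lra.
Qed.

Lemma cutoff_far0 c r x : 0 < r -> (2 * r) ^+ 2 < rad2 c x ->
  grd (cutoff c r) (cutoff c r) x = 0 /\ lap (cutoff c r) x = 0.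
Proof.
move=> r0 h; pose U := [set y | (2 * r) ^+ 2 < rad2 c y].
have oU : open U.
  rewrite /U (_ : [set x | _] = (rad2 c) @^-1` [set t | (2 * r) ^+ 2 < t])//.
  apply: open_comp => [y _|]; last exact: open_gt.
  by apply: smooth_continuous; exact: smooth_rad2.
have H y : U y -> cutoff c r y = 0 by move=> Uy; apply: cutoff_eq0 => //; exact: ltW.
split; last exact: (lap0_open oU H).
by rewrite /grd big1// => i _; rewrite (partial0_open _ oU H)// mul0r.
Qed.

Lemma cutoff_near0 c r x : 0 < r -> rad2 c x < r ^+ 2 ->
  (forall f, grd (cutoff c r) f x = 0) /\ lap (cutoff c r) x = 0.
Proof.
move=> r0 h; pose U := [set y | rad2 c y < r ^+ 2].
have oU : open U.
  rewrite /U (_ : [set x | _] = (rad2 c) @^-1` [set t | t < r ^+ 2])//.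
  apply: open_comp => [y _|]; last exact: open_lt.
  by apply: smooth_continuous; exact: smooth_rad2.
pose F y := cutoff c r y + -1.
have H y : U y -> F y = 0 by move=> Uy; rewrite /F cutoff_eq1 ?subrr//; exact: ltW.
have E : cutoff c r = fun y => F y + 1 by apply/funext => y; rewrite /F addrNK.
have sF : smooth F by apply: smoothD; [exact: smooth_cutoff|exact: smooth_cst].
have D i y : U y -> partial i (cutoff c r) y = 0.
  move=> Uy; rewrite E partialD//; last exact: smooth_cst.
  by rewrite partial_cst addr0 (partial0_open _ oU H).
split; first by move=> f; rewrite /grd big1// => i _; rewrite D ?mul0r.
by rewrite /lap big1// => i _; rewrite (partial0_open _ oU (fun y => @D i y)).
Qed.

End cutoff.

#[local] Opaque partial lap grd euler rad2 bint.

(** Here [G] and [l] are the commutator data (gradient product and Laplacian of the cutoff), [b] is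
    the cutoff of twice the radius and [ao] bounds the weight on the annulus. Either the commutator
    vanishes, or [b] is 1 and the weight is at most [ao]. *)
Lemma commutator_scalar (R : realType) (a ao chi v G f l Gx Gf b L : R) : 0 <= a -> 0 <= Gf -> 0 <= L -> 0 <= ao ->
  G ^+ 2 <= Gx * Gf -> Gx <= L -> `|l| <= L ->
  (G = 0 /\ l = 0) \/ (b = 1 /\ a <= ao) -> 0 <= b ->
  a * (chi * v + 2 * G + f * l) ^+ 2 <=
  2 * (a * (chi ^+ 2 * v ^+ 2)) + ao * (16 * L * (b ^+ 6 * Gf) + 4 * L ^+ 2 * (b ^+ 4 * f ^+ 2)).
Proof.
move=> a0 Gf0 L0 ao0 cs GL lL cas b0.
have m1 : (chi * v + 2 * G + f * l) ^+ 2 <= 2 * (chi ^+ 2 * v ^+ 2) + (16 * G ^+ 2 + 4 * (f ^+ 2 * l ^+ 2)).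
  have h1 := sqr_ge0 (chi * v - (2 * G + f * l)).
  have h2 := sqr_ge0 (2 * G - f * l).
  have -> : (chi * v + 2 * G + f * l) ^+ 2 = 2 * (chi ^+ 2 * v ^+ 2) + 2 * (2 * G + f * l) ^+ 2
    - (chi * v - (2 * G + f * l)) ^+ 2 by ring.
  have -> : (2 * G + f * l) ^+ 2 = 8 * G ^+ 2 + 2 * (f ^+ 2 * l ^+ 2) - (2 * G - f * l) ^+ 2 by ring.
  lra.
apply: (le_trans (ler_wpM2l a0 m1)); rewrite mulrDr.
have -> : a * (2 * (chi ^+ 2 * v ^+ 2)) = 2 * (a * (chi ^+ 2 * v ^+ 2)) by ring.
rewrite lerD2l.
case: cas => [[-> ->]|[-> aao]].
  rewrite !expr0n /= !mulr0 addr0 mulr0; apply: mulr_ge0 => //.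
  apply: addr_ge0; apply: mulr_ge0; try lra.
  - by apply: mulr_ge0 => //; exact: exprn_ge0.
  - by apply: mulr_ge0 => //; exact: sqr_ge0.
  - by apply: mulr_ge0; [exact: exprn_ge0|exact: sqr_ge0].
rewrite !expr1n !mul1r; apply: ler_pM => //.
  apply: addr_ge0; apply: mulr_ge0 => //; first exact: sqr_ge0.
  by apply: mulr_ge0; exact: sqr_ge0.
apply: lerD.
  rewrite -mulrA; apply: ler_wpM2l => //; apply: le_trans cs _; exact: ler_wpM2r.
rewrite -mulrA; apply: ler_wpM2l => //; rewrite mulrC; apply: ler_wpM2r; first exact: sqr_ge0.
by rewrite -[l ^+ 2]real_normK ?num_real// lerXn2r// nnegrE.
Qed.

Section cutoff_estimates.
Variables (R : realType) (N : nat).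
Local Notation V := 'rV[R]_N.
Implicit Types (f g h w : V -> R) (i j : 'I_N) (x v c : V) (r : R).

Lemma cutoff_le2 c r x : 0 < r -> cutoff c r x <= cutoff c (2 * r) x.
Proof.
move=> r0; have [h|h] := leP (rad2 c x) ((2 * r) ^+ 2).
  by rewrite [leRHS]cutoff_eq1 ?cutoff_le1// mulr_gt0.
by rewrite cutoff_eq0 ?cutoff_ge0// ltW.
Qed.

Lemma cutoff_grd_le (L : R) c r x : 0 < r ->
  grd (cutoff c r) (cutoff c r) x <= L / r ^+ 2 ->
  grd (cutoff c r) (cutoff c r) x <= L / r ^+ 2 * cutoff c (2 * r) x.
Proof.
move=> r0 H; have [h|h] := leP (rad2 c x) ((2 * r) ^+ 2).
  by rewrite [X in _ * X]cutoff_eq1 ?mulr1// mulr_gt0.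
have [-> _] := cutoff_far0 r0 h; rewrite mulr_ge0 ?cutoff_ge0//.
exact: le_trans (grd_ge0 _ _) H.
Qed.

Lemma cutoff_lap_le (L : R) c r x : 0 < r ->
  `|lap (cutoff c r) x| <= L / r ^+ 2 ->
  `|lap (cutoff c r) x| <= L / r ^+ 2 * cutoff c (2 * r) x.
Proof.
move=> r0 H; have [h|h] := leP (rad2 c x) ((2 * r) ^+ 2).
  by rewrite [X in _ * X]cutoff_eq1 ?mulr1// mulr_gt0.
have [_ ->] := cutoff_far0 r0 h; rewrite normr0 mulr_ge0 ?cutoff_ge0//.
exact: le_trans (normr_ge0 _) H.
Qed.

Lemma cutoff_interior (L : R) c r f : 0 < r -> 1 <= L / r ^+ 2 ->
  (forall x, grd (cutoff c r) (cutoff c r) x <= L / r ^+ 2 /\ `|lap (cutoff c r) x| <= L / r ^+ 2) ->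
  smooth f ->
  [/\ bint (fun x => cutoff c r x ^+ 4 * lap f x ^+ 2) <=
        80 * 100 * 10 * (L / r ^+ 2) ^+ 3 * bint (fun x => cutoff c (2 * r) x * (f x ^+ 2 + lap (lap f) x ^+ 2)),
      bint (fun x => cutoff c r x ^+ 6 * grd (lap f) (lap f) x) <=
        80 * 100 * 10 * (L / r ^+ 2) ^+ 3 * bint (fun x => cutoff c (2 * r) x * (f x ^+ 2 + lap (lap f) x ^+ 2)) &
      bint (fun x => cutoff c r x ^+ 6 * grd f f x) <=
        80 * 100 * 10 * (L / r ^+ 2) ^+ 3 * bint (fun x => cutoff c (2 * r) x * (f x ^+ 2 + lap (lap f) x ^+ 2))].
Proof.
move=> r0 L1 H sf; have r20 : 0 < 2 * r by rewrite mulr_gt0.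
exact: (interior_estimate (smooth_cutoff c r) (bounded_support_cutoff c r0) (cc_cutoff c r20)
  (cutoff_ge0 c r) (fun x => cutoff_le2 c x r0) (cutoff_le1 c (2 * r)) L1
  (fun x => cutoff_grd_le r0 (H x).1) (fun x => cutoff_lap_le r0 (H x).2) sf).
Qed.

(** To be compared with [weight_in]: the bases 2 / r^2 on the annulus and 8 / r^2 near the centre
    give the gain 4^n that survives as n grows. The 2 comes from exp (1/4) <= 2. *)
Lemma weight_out c n (eps : R) r x : 0 < r -> 0 < eps -> r ^+ 2 <= rad2 c x -> rad2 c x <= 1 / 4 ->
  cweight c n eps x <= (2 / r ^+ 2) ^+ n.
Proof.
move=> r0 e0 h1 h2; rewrite /cweight mulrC expRM_natl -exprMn.
have r2 : 0 < r ^+ 2 by rewrite exprn_gt0.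
have d0 : 0 < rad2 c x + eps by apply: ltr_wpDl => //; exact: rad2_ge0.
have q0 : 0 <= cq c eps x by rewrite invr_ge0 ltW.
have q1 : cq c eps x <= (r ^+ 2)^-1 by rewrite /cq lef_pV2 ?posrE//; lra.
have e1 : expR (rad2 c x) <= 2.
  rewrite -[expR _]invrK -expRN -[leRHS]invrK lef_pV2 ?posrE ?invr_gt0// ?expR_gt0//.
  by apply: le_trans (expR_ge1Dx _); lra.
have x0 := expR_ge0 (rad2 c x).
have eq1 : expR (rad2 c x) * cq c eps x <= 2 / r ^+ 2 by exact: ler_pM.
apply: lerXn2r eq1; rewrite nnegrE; first exact: mulr_ge0.
by rewrite divr_ge0// ltW.
Qed.

Lemma weight_in c n (eps : R) r x : 0 < r -> 0 < eps -> rad2 c x <= r ^+ 2 / 16 -> eps <= r ^+ 2 / 16 ->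
  (8 / r ^+ 2) ^+ n <= cweight c n eps x.
Proof.
move=> r0 e0 h1 h2; rewrite /cweight.
have r2 : 0 < r ^+ 2 by rewrite exprn_gt0.
have d0 : 0 < rad2 c x + eps by apply: ltr_wpDl => //; exact: rad2_ge0.
apply: (@le_trans _ _ (cq c eps x ^+ n)).
  have q1 : 8 / r ^+ 2 <= cq c eps x.
    rewrite /cq -[8 / _]invrK invf_div lef_pV2 ?posrE ?divr_gt0//; lra.
  apply: lerXn2r q1; rewrite nnegrE; first by rewrite divr_ge0// ltW.
  by rewrite invr_ge0 ltW.
rewrite ler_peMr ?exprn_ge0 ?invr_ge0 ?(ltW d0)//.
by rewrite -expR0 ler_expR mulr_ge0 ?rad2_ge0.
Qed.

(** The derivatives of the cutoff live on the annulus, where [weight_out] replaces the weight by a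
    constant and the cutoff of radius 2r equals 1. What remains there are unweighted energies, ready
    for the interior estimate. *)
Lemma commutator_estimate (L : R) c n (eps : R) r w : 0 < r -> r <= 1 / 4 -> 0 < eps -> (0 < n)%N -> 0 <= L ->
  (forall x, grd (cutoff c r) (cutoff c r) x <= L /\ `|lap (cutoff c r) x| <= L) ->
  smooth w ->
  bint (fun x => cweight c n eps x * lap (fun x => cutoff c r x * w x) x ^+ 2) <=
  2 * bint (fun x => cweight c n eps x * (cutoff c r x ^+ 2 * lap w x ^+ 2)) +
  (2 / r ^+ 2) ^+ n * (16 * L * bint (fun x => cutoff c (2 * r) x ^+ 6 * grd w w x) +
    4 * L ^+ 2 * bint (fun x => cutoff c (2 * r) x ^+ 4 * w x ^+ 2)).
Proof.
move=> r0 r4 e0 n0 L0 H sw.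
have ca : continuous (cweight c n eps) by have [sa _] := radial_weight c n0 e0; exact: smooth_continuous.
have sc := smooth_cutoff c r; have bc := bounded_support_cutoff c r0.
have r20 : 0 < 2 * r by rewrite mulr_gt0.
have sl := smooth_lap sw.
have c1 : cc (fun x => cweight c n eps x * (cutoff c r x ^+ 2 * lap w x ^+ 2)).
  apply: ccMr => //; apply: ccMl; last by apply: smooth_continuous; exact: smoothX.
  by apply: ccP; [exact: smoothX|exact: bounded_supportX].
have c2 : cc (fun x => cutoff c (2 * r) x ^+ 6 * grd w w x).
  apply: ccMl; last by apply: smooth_continuous; exact: smooth_grd.
  by apply: ccP; [apply: smoothX; exact: smooth_cutoff|apply: bounded_supportX => //; exact: bounded_support_cutoff].
have c3 : cc (fun x => cutoff c (2 * r) x ^+ 4 * w x ^+ 2).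
  apply: ccMl; last by apply: smooth_continuous; exact: smoothX.
  by apply: ccP; [apply: smoothX; exact: smooth_cutoff|apply: bounded_supportX => //; exact: bounded_support_cutoff].
have z2 := ccZ (16 * L) c2; have z3 := ccZ (4 * L ^+ 2) c3.
have z1 := ccZ 2 c1; have z4 := ccZ ((2 / r ^+ 2) ^+ n) (ccD z2 z3).
rewrite -(bintZ _ c1) -(bintZ _ c2) -(bintZ _ c3) -(bintD z2 z3) -(bintZ _ (ccD z2 z3)) -(bintD z1 z4).
apply: le_bint; [|exact: (ccD z1 z4)|].
  apply: ccMr => //; apply: ccP; first by apply: smoothX; apply: smooth_lap; exact: smoothM.
  by apply: bounded_supportX => //; apply: bounded_support_lap; exact: bounded_supportMl.
move=> x; rewrite lapM//.
have [gx lx] := H x.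
apply: (@commutator_scalar _ _ _ _ _ _ _ _ (grd (cutoff c r) (cutoff c r) x)) => //.
- have d0 : 0 < rad2 c x + eps by apply: ltr_wpDl => //; exact: rad2_ge0.
  by rewrite mulr_ge0 ?expR_ge0// exprn_ge0// invr_ge0 ltW.
- exact: grd_ge0.
- by rewrite exprn_ge0// divr_ge0// sqr_ge0.
- exact: grd_cauchy_schwarz.
(* Three regions: inside radius r the cutoff is constant; between r and 2r the weight bound applies,
   since r <= 1/4 gives (2r)^2 <= 1/4; beyond 2r the cutoff vanishes. *)
- have [near|far] := ltP (rad2 c x) (r ^+ 2).
    by left; have [h1 h2] := cutoff_near0 r0 near; rewrite h1 h2.
  have [inn|out] := leP (rad2 c x) ((2 * r) ^+ 2).
    right; rewrite cutoff_eq1//; split => //; apply: weight_out => //.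
    apply: le_trans inn _; rewrite expr2; nra.
  left; have [h1 h2] := cutoff_far0 r0 out; split => //.
  have := grd_cauchy_schwarz (cutoff c r) w x; rewrite h1 mul0r => h3.
  by apply/eqP; rewrite -sqrf_eq0 eq_le h3 sqr_ge0.
- exact: cutoff_ge0.
Qed.

End cutoff_estimates.

#[local] Opaque cweight cutoff.

(** * The Carleman inequality for the bilaplacian *)

Section two_step_carleman.
Variables (R : realType) (N : nat).
Local Notation V := 'rV[R]_N.
Implicit Types (f g h w : V -> R) (x c : V) (r : R).

(** [X1], [X2], [X3] are the weighted integrals of f^2, (Delta f)^2, (Delta^2 f)^2; [ao * (K * W)]
    is the commutator error and [e * T1], [e * T2] are the errors of the small ball. The first
    inequality times nu^3 feeds on the second. *)
Lemma two_step_scalar (nu X1 X2 X3 ao K W e T1 T2 KW : R) : 1 <= nu -> 0 <= ao -> 0 <= W -> 0 <= e -> 0 <= K -> 0 <= KW ->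
  nu ^+ 3 * X1 <= 2 * X2 + ao * (K * W) + e * T1 ->
  nu ^+ 3 * X2 <= 2 * X3 + ao * (K * W) + e * T2 ->
  T1 <= KW -> T2 <= KW ->
  nu ^+ 6 * X1 <= 4 * X3 + nu ^+ 3 * ao * (3 * K) * W + 3 * nu ^+ 3 * e * KW.
Proof.
move=> n1 ao0 W0 e0 K0 KW0 h1 h2 t1 t2.
have n3 : 1 <= nu ^+ 3 by rewrite expr_ge1//; lra.
have n30 : 0 <= nu ^+ 3 by lra.
have := ler_wpM2l n30 h1.
have -> : nu ^+ 3 * (nu ^+ 3 * X1) = nu ^+ 6 * X1 by ring.
have -> : nu ^+ 3 * (2 * X2 + ao * (K * W) + e * T1) =
  2 * (nu ^+ 3 * X2) + nu ^+ 3 * (ao * (K * W)) + nu ^+ 3 * (e * T1) by ring.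
have -> : nu ^+ 3 * ao * (3 * K) * W = 3 * (nu ^+ 3 * (ao * (K * W))) by ring.
have -> : 3 * nu ^+ 3 * e * KW = 3 * (nu ^+ 3 * (e * KW)) by ring.
have a1 := ler_wpM2l e0 t1; have a2 := ler_wpM2l e0 t2.
have a3 := ler_wpM2l n30 a1.
have P0 : 0 <= ao * (K * W) by apply: mulr_ge0 => //; exact: mulr_ge0.
have P1 : ao * (K * W) <= nu ^+ 3 * (ao * (K * W)) by rewrite ler_peMl.
move: h2 a2 a3 P1 P0.
have P2 : e * KW <= nu ^+ 3 * (e * KW) by rewrite ler_peMl// mulr_ge0.
move: P2; clear; move: (nu ^+ 3 * X2) (ao * (K * W)) (nu ^+ 6 * X1) (e * T2) (e * KW) (nu ^+ 3 * (e * T1)) => a b k l m o.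
move: (nu ^+ 3 * b) (nu ^+ 3 * m) => q d; lra.
Qed.

Lemma cutoff_pow_le c r x n (a b : R) : 0 < r -> 0 <= a -> a <= b ->
  cutoff c r x ^+ n.+1 * a <= cutoff c (2 * r) x * b.
Proof.
move=> r0 a0 ab; have h0 := cutoff_ge0 c r x.
apply: ler_pM => //; first exact: exprn_ge0.
apply: le_trans (cutoff_le2 c x r0).
by rewrite exprS ler_piMr// exprn_ile1// cutoff_le1.
Qed.

Lemma cutoff_sq_le c r x (t : R) : (cutoff c r x * t) ^+ 2 <= t ^+ 2.
Proof.
by rewrite exprMn ler_piMl ?sqr_ge0// exprn_ile1 ?cutoff_ge0 ?cutoff_le1.
Qed.

(** The order of the quantifiers matters: [K] depends on the radius alone, [C] on n but not on rho.
    This permits rho -> 0 at fixed n, and then n -> oo. *)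
Lemma two_step c r : 0 < r -> r <= 1 / 4 -> exists2 K, 0 <= K &
  forall n, (0 < n)%N -> exists2 C, 0 <= C & forall rho, 0 < rho -> rho <= 1 / 2 ->
  forall f, smooth f ->
  n%:R ^+ 6 * bint (fun x => cweight c n (rho ^+ 4 / 2) x * (cutoff c r x ^+ 2 * f x ^+ 2)) <=
  4 * bint (fun x => cweight c n (rho ^+ 4 / 2) x * (cutoff c r x ^+ 2 * lap (lap f) x ^+ 2)) +
  n%:R ^+ 3 * (2 / r ^+ 2) ^+ n * K *
    bint (fun x => cutoff c (4 * r) x * (f x ^+ 2 + lap (lap f) x ^+ 2)) +
  C * (rho ^- (4 * n + 10)) * bint (fun x => cutoff c (2 * rho) x * (f x ^+ 2 + lap (lap f) x ^+ 2)).
Proof.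
move=> r0 r4.
have [L L1 HL] := cutoff_derivative_bound R N.
have r20 : 0 < 2 * r by rewrite mulr_gt0.
have r2_0 : 0 < r ^+ 2 by rewrite exprn_gt0.
have Lr0 : 0 <= L / r ^+ 2 by rewrite divr_ge0//; lra.
have Lr1 : 1 <= L / (2 * r) ^+ 2.
  rewrite ler_pdivlMr ?exprn_gt0// mul1r; apply: le_trans L1.
  by rewrite expr_le1 ?(ltW r20)//; lra.
pose Q := L / r ^+ 2; pose K1 := 80 * 100 * 10 * (L / (2 * r) ^+ 2) ^+ 3.
have K10 : 1 <= K1.
  have : 1 <= (L / (2 * r) ^+ 2) ^+ 3 by apply: exprn_ege1.
  rewrite /K1; lra.
pose K0 := 16 * Q * K1 + 4 * Q ^+ 2 * K1.
have K00 : 0 <= K0.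
  have K1' : 0 <= K1 by lra.
  apply: addr_ge0; apply: mulr_ge0 => //; apply: mulr_ge0 => //; exact: sqr_ge0.
exists (3 * K0); first by rewrite mulr_ge0.
move=> n n0.
pose K2 := 80 * 100 * 10 * L ^+ 3.
have K21 : 1 <= K2.
  have : 1 <= L ^+ 3 by apply: exprn_ege1.
  rewrite /K2; lra.
pose C := 3 * n%:R ^+ 3 * (40 * n%:R ^+ 3 * (2 ^+ n.+1 * expR n%:R)) * K2.
exists C.
  rewrite /C; apply: mulr_ge0; last lra.
  apply: mulr_ge0; first by apply: mulr_ge0 => //; exact: exprn_ge0.
  apply: mulr_ge0; first by apply: mulr_ge0 => //; exact: exprn_ge0.
  by apply: mulr_ge0; [exact: exprn_ge0|exact: expR_ge0].
move=> rho rho0 rho2 f sf.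
have rho1 : rho <= 1 by lra.
(* With this choice 2 eps = rho^4, so the small ball of the Carleman error is s + eps < rho^2, which
   lies inside radius rho. *)
set eps := rho ^+ 4 / 2.
have rho40 : 0 < rho ^+ 4 by rewrite exprn_gt0.
have eps0 : 0 < eps by rewrite divr_gt0.
have rho4 : rho ^+ 4 <= 1 / 8.
  apply: (@le_trans _ _ ((1 / 2) ^+ 4)); first by apply: lerXn2r; rewrite ?nnegrE//; lra.
  rewrite !exprS expr0; lra.
have eps4 : eps <= 1 / 4 by rewrite /eps; lra.
have eps2 : eps <= 1 / 2 by lra.
have nu1 : 1 <= n%:R :> R by rewrite ler1n.
pose ao := (2 / r ^+ 2) ^+ n.
have ao0 : 0 <= ao by rewrite exprn_ge0// divr_ge0// ltW.
pose e := 40 * n%:R ^+ 3 * (eps ^- n.+1 * expR n%:R).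
have e0 : 0 <= e.
  apply: mulr_ge0; first by apply: mulr_ge0 => //; exact: exprn_ge0.
  by apply: mulr_ge0; [rewrite invr_ge0 exprn_ge0// ltW|exact: expR_ge0].
have Q16 : 0 <= 16 * Q by rewrite mulr_ge0.
have Q4 : 0 <= 4 * Q ^+ 2 by rewrite mulr_ge0// sqr_ge0.
have rho20 : 0 < rho ^+ 2 by rewrite exprn_gt0.
have Lrho : 1 <= L / rho ^+ 2.
  rewrite ler_pdivlMr// mul1r; apply: le_trans L1.
  exact: exprn_ile1 (ltW rho0) rho1.
have K30 : 1 <= 80 * 100 * 10 * (L / rho ^+ 2) ^+ 3.
  rewrite -[leLHS]mul1r; apply: ler_pM => //; last exact: exprn_ege1.
  by rewrite -!natrM ler1n.
have sv := smooth_lap sf; have sg := smooth_lap sv.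
have sc := smooth_cutoff c r; have bc := bounded_support_cutoff c r0.
(* The fourth power matches the interior estimate at radius rho, which then bounds the small-ball
   error in Delta f by f and Delta^2 f on radius 2 rho. *)
pose th x := cutoff c rho x ^+ 4.
have cth : continuous th by apply: smooth_continuous; apply: smoothX; exact: smooth_cutoff.
have th0 x : 0 <= th x by rewrite exprn_ge0 ?cutoff_ge0.
have fout w x : 1 / 2 < rad2 c x + eps -> cutoff c r x * w x = 0.
  move=> h; rewrite cutoff_eq0 ?mul0r//.
  have : (2 * r) ^+ 2 <= 1 / 4 by rewrite expr2; nra.
  lra.
have thin x : (rad2 c x + eps) ^+ 2 < 2 * eps -> 1 <= th x.
  move=> h; rewrite /th cutoff_eq1 ?expr1n//.
  have : rad2 c x + eps < rho ^+ 2.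
    rewrite -ltr_sqr ?nnegrE ?sqr_ge0//; last by rewrite addr_ge0 ?rad2_ge0// ltW.
    by apply: lt_le_trans h _; rewrite /eps mulrC divfK// -exprM.
  lra.
have car w : smooth w -> n%:R ^+ 3 * bint (fun x => cweight c n eps x * (cutoff c r x * w x) ^+ 2) <=
    bint (fun x => cweight c n eps x * lap (fun x => cutoff c r x * w x) x ^+ 2) +
    e * bint (fun x => th x * (cutoff c r x * w x) ^+ 2).
  move=> sw; have scw := smoothM sc sw.
  exact: (carleman_inequality n0 eps0 eps2 scw (bounded_supportMl _ bc) cth th0 (fout w) thin).
have com w : smooth w -> _ := fun sw => commutator_estimate r0 r4 eps0 n0 Lr0 (fun x => HL c r x r0) sw.
have [i1 i2 i3] := cutoff_interior r20 Lr1 (fun x => HL c (2 * r) x r20) sf.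
have [j1 _ _] := cutoff_interior rho0 Lrho (fun x => HL c rho x rho0) sf.
set Wr := bint (fun x => cutoff c (2 * rho) x * (f x ^+ 2 + lap (lap f) x ^+ 2)) in j1 *.
have W1E : bint (fun x => cutoff c (2 * (2 * r)) x * (f x ^+ 2 + lap (lap f) x ^+ 2)) =
    bint (fun x => cutoff c (4 * r) x * (f x ^+ 2 + lap (lap f) x ^+ 2)).
  by rewrite mulrA -natrM.
rewrite W1E in i1 i2 i3.
set W := bint (fun x => cutoff c (4 * r) x * (f x ^+ 2 + lap (lap f) x ^+ 2)) in i1 i2 i3 *.
have csum : continuous (fun x => f x ^+ 2 + lap (lap f) x ^+ 2).
  by apply: smooth_continuous; apply: smoothD; exact: smoothX.
have sum0 x : 0 <= f x ^+ 2 + lap (lap f) x ^+ 2 by rewrite addr_ge0 ?sqr_ge0.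
have W0 : 0 <= W by apply: bint_ge0 => x; rewrite mulr_ge0 ?cutoff_ge0.
have Wr0 : 0 <= Wr by apply: bint_ge0 => x; rewrite mulr_ge0 ?cutoff_ge0.
have ccW s : 0 < s -> cc (fun x => cutoff c s x * (f x ^+ 2 + lap (lap f) x ^+ 2)).
  by move=> s0; exact: (ccMl (cc_cutoff c s0) csum).
have ccut n' s w : (0 < n')%N -> 0 < s -> smooth w -> cc (fun x => cutoff c s x ^+ n' * w x).
  move=> n'0 s0 sw; apply: ccMl (smooth_continuous sw).
  exact: (ccP (smoothX n' (smooth_cutoff c s)) (bounded_supportX n'0 (bounded_support_cutoff c s0))).
have f4 : bint (fun x => cutoff c (2 * r) x ^+ 4 * f x ^+ 2) <= W.
  apply: le_bint; [exact: (ccut 4 _ _ isT r20 (smoothX 2 sf))|exact: (ccW _ (mulr_gt0 (ltr0n _ 4) r0))|].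
  move=> x; have -> : 4 * r = 2 * (2 * r) by rewrite mulrA -natrM.
  by apply: (cutoff_pow_le c x 3 r20 (sqr_ge0 _)); rewrite lerDl sqr_ge0.
pose KW := 80 * 100 * 10 * (L / rho ^+ 2) ^+ 3 * Wr.
have KW0 : 0 <= KW := mulr_ge0 (le_trans ler01 K30) Wr0.
have key w B1 B2 : smooth w -> bint (fun x => cutoff c (2 * r) x ^+ 6 * grd w w x) <= B1 ->
    bint (fun x => cutoff c (2 * r) x ^+ 4 * w x ^+ 2) <= B2 -> B1 <= K1 * W -> B2 <= K1 * W ->
    n%:R ^+ 3 * bint (fun x => cweight c n eps x * (cutoff c r x ^+ 2 * w x ^+ 2)) <=
    2 * bint (fun x => cweight c n eps x * (cutoff c r x ^+ 2 * lap w x ^+ 2)) +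
    ao * (K0 * W) + e * bint (fun x => th x * (cutoff c r x * w x) ^+ 2).
  move=> sw b1 b2 b3 b4.
  have -> : bint (fun x => cweight c n eps x * (cutoff c r x ^+ 2 * w x ^+ 2)) =
      bint (fun x => cweight c n eps x * (cutoff c r x * w x) ^+ 2).
    apply: eq_bint => x; congr (_ * _); exact: esym (exprMn 2 (cutoff c r x) (w x)).
  apply: (le_trans (car w sw)); rewrite lerD2r.
  apply: (le_trans (com w sw)); rewrite lerD2l; apply: (ler_wpM2l ao0).
  rewrite /K0 [leRHS]mulrDl -!(mulrA _ K1); apply: lerD.
    exact: (ler_wpM2l Q16 (le_trans b1 b3)).
  exact: (ler_wpM2l Q4 (le_trans b2 b4)).
have W1 : W <= K1 * W := ler_peMl W0 K10.
have k1 := key f _ _ sf i3 f4 (lexx _) W1.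
have k2 := key (lap f) _ _ sv i2 i1 (lexx _) (lexx _).
have T1 : bint (fun x => th x * (cutoff c r x * f x) ^+ 2) <= KW.
  apply: (@le_trans _ _ Wr); last exact: (ler_peMl Wr0 K30).
  apply: le_bint; [exact: (ccut 4 rho _ isT rho0 (smoothX 2 (smoothM sc sf)))|exact: (ccW _ (mulr_gt0 (ltr0n _ 2) rho0))|].
  move=> x; apply: (cutoff_pow_le c x 3 rho0 (sqr_ge0 _)).
  by apply: le_trans (cutoff_sq_le _ _ _ _) _; rewrite lerDl sqr_ge0.
have T2 : bint (fun x => th x * (cutoff c r x * lap f x) ^+ 2) <= KW.
  apply: le_trans j1.
  apply: le_bint.
  - exact: (ccut 4 rho _ isT rho0 (smoothX 2 (smoothM sc sv))).
  - exact: (ccut 4 rho _ isT rho0 (smoothX 2 sv)).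
  move=> x; apply: ler_wpM2l; last exact: cutoff_sq_le.
  exact: exprn_ge0 (cutoff_ge0 _ _ _).
(* The exponent collects 4(n + 1) from eps^-(n+1) and 6 from the third power of L / rho^2 in the
   interior estimate. *)
have -> : C * rho ^- (4 * n + 10) * Wr = 3 * n%:R ^+ 3 * e * KW.
  have -> : rho ^- (4 * n + 10) = (rho ^+ 4) ^- n.+1 * (rho ^+ 2) ^- 3.
    by rewrite -!exprM -invfM -exprD mulnS (addnC 4) -addnA.
  have E1 : eps ^- n.+1 = 2 ^+ n.+1 * (rho ^+ 4) ^- n.+1.
    by rewrite /eps -exprVn invf_div exprMn exprVn.
  have E2 : (L / rho ^+ 2) ^+ 3 = L ^+ 3 * (rho ^+ 2) ^- 3 by rewrite exprMn exprVn.
  rewrite /KW /C /e /K2 E1 E2.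
  move: ((rho ^+ 4) ^- n.+1) ((rho ^+ 2) ^- 3) (2 ^+ n.+1) (expR n%:R) => t1 t2 t3 t4.
  clearbody Wr; clear; ring.
exact: (two_step_scalar nu1 ao0 W0 e0 K00 KW0 k1 k2 T1 T2).
Qed.

End two_step_carleman.

(** * Vanishing of approximate solutions *)

Section local_vanishing.
Variables (R : realType) (N : nat).
Local Notation V := 'rV[R]_N.
Implicit Types (f g h w : V -> R) (x c : V).

Lemma le_bint_weighted w f h (A B : R) : cc w -> (forall x, 0 <= w x) -> continuous f -> continuous h ->
  (forall x, w x != 0 -> f x <= A * h x + B) ->
  bint (fun x => w x * f x) <= A * bint (fun x => w x * h x) + B * bint w.
Proof.
move=> cw w0 cf ch H; rewrite -!bintZ//; last exact: ccMl.
rewrite -bintD//; [|exact/ccZ/ccMl|exact: ccZ].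
apply: le_bint; [exact: ccMl|apply: ccD; [exact/ccZ/ccMl|exact: ccZ]|].
move=> x; have [->|wx] := eqVneq (w x) 0; first by rewrite !mul0r !mulr0 addr0.
by apply: le_trans (ler_wpM2l (w0 x) (H x wx)) _; rewrite mulrDr mulrCA (mulrC B).
Qed.

Lemma ler_add_small (X Y Z : R) : (forall s, 0 < s -> X <= Y + s * Z) -> X <= Y.
Proof.
move=> H; apply/ler_addgt0Pr => e e0.
have Z1 : 0 < `|Z| + 1 by rewrite ltr_wpDl.
apply: le_trans (H (e / (`|Z| + 1)) (divr_gt0 e0 Z1)) _; rewrite lerD2l.
rewrite mulrAC ler_pdivrMr// ler_pM2l//; have := ler_norm Z; lra.
Qed.

Lemma archimedean_le0 (D B : R) n0 : (forall n, (n0 <= n)%N -> n%:R * D <= B) -> D <= 0.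
Proof.
move=> H; rewrite leNgt; apply/negP => D0.
have := archi_boundP (normr_ge0 (B / D)); set k := Num.bound _ => kP.
have := H (maxn n0 k) (leq_maxl _ _); apply/negP; rewrite -ltNge -ltr_pdivrMr//.
apply: le_lt_trans (ler_norm _) _; apply: lt_le_trans kP _.
by rewrite ler_nat leq_maxr.
Qed.

(** Transfers the estimate from an approximant [f] to its limit: [F], [G], [E], [H] are integrals
    built on [f], while [X], [W], [w] are built on the limit. The approximation error enters only
    through a term linear in [s], which may then tend to 0. *)
Lemma approx_scalar (X F G E H W w s n6 k cc b e h M2 : R) : 0 <= n6 -> 0 <= k -> 0 <= cc ->
  X <= 2 * F + 2 * s * b -> n6 * F <= 4 * G + k * E + cc * H ->
  G <= 2 * M2 * X + 2 * s * b -> E <= 2 * (1 + M2) * W + 4 * s * e ->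
  H <= 2 * (1 + M2) * w + 4 * s * h ->
  n6 * X <= 16 * M2 * X + 4 * (1 + M2) * (k * W + cc * w) +
    s * (16 * b + 2 * n6 * b + 8 * k * e + 8 * cc * h).
Proof.
move=> n0 k0 c0 h1 h2 h3 h4 h5.
have := ler_wpM2l n0 h1; have := ler_wpM2l k0 h4; have := ler_wpM2l c0 h5; lra.
Qed.

Lemma sum_sq_scalar (y z v m s : R) : z <= 2 * y + 2 * s -> v <= 2 * m * y + 2 * s ->
  z + v <= 2 * (1 + m) * y + 4 * s.
Proof. lra. Qed.

Lemma double_le (s t : R) : s <= t -> 0 <= t -> 2 * s <= 4 * t.
Proof. lra. Qed.

#[local] Opaque cweight cutoff lap grd rad2 bint.

(** The limit [ut] is never differentiated: the Carleman estimate is applied to approximants and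
    contains only f and Delta^2 f, both controlled by [ut] up to [s]. The factor 8r is the reach of
    the cutoff of radius 4r. *)
Lemma local_vanishing c (r M : R) (ut : V -> R) : 0 < r -> r <= 1 / 4 -> continuous ut ->
  (forall s, 0 < s -> exists2 f, smooth f & forall x, rad2 c x <= (8 * r) ^+ 2 ->
     `|f x - ut x| <= s /\ `|lap (lap f) x| <= M * `|ut x| + s) ->
  (forall k (s d : R), 0 < s -> 0 < d -> exists rho, [/\ 0 < rho, rho <= d &
     bint (fun x => cutoff c (2 * rho) x * ut x ^+ 2) <= s * rho ^+ k]) ->
  forall x, rad2 c x <= (r / 8) ^+ 2 -> ut x = 0.
Proof.
move=> r0 r4 cu Hf Hv.
have cu2 : continuous (fun x => ut x ^+ 2).
  by move=> x; exact: cvgM (cu x) (cu x).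
have [K K0 TS] := two_step c r0 r4.
have r80 : 0 < r / 8 by rewrite divr_gt0.
set D := bint (fun x => cutoff c (r / 8) x * ut x ^+ 2).
have D0 : 0 <= D by apply: bint_ge0 => x; rewrite mulr_ge0 ?cutoff_ge0 ?sqr_ge0.
pose W := bint (fun x => cutoff c (4 * r) x * ut x ^+ 2).
have W0 : 0 <= W by apply: bint_ge0 => x; rewrite mulr_ge0 ?cutoff_ge0 ?sqr_ge0.
have cut_in s x : 0 < s -> s <= 4 * r -> cutoff c s x != 0 -> rad2 c x <= (8 * r) ^+ 2.
  move=> s0 sr h; rewrite leNgt; apply/negP => h2; move/eqP: h; apply.
  apply: cutoff_eq0 => //; apply: le_trans (ltW h2).
  by rewrite ler_sqr ?nnegrE; nra.
have main n rho C : (0 < n)%N -> 0 < rho -> rho <= r -> 0 <= C ->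
    (forall f, smooth f ->
  n%:R ^+ 6 * bint (fun x => cweight c n (rho ^+ 4 / 2) x * (cutoff c r x ^+ 2 * f x ^+ 2)) <=
  4 * bint (fun x => cweight c n (rho ^+ 4 / 2) x * (cutoff c r x ^+ 2 * lap (lap f) x ^+ 2)) +
  n%:R ^+ 3 * (2 / r ^+ 2) ^+ n * K *
    bint (fun x => cutoff c (4 * r) x * (f x ^+ 2 + lap (lap f) x ^+ 2)) +
  C * (rho ^- (4 * n + 10)) * bint (fun x => cutoff c (2 * rho) x * (f x ^+ 2 + lap (lap f) x ^+ 2))) ->
  32 * M ^+ 2 <= n%:R ^+ 6 ->
  n%:R ^+ 6 * ((8 / r ^+ 2) ^+ n * D) <= 8 * (1 + M ^+ 2) * (n%:R ^+ 3 * (2 / r ^+ 2) ^+ n * K * W +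
    C * (rho ^- (4 * n + 10)) * bint (fun x => cutoff c (2 * rho) x * ut x ^+ 2)).
  move=> n0 rho0 rhor C0 {}TS nM.
  have eps0 : 0 < rho ^+ 4 / 2 by rewrite divr_gt0 ?exprn_gt0.
  have eps16 : rho ^+ 4 / 2 <= r ^+ 2 / 16.
    have a1 : rho ^+ 2 <= r ^+ 2 by rewrite ler_sqr ?nnegrE // ltW.
    have a2 : r ^+ 2 <= 1 / 16 by rewrite expr2; nra.
    have a3 : 0 <= rho ^+ 2 by rewrite sqr_ge0.
    have -> : rho ^+ 4 = rho ^+ 2 * rho ^+ 2 by rewrite -exprD.
    have : rho ^+ 2 * rho ^+ 2 <= r ^+ 2 * (1 / 16).
      by apply: ler_pM => //; exact: le_trans a2.
    have := mulr_ge0 a3 a3; move: (rho ^+ 2 * _) (r ^+ 2) => y z; lra.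
  have [sa _] := radial_weight c n0 eps0.
  pose w1 x := cweight c n (rho ^+ 4 / 2) x * cutoff c r x ^+ 2.
  have cw1 : cc w1.
    apply: ccMr; first exact: smooth_continuous.
    exact: (ccP (smoothX 2 (smooth_cutoff c r)) (bounded_supportX _ (bounded_support_cutoff c r0))).
  have w10 x : 0 <= w1 x by rewrite mulr_ge0 ?sqr_ge0// ltW ?weight_gt0.
  have w1E h : bint (fun x => cweight c n (rho ^+ 4 / 2) x * (cutoff c r x ^+ 2 * h x)) =
      bint (fun x => w1 x * h x) by apply: eq_bint => x; rewrite mulrA.
  have cE s : 0 < s -> cc (cutoff c s) := fun s0 => cc_cutoff c s0.
  pose X := bint (fun x => w1 x * ut x ^+ 2).
  have XD : (8 / r ^+ 2) ^+ n * D <= X.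
    rewrite /D -bintZ; last exact: (ccMl (cE _ r80) cu2).
    apply: le_bint; [exact/ccZ/(ccMl (cE _ r80))|exact: ccMl|] => x.
    rewrite mulrA; apply: ler_wpM2r; first exact: sqr_ge0.
    have [h|h] := ltP ((2 * (r / 8)) ^+ 2) (rad2 c x).
      by rewrite (cutoff_eq0 r80 (ltW h)) mulr0.
    have h2 : rad2 c x <= r ^+ 2 / 16.
      by apply: le_trans h _; move: (r) => t; rewrite le_eqVlt; apply/orP; left; apply/eqP; field.
    have h3 : rad2 c x <= r ^+ 2 by apply: le_trans h2 _; have := sqr_ge0 r; lra.
    rewrite /w1 (cutoff_eq1 r0 h3) expr1n mulr1.
    apply: le_trans (weight_in n r0 eps0 h2 eps16).
    rewrite ler_piMr ?cutoff_le1// exprn_ge0// divr_ge0// sqr_ge0//.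
  pose w := bint (fun x => cutoff c (2 * rho) x * ut x ^+ 2).
  pose kk := n%:R ^+ 3 * (2 / r ^+ 2) ^+ n * K.
  have kk0 : 0 <= kk by rewrite !mulr_ge0// exprn_ge0// divr_ge0// sqr_ge0.
  pose ck := C * (rho ^- (4 * n + 10)).
  have ck0 : 0 <= ck by rewrite mulr_ge0// invr_ge0 exprn_ge0// ltW.
  have rr0 : 0 < 4 * r by rewrite mulr_gt0.
  have rh0 : 0 < 2 * rho by rewrite mulr_gt0.
  have key : n%:R ^+ 6 * X <= 16 * M ^+ 2 * X + 4 * (1 + M ^+ 2) * (kk * W + ck * w).
    pose Z := 16 * bint w1 + 2 * n%:R ^+ 6 * bint w1 + 8 * kk * bint (cutoff c (4 * r)) +
      8 * ck * bint (cutoff c (2 * rho)).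
    apply: (@ler_add_small _ _ Z) => s s0; rewrite /Z.
    (* An approximation within the square root of s makes the squares differ by terms of order s. *)
    have ss0 : 0 < Num.sqrt s by rewrite sqrtr_gt0.
    have [f sf Hfs] := Hf _ ss0.
    have pt x : rad2 c x <= (8 * r) ^+ 2 -> [/\ ut x ^+ 2 <= 2 * f x ^+ 2 + 2 * s,
        f x ^+ 2 <= 2 * ut x ^+ 2 + 2 * s & lap (lap f) x ^+ 2 <= 2 * M ^+ 2 * ut x ^+ 2 + 2 * s].
      move=> /Hfs; move: (ut x) (f x) (lap _ _) => y z v [h1 h2].
      have h3 : (z - y) ^+ 2 <= s.
        by rewrite -[leRHS]sqr_sqrtr ?(ltW s0)// -[leLHS]real_normK ?num_real// ler_sqr ?nnegrE ?(ltW ss0).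
      have h4 : v ^+ 2 <= 2 * M ^+ 2 * y ^+ 2 + 2 * s.
        rewrite -[v ^+ 2]real_normK ?num_real//.
        apply: (@le_trans _ _ ((M * `|y| + Num.sqrt s) ^+ 2)).
          by rewrite ler_sqr ?nnegrE ?(le_trans _ h2).
        have := sqr_ge0 (M * `|y| - Num.sqrt s); rewrite sqrrB sqrrD exprMn sqr_sqrtr ?(ltW s0)// real_normK ?num_real//.
        move: (M ^+ 2 * y ^+ 2) (M ^+ 2) (y ^+ 2) (M * `|y| * Num.sqrt s) (mulrA 2 (M^+2) (y^+2)) => a1 a2 a3 a4.
        by move=> <-; lra.
      have := sqr_ge0 (z - 2 * y); have := sqr_ge0 (2 * z - y).
      by split => //; nra.
    have cf2 : continuous (fun x => f x ^+ 2) by apply/smooth_continuous/smoothX.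
    have cg2 : continuous (fun x => lap (lap f) x ^+ 2) by apply/smooth_continuous/smoothX/smooth_lap/smooth_lap.
    have cfg2 : continuous (fun x => f x ^+ 2 + lap (lap f) x ^+ 2).
      by move=> x; exact: cvgD (cf2 x) (cg2 x).
    have w1in x : w1 x != 0 -> rad2 c x <= (8 * r) ^+ 2.
      move=> h; apply: (@cut_in r) => //; first lra.
      by apply: contraNneq h => h; rewrite /w1 h expr0n/= mulr0.
    have := TS f sf; rewrite !w1E => TSf.
    apply: (approx_scalar (exprn_ge0 6 (ler0n R n)) kk0 ck0 _ TSf).
    - by apply: le_bint_weighted => // x /w1in/pt[].
    - by apply: le_bint_weighted => // x /w1in/pt[].
    - apply: le_bint_weighted => //; [exact: cE|by move=> x; exact: cutoff_ge0|].
      by move=> x /(cut_in _ _ rr0 (lexx _))/pt[_]; exact: sum_sq_scalar.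
    - apply: le_bint_weighted => //; [exact: cE|by move=> x; exact: cutoff_ge0|].
      have le := double_le rhor (ltW r0).
      by move=> x /(cut_in _ _ rh0 le)/pt[_]; exact: sum_sq_scalar.
  have X0 : 0 <= X by apply: bint_ge0 => x; rewrite mulr_ge0 ?sqr_ge0.
  apply: (@le_trans _ _ (n%:R ^+ 6 * X)); first by apply: ler_wpM2l => //; rewrite exprn_ge0.
  (* As 32 M^2 <= n^6, the term 16 M^2 X is at most half of the left side. *)
  have := ler_wpM2r X0 nM; move: key; rewrite -/kk -/ck -/w; clearbody X.
  move: (n%:R ^+ 6) (kk * W + ck * w) (M ^+ 2); clear => a1 a2 a3; lra.
(* Infinite-order vanishing with exponent 4n + 10 compensates the power of rho, and its arbitrary
   factor [s] kills the last term. Dividing by n^3 (2 / r^2)^n leaves n^3 4^n D bounded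
   independently of n, of which only n D is kept. *)
have step2 n : (0 < n)%N -> 32 * M ^+ 2 <= n%:R ^+ 6 -> n%:R * D <= 8 * (1 + M ^+ 2) * (K * W).
  move=> n0 nM; have [C C0 TSn] := TS n n0.
  have M1 : 0 <= 8 * (1 + M ^+ 2) by have := sqr_ge0 M; lra.
  pose q := 2 / r ^+ 2.
  have q0 : 0 < q by rewrite divr_gt0// exprn_gt0.
  have : n%:R ^+ 6 * ((8 / r ^+ 2) ^+ n * D) <= 8 * (1 + M ^+ 2) * (n%:R ^+ 3 * q ^+ n * K * W).
    apply: (@ler_add_small _ _ (8 * (1 + M ^+ 2) * C)) => s s0.
    have [rho [rho0 rhor hw]] := Hv (4 * n + 10)%N s r s0 r0.
    have rho2 : rho <= 1 / 2 by lra.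
    apply: le_trans (main n rho C n0 rho0 rhor C0 (TSn rho rho0 rho2) nM) _.
    rewrite mulrDr lerD2l [s * _]mulrCA; apply: ler_wpM2l => //.
    rewrite [s * _]mulrC -!mulrA; apply: ler_wpM2l => //.
    by rewrite mulrC ler_pdivrMr ?exprn_gt0.
  have -> : 8 / r ^+ 2 = 4 * q by rewrite /q mulrA -natrM.
  rewrite exprMn => h.
  have n1 : 1 <= n%:R :> R by rewrite ler1n.
  have n3 : 0 < n%:R ^+ 3 :> R by rewrite exprn_gt0// (lt_le_trans ltr01).
  have qn : 0 < q ^+ n by rewrite exprn_gt0.
  have h2 : n%:R ^+ 3 * (4 ^+ n * D) <= 8 * (1 + M ^+ 2) * (K * W).
    rewrite -(ler_pM2l (mulr_gt0 n3 qn)); move: h.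
    have -> : n%:R ^+ 6 = n%:R ^+ 3 * n%:R ^+ 3 :> R by rewrite -exprD.
    move: (n%:R ^+ 3 : R) (q ^+ n) (4 ^+ n : R) (M ^+ 2) => a1 a2 a3 a4.
    by apply: etrans; congr (_ <= _); ring.
  apply: le_trans h2; apply: ler_pM; [exact: ler0n|exact: D0| |].
    by rewrite exprSr ler_peMl// exprn_ege1.
  by apply: (ler_peMl D0); apply: exprn_ege1; rewrite ler1n.
have D00 : D = 0.
  apply/eqP; rewrite eq_le D0 andbT.
  pose k := Num.bound (32 * M ^+ 2).
  apply: (@archimedean_le0 _ (8 * (1 + M ^+ 2) * (K * W)) k.+1) => n kn.
  apply: step2; first exact: leq_trans kn.
  have n1 : 1 <= n%:R :> R by rewrite ler1n; exact: leq_trans kn.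
  apply: (@le_trans _ _ n%:R); last by rewrite exprS ler_peMr ?exprn_ege1.
  apply: ltW; apply: (lt_trans (archi_boundP _)); first by rewrite mulr_ge0 ?sqr_ge0.
  by rewrite ltr_nat.
move=> x xr.
have := bint_eq0 (ccMl (cc_cutoff c r80) cu2) _ D00 => /(_ _ x) h.
have /eqP := h (fun y => mulr_ge0 (cutoff_ge0 c (r / 8) y) (sqr_ge0 (ut y))).
by rewrite (cutoff_eq1 r80 xr) mul1r sqrf_eq0 => /eqP.
Qed.

End local_vanishing.

#[local] Transparent partial lap grd euler rad2 bint cweight cutoff.
(** * Integrals for the completed measure *)

Section integrable_functions.
Context d (T : measurableType d) (R : realType) (nu : {measure set T -> \bar R}).
Implicit Types (f g U : T -> R).

Definition rintegrable U := nu.-integrable setT (EFin \o U).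

Definition rint U : R := \int[nu]_x U x.

Lemma rintegrable_measurable U : rintegrable U -> measurable_fun setT U.
Proof. by move=> /measurable_int /measurable_EFinP. Qed.

Lemma rintegrable_mul U f (M : R) : rintegrable U -> measurable_fun setT f -> (forall x, `|f x| <= M) ->
  rintegrable (fun x => U x * f x).
Proof.
move=> iU mf fM.
have := @integrableMl _ T R nu setT measurableT (EFin \o U) f iU mf.
have bf : [bounded f x | x in [set: T]].
  by exists M; split => [|y My x _]; [exact: num_real|exact: le_trans (fM x) (ltW My)].
by move=> /(_ bf); apply: eq_integrable.
Qed.

Lemma rintegrable_le U f : rintegrable U -> measurable_fun setT f -> (forall x, `|f x| <= `|U x|) -> rintegrable f.
Proof.
move=> iU mf fU; apply: (le_integrable measurableT _ _ iU) => /=.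
  exact/measurable_EFinP.
by move=> x _ /=; rewrite lee_fin.
Qed.

Lemma rintegrableD U f : rintegrable U -> rintegrable f -> rintegrable (fun x => U x + f x).
Proof. by move=> iU jf; have := integrableD measurableT iU jf; apply: eq_integrable. Qed.

Lemma rintegrableB U f : rintegrable U -> rintegrable f -> rintegrable (fun x => U x - f x).
Proof. by move=> iU jf; have := integrableB measurableT iU jf; apply: eq_integrable. Qed.

Lemma rintegrableZ (c : R) U : rintegrable U -> rintegrable (fun x => c * U x).
Proof. by move=> iU; have := integrableZl measurableT c iU; apply: eq_integrable. Qed.

Lemma rintegrable0 : rintegrable (fun=> 0). Proof. exact: integrable0. Qed.

Lemma rintegrable_sum (I : Type) (s : seq I) (F : I -> T -> R) :
  (forall i, rintegrable (F i)) -> rintegrable (fun x => \sum_(i <- s) F i x).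
Proof.
move=> H; elim: s => [|i s IH].
  by rewrite (_ : (fun x => _) = fun=> 0); [exact: rintegrable0|apply/funext => x; rewrite big_nil].
rewrite (_ : (fun x => _) = fun x => F i x + \sum_(j <- s) F j x); first exact: rintegrableD.
by apply/funext => x; rewrite big_cons.
Qed.

Lemma rintegrable_norm U : rintegrable U -> rintegrable (fun x => `|U x|).
Proof.
move=> iU; apply: (rintegrable_le iU) => [|x]; last by rewrite normr_id.
by apply: measurableT_comp => //; exact: rintegrable_measurable.
Qed.

Lemma rintD U f : rintegrable U -> rintegrable f -> rint (fun x => U x + f x) = rint U + rint f.
Proof. by move=> iU jf; apply: RintegralD. Qed.

Lemma rintB U f : rintegrable U -> rintegrable f -> rint (fun x => U x - f x) = rint U - rint f.
Proof. by move=> iU jf; apply: RintegralB. Qed.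

Lemma rintZ (c : R) U : rintegrable U -> rint (fun x => c * U x) = c * rint U.
Proof. by move=> iU; apply: RintegralZl. Qed.

Lemma rint0 : rint (fun=> 0) = 0.
Proof. by rewrite /rint Rintegral_cst// mul0r. Qed.

Lemma eq_rint f g : (forall x, f x = g x) -> rint f = rint g.
Proof. by move=> H; congr rint; exact/funext. Qed.

Lemma rint_sum (I : Type) (s : seq I) (F : I -> T -> R) :
  (forall i, rintegrable (F i)) -> rint (fun x => \sum_(i <- s) F i x) = \sum_(i <- s) rint (F i).
Proof.
move=> H; elim: s => [|i s IH].
  by rewrite big_nil -[RHS]rint0; apply: eq_rint => x; rewrite big_nil.
rewrite big_cons -IH -rintD//; last exact: rintegrable_sum.
by apply: eq_rint => x; rewrite big_cons.
Qed.

Lemma le_rint f g : rintegrable f -> rintegrable g -> (forall x, f x <= g x) -> rint f <= rint g.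
Proof. by move=> jf ig H; apply: le_Rintegral. Qed.

Lemma rint_ge0 f : (forall x, 0 <= f x) -> 0 <= rint f.
Proof. by move=> H; apply: Rintegral_ge0. Qed.

Lemma normr_rint f : rintegrable f -> `|rint f| <= rint (fun x => `|f x|).
Proof. by move=> jf; apply: le_normr_Rintegral. Qed.

Lemma normr_rint_le f g : rintegrable f -> rintegrable g -> (forall x, `|f x| <= g x) -> `|rint f| <= rint g.
Proof.
move=> jf ig H; apply: le_trans (normr_rint jf) _.
by apply: le_rint => //; exact: rintegrable_norm.
Qed.

Lemma ae_eq_rint f g : measurable_fun setT f -> measurable_fun setT g ->
  {ae nu, forall x, f x = g x} -> rint f = rint g.
Proof.
move=> mf mg fg; rewrite /rint /Rintegral; congr fine.
apply: ae_eq_integral => //; [exact/measurable_EFinP|exact/measurable_EFinP|].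
by apply: filterS fg => x /= ->.
Qed.

Lemma ae_le_rint f g : rintegrable f -> rintegrable g -> {ae nu, forall x, f x <= g x} -> rint f <= rint g.
Proof.
move=> jf ig fg; rewrite -subr_ge0 -rintB//.
(* Truncating at 0 changes the integrand on a null set only and makes it nonnegative everywhere. *)
have -> : rint (fun x => g x - f x) = rint (fun x => Num.max 0 (g x - f x)).
  apply: ae_eq_rint; first exact/rintegrable_measurable/rintegrableB.
    by apply: measurable_maxr => //; exact/rintegrable_measurable/rintegrableB.
  apply: filterS fg => x fg.
  by rewrite max_r// subr_ge0.
by apply: rint_ge0 => x; rewrite le_max lexx.
Qed.

End integrable_functions.

Section lebesgue_integral.
Variables (R : realType) (N : nat).
Local Notation V := 'rV[R]_N.
Local Notation L := (lebesgue_space R N).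
Local Notation mu := (lebesgue R N).
Implicit Types (f g h k U : V -> R) (A B K : set V).

Local Notation lintegrable := (@rintegrable _ L R mu).
Local Notation lint := (@rint _ L R mu).

Lemma borel_lebesgue_measurable A :
  measurable (A : set (borel_space R N)) -> measurable (A : set L).
Proof. exact: caratheodory_measurable_mu_ext. Qed.

Lemma measurable_fun_borel d (T : measurableType d) (f : V -> T) :
  measurable_fun setT (f : borel_space R N -> T) -> measurable_fun setT (f : L -> T).
Proof.
move=> mf _ B mB; rewrite setTI; apply: borel_lebesgue_measurable.
by rewrite -[X in measurable X]setTI; exact: mf.
Qed.

Lemma lebesgue_borel A : measurable (A : set (borel_space R N)) -> mu A = borel_lebesgue R N A.
Proof. exact: measurable_mu_extE. Qed.

Lemma continuous_lebesgue f : continuous f -> measurable_fun setT (f : L -> measurableTypeR R).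
Proof. by move=> cf; apply: measurable_fun_borel; exact: continuous_borel. Qed.

Let id_LB (x : L) : borel_space R N := x.

Let measurable_id_LB : measurable_fun setT id_LB.
Proof. by move=> _ B mB; rewrite setTI; exact: borel_lebesgue_measurable. Qed.

(** The identity is measurable from the completed space to the Borel one and carries the completed
    measure to the Borel measure; the change of variables formula does the rest. *)
Lemma integral_lebesgue_borel (f : V -> \bar R) : measurable_fun setT (f : borel_space R N -> \bar R) ->
  (forall x, 0 <= f x)%E ->
  (\int[mu]_x (f : L -> \bar R) x = \int[borel_lebesgue R N]_x (f : borel_space R N -> \bar R) x)%E.
Proof.
move=> mf f0.
have := @ge0_integral_pushforward _ _ L (borel_space R N) R id_LB measurable_id_LB mu setT f measurableT mf (fun x _ => f0 x).
rewrite preimage_setT => <-; apply: eq_measure_integral => A mA _.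
by rewrite /pushforward lebesgue_borel.
Qed.

Lemma integrable_lebesgue_borel f : measurable_fun setT (f : borel_space R N -> R) ->
  (borel_lebesgue R N).-integrable setT (EFin \o (f : borel_space R N -> R)) -> lintegrable f.
Proof.
move=> mf /integrableP[m1 m2]; apply/integrableP; split.
  by apply: measurable_fun_borel; apply/measurable_EFinP.
apply: le_lt_trans m2; rewrite (@integral_lebesgue_borel (fun x => `|(f x)%:E|%E))//.
by apply/measurable_EFinP; apply: measurableT_comp.
Qed.

Lemma lint_bint f : measurable_fun setT (f : borel_space R N -> R) -> lint f = bint f.
Proof.
move=> mf; rewrite /rint /bint /Rintegral; congr fine.
rewrite [LHS]integralE [RHS]integralE; congr (_ - _)%E.
  by apply: integral_lebesgue_borel => //; apply: measurable_funepos; apply/measurable_EFinP.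
by apply: integral_lebesgue_borel => //; apply: measurable_funeneg; apply/measurable_EFinP.
Qed.

Lemma lintegrable_cc f : cc f -> lintegrable f.
Proof.
move=> cf; apply: integrable_lebesgue_borel; last exact: cc_integrable.
by apply: continuous_borel; case: cf.
Qed.


End lebesgue_integral.

(** * Mollifiers and convolution *)

Section bell.
Variable R : realType.
Local Notation lam := (@lebesgue_measure R).
Implicit Types (s t d a b : R).

Lemma continuous_flat k : continuous (flat k : R -> R).
Proof. by move=> t; exact: is_derive_continuous1 (is_derive_flat k t). Qed.

Definition dstep s : R :=
  (flat 2 (4 - s) * flat 0 (s - 1) + flat 0 (4 - s) * flat 2 (s - 1)) /
  (flat 0 (4 - s) + flat 0 (s - 1)) ^+ 2.

Lemma is_derive_step s : is_derive s 1 (@step R) (- dstep s).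
Proof.
have HF : is_derive s 1 (fun s => flat 0 (4 - s) : R) (- flat 2 (4 - s)).
  have h : is_derive s 1 (fun s : R => 4 - s) (-1).
    have := is_deriveB (is_derive_cst (4 : R) s 1) (is_derive_id s (1 : R)).
    by rewrite sub0r.
  have := is_derive_comp11 h (is_derive_flat 0 (4 - s)).
  by rewrite oppr0 mul0r add0r mulrN1.
have HG : is_derive s 1 (fun s => flat 0 (s - 1) : R) (flat 2 (s - 1)).
  have h : is_derive s 1 (fun s : R => s - 1) 1.
    have := is_deriveB (is_derive_id s (1 : R)) (is_derive_cst (1 : R) s 1).
    by rewrite subr0.
  have := is_derive_comp11 h (is_derive_flat 0 (s - 1)).
  by rewrite oppr0 mul0r add0r mulr1.
have Dn : flat 0 (4 - s) + flat 0 (s - 1) != 0 :> R by rewrite gt_eqF ?step_den_gt0.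
have HD := is_deriveD HF HG.
have HV := is_derive_comp11 HD (is_deriveXV 1 Dn).
have HM : is_derive s 1 (@step R) _ := is_deriveM HF HV.
apply: (is_derive_eq HM); move: Dn; rewrite /dstep /GRing.scale/= !fctE.
set F := flat 0 (4 - s); set G := flat 0 (s - 1) => Dn.
by field.
Qed.

Lemma dstep_ge0 s : 0 <= dstep s.
Proof. by rewrite divr_ge0 ?sqr_ge0// addr_ge0// mulr_ge0// flat_ge0. Qed.

Lemma dstep_eq0 s : s <= 1 \/ 4 <= s -> dstep s = 0.
Proof.
move=> h; rewrite /dstep; have [h1|h1] : 4 - s <= 0 \/ s - 1 <= 0 by lra.
  by rewrite !(flat_eq0 _ h1) !mul0r addr0 mul0r.
by rewrite !(flat_eq0 _ h1) !mulr0 addr0 mul0r.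
Qed.

Lemma dstep_sym s : dstep (5 - s) = dstep s.
Proof.
rewrite /dstep (_ : 4 - (5 - s) = s - 1); last by ring.
rewrite (_ : 5 - s - 1 = 4 - s); last by ring.
rewrite (addrC (flat 0 (4 - s))) (mulrC (flat 2 (s - 1))) (mulrC (flat 0 (s - 1)) (flat 2 _)).
by rewrite (addrC (flat 2 (4 - s) * _)).
Qed.

Lemma continuous_dstep : continuous (dstep : R -> R).
Proof.
have c1 k : continuous (fun s : R => flat k (4 - s)).
  move=> s; apply: (continuous_comp (f := fun s : R => 4 - s)); last exact: continuous_flat.
  by apply: cvgB; [exact: cvg_cst|exact: cvg_id].
have c2 k : continuous (fun s : R => flat k (s - 1)).
  move=> s; apply: (continuous_comp (f := fun s : R => s - 1)); last exact: continuous_flat.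
  by apply: cvgB; [exact: cvg_id|exact: cvg_cst].
move=> s; apply: cvgM.
  by apply: cvgD; apply: cvgM; [exact: c1|exact: c2|exact: c1|exact: c2].
apply: cvgV; first by rewrite expf_neq0// gt_eqF ?step_den_gt0.
by apply: cvgM; apply: cvgD; [exact: c1|exact: c2|exact: c1|exact: c2].
Qed.

Lemma smooth_dstep N (f : 'rV[R]_N -> R) : smooth f -> smooth (fun x => dstep (f x)).
Proof.
move=> sf.
have s1 k : smooth (fun x => flat k (4 - f x)).
  by apply: smooth_flat; apply: smoothB => //; exact: smooth_cst.
have s2 k : smooth (fun x => flat k (f x - 1)).
  by apply: smooth_flat; apply: smoothB => //; exact: smooth_cst.
apply: smoothM.
  by apply: smoothD; exact: smoothM.
apply: smoothV => [x|]; first by rewrite expf_neq0// gt_eqF// step_den_gt0.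
by apply: smoothX; exact: smoothD.
Qed.

(** The two arguments [4 - s] and [s - 1] add up to 3, so one of them is at least 3/2 and the
    denominator is bounded below. *)
Lemma dstep_bounded : exists2 B : R, 0 <= B & forall s, dstep s <= B.
Proof.
pose q : R := flat 0 (3 / 2); have q0 : 0 < q by apply: flat_gt0; lra.
have mono (u v : R) : 0 < u -> u <= v -> flat 0 u <= flat 0 v.
  move=> u0 uv; have v0 := lt_le_trans u0 uv; rewrite /flat u0 v0 !expr0 invr1 !mul1r ler_expR lerN2.
  by rewrite lef_pV2.
exists (4 / q ^+ 2); first by rewrite divr_ge0// sqr_ge0.
move=> s; rewrite /dstep.
have d0 : q <= flat 0 (4 - s) + flat 0 (s - 1).
  have [h|h] : 3 / 2 <= 4 - s \/ 3 / 2 <= s - 1 by lra.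
    by apply: (@le_trans _ _ (flat 0 (4 - s))); [apply: mono => //; lra|rewrite lerDl flat_ge0].
  by apply: (@le_trans _ _ (flat 0 (s - 1))); [apply: mono => //; lra|rewrite lerDr flat_ge0].
have dd := lt_le_trans q0 d0.
apply: ler_pM.
- by rewrite addr_ge0// mulr_ge0// flat_ge0.
- by rewrite invr_ge0 sqr_ge0.
- have := flat_bound 2 (4 - s); have := flat_bound 2 (s - 1); have := flat_bound 0 (4 - s); have := flat_bound 0 (s - 1).
  have := flat_ge0 2 (4 - s); have := flat_ge0 2 (s - 1); have := flat_ge0 0 (4 - s); have := flat_ge0 0 (s - 1).
  rewrite /= !(factS, fact0) !muln1.
  move: (flat 2 _) (flat 2 _) (flat 0 _) (flat 0 _) => a b c e; nra.
- by rewrite lef_pV2 ?posrE ?exprn_gt0// ler_sqr ?nnegrE// ltW.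
Qed.

(** The affine change of variable carries [-d, d] onto [1, 4]. Having the explicit primitive [ramp]
    of [bell] gives mass 1 without a normalising constant, and later the primitive of a difference
    of two mollifiers. *)
Definition ramp d t : R := 1 - step (3 / 2 * (t / d) + 5 / 2).
Definition bell d t : R := 3 / 2 / d * dstep (3 / 2 * (t / d) + 5 / 2).

Lemma is_derive_ramp d t : is_derive t 1 (ramp d) (bell d t).
Proof.
have h : is_derive t 1 (fun t : R => 3 / 2 * (t / d) + 5 / 2) (3 / 2 / d).
  have e : is_derive t 1 (fun t : R => (3 / 2 / d) * t) (3 / 2 / d).
    have := @is_deriveZ _ _ _ id (3 / 2 / d) t 1 1 _.
    by rewrite /GRing.scale /= mulr1; apply.
  have := is_deriveD e (is_derive_cst (5 / 2 : R) t 1); rewrite addr0.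
  rewrite (_ : (fun t : R => 3 / 2 * (t / d) + 5 / 2) = (fun t : R => (3 / 2 / d) * t + 5 / 2))//.
  by apply/funext => s; rewrite mulrA mulrAC.
have H : is_derive t 1 (ramp d) _ :=
  is_deriveB (is_derive_cst (1 : R) t 1) (is_derive_comp11 h (is_derive_step _)).
apply: (is_derive_eq H); rewrite /bell; move: (dstep _) (3 / 2 / d) => u v; ring.
Qed.

Lemma bell_ge0 d t : 0 < d -> 0 <= bell d t.
Proof. by move=> d0; rewrite mulr_ge0 ?dstep_ge0// divr_ge0// ltW. Qed.

Lemma bell_arg d t : 0 < d -> d <= `|t| ->
  3 / 2 * (t / d) + 5 / 2 <= 1 /\ t < 0 \/ 4 <= 3 / 2 * (t / d) + 5 / 2 /\ 0 < t.
Proof.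
move=> d0; have [t0|t0] := leP 0 t.
  rewrite ger0_norm// => h; right.
  have : 1 <= t / d by rewrite ler_pdivlMr// mul1r.
  by move=> ?; split; [lra|exact: lt_le_trans h].
rewrite ltr0_norm// => h; left; split => //.
have : t / d <= -1 by rewrite ler_pdivrMr// mulN1r lerNr.
lra.
Qed.

Lemma bell_eq0 d t : 0 < d -> d <= `|t| -> bell d t = 0.
Proof. by move=> d0 /(bell_arg d0) h; rewrite /bell dstep_eq0 ?mulr0//; case: h => -[h _]; [left|right]. Qed.

Lemma ramp_ge0 d t : 0 <= ramp d t. Proof. by rewrite subr_ge0 step_le1. Qed.
Lemma ramp_le1 d t : ramp d t <= 1. Proof. by rewrite lerBlDr lerDl step_ge0. Qed.

Lemma ramp_eq1 d t : 0 < d -> d <= t -> ramp d t = 1.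
Proof.
move=> d0 dt; have t0 := lt_le_trans d0 dt; have := @bell_arg d t d0.
by rewrite gtr0_norm// => /(_ dt)[[_ ]|[h _]]; [lra|rewrite /ramp step_eq0// subr0].
Qed.

Lemma ramp_eq0 d t : 0 < d -> t <= - d -> ramp d t = 0.
Proof.
move=> d0 dt; have t0 : t < 0 by apply: (le_lt_trans dt); rewrite oppr_lt0.
have := @bell_arg d t d0.
by rewrite ltr0_norm// lerNr => /(_ dt)[[h _]|[_ h]]; [rewrite /ramp step_eq1// subrr|lra].
Qed.

Lemma bell_sym d t : bell d (- t) = bell d t.
Proof. by rewrite /bell -(dstep_sym (_ + _)); congr (_ * dstep _); rewrite mulNr mulrN; lra. Qed.

Lemma bell_bounded : exists2 B : R, 0 <= B & forall d t, 0 < d -> bell d t <= B / d.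
Proof.
have [B B0 HB] := dstep_bounded; exists (3 / 2 * B); first by rewrite mulr_ge0// divr_ge0.
move=> d t d0; rewrite /bell mulrAC; apply: ler_wpM2r; first by rewrite invr_ge0 ltW.
by apply: ler_wpM2l => //; rewrite divr_ge0.
Qed.

Lemma continuous_bell d : continuous (bell d).
Proof.
move=> t; apply: cvgM; first exact: cvg_cst.
apply: (continuous_comp (f := fun t : R => 3 / 2 * (t / d) + 5 / 2)); last exact: continuous_dstep.
apply: cvgD; last exact: cvg_cst.
by apply: cvgM; [exact: cvg_cst|apply: cvgM; [exact: cvg_id|exact: cvg_cst]].
Qed.

Lemma smooth_ramp_arg N d (f : 'rV[R]_N -> R) : smooth f -> smooth (fun x => 3 / 2 * (f x / d) + 5 / 2).
Proof.
move=> sf; apply: smoothD; last exact: smooth_cst.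
by apply: smoothZ; apply: smoothM => //; exact: smooth_cst.
Qed.

Lemma smooth_bell N d (f : 'rV[R]_N -> R) : smooth f -> smooth (fun x => bell d (f x)).
Proof. by move=> sf; apply: smoothZ; apply: smooth_dstep; exact: smooth_ramp_arg. Qed.

Lemma smooth_ramp N d (f : 'rV[R]_N -> R) : smooth f -> smooth (fun x => ramp d (f x)).
Proof.
move=> sf; apply: smoothB; first exact: smooth_cst.
by apply: smooth_step; exact: smooth_ramp_arg.
Qed.

Lemma integral_bell d a : 0 < d -> (\int[lam]_t (bell d (t - a))%:E = 1)%E.
Proof.
move=> d0.
have dr t : is_derive t 1 (fun t => ramp d (t - a)) (bell d (t - a)).
  have h : is_derive t 1 (fun s : R => s - a) 1.
    have := is_deriveB (is_derive_id t (1 : R)) (is_derive_cst a t 1).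
    by rewrite subr0.
  by have := is_derive_comp11 h (is_derive_ramp d (t - a)); rewrite mulr1.
have cb : continuous (fun t => bell d (t - a)).
  move=> t; apply: (continuous_comp (f := fun t : R => t - a)); last exact: continuous_bell.
  by apply: cvgB; [exact: cvg_id|exact: cvg_cst].
rewrite (@integral_derive1 R _ _ (`|a| + d) 0 1 cb dr) ?subr0//.
- by move=> t h; apply: ramp_eq1 => //; have := ler_norm a; lra.
- by move=> t h; apply: ramp_eq0 => //; have := ler_norm (- a); rewrite normrN; lra.
- move=> t h; apply: bell_eq0 => //; have := ler_normD (t - a) a; rewrite subrK; lra.
Qed.

End bell.

Section mollifier.
Variables (R : realType) (N : nat).
Local Notation V := 'rV[R]_N.
Implicit Types (x y z : V) (d : R).

(** A product of one-variable bells, instead of a radial bump, so that the width can be halved one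
    coordinate at a time. *)
Definition mollifier d z : R := \prod_i bell d (z 0 i).

Lemma smooth_mollifier d : smooth (mollifier d).
Proof. by apply: smooth_prod => i; apply: smooth_bell; exact: smooth_coord. Qed.

Lemma mollifier_ge0 d z : 0 < d -> 0 <= mollifier d z.
Proof. by move=> d0; apply: prodr_ge0 => i _; exact: bell_ge0. Qed.

Lemma mollifier_eq0 d z : 0 < d -> d < `|z| -> mollifier d z = 0.
Proof.
move=> d0 dz; have [i di] : exists i, d < `|z 0 i|.
  apply/not_existsP => h; move: dz; rewrite ltNge => /negP; apply.
  by apply/norm_leP; [exact: ltW|move=> i; rewrite leNgt; exact/negP/h].
by rewrite /mollifier (bigD1 i)//= bell_eq0 ?mul0r// ltW.
Qed.

Lemma cc_mollifier d : 0 < d -> cc (mollifier d).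
Proof.
move=> d0; apply: ccP; first exact: smooth_mollifier.
by exists d => x; exact: mollifier_eq0.
Qed.

Lemma mollifier_sym d z : mollifier d (- z) = mollifier d z.
Proof. by apply: eq_bigr => i _; rewrite rowNE bell_sym. Qed.

Lemma bint_mollifier d y : 0 < d -> bint (fun x => mollifier d (x - y)) = 1.
Proof.
move=> d0; rewrite /bint /Rintegral /mollifier.
have := @integral_prod R N (fun i t => bell d (t - y 0 i)) (fun=> 1).
rewrite big1// => H; rewrite -[RHS]/(fine 1%:E) -H; clear H.
- by congr fine; apply: eq_integral => x _; congr EFin; apply: eq_bigr => i _; exact: congr1 (rowBE x y i).
- move=> i; apply: continuous_measurable_fun => t.
  apply: (continuous_comp (f := fun t : R => t - y 0 i)); last exact: continuous_bell.
  by apply: cvgB; [exact: cvg_id|exact: cvg_cst].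
- by move=> i t; exact: bell_ge0.
- by move=> i; exact: integral_bell.
Qed.

End mollifier.

Section lipschitz.
Variables (R : realType) (N : nat).
Local Notation V := 'rV[R]_N.
Local Notation "''e_' i" := (delta_mx 0 i : V) (at level 8, i at level 2, format "''e_' i").
Implicit Types (f k : V -> R) (x y z v : V) (i : 'I_N).

(** A uniform quadratic remainder is the form of differentiability that survives integration against
    an integrable function. *)
Lemma is_derive_quadratic f x v (D M : R) :
  (forall h : R, `|f (h *: v + x) - f x - h * D| <= M * h ^+ 2) -> is_derive x v f D.
Proof.
move=> H.
have L : h^-1 *: (f (h *: v + x) - f x) @[h --> (0:R)^'] --> D.
  apply/cvgrPdist_lt => e e0.
  have M1 : 0 < `|M| + 1 by rewrite ltr_wpDl.
  near=> h.
  have h0 : h != 0 by near: h; exact: nbhs_dnbhs_neq.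
  have -> : D - h^-1 *: (f (h *: v + x) - f x) = - (h^-1 * (f (h *: v + x) - f x - h * D)).
    by rewrite /GRing.scale/= [in RHS]mulrBr mulKf// opprB.
  rewrite normrN normrM normfV ltr_pdivrMl ?normr_gt0//.
  apply: le_lt_trans (H h) _; rewrite -real_normK ?num_real// expr2 mulrCA ltr_pM2l ?normr_gt0//.
  apply: (@le_lt_trans _ _ ((`|M| + 1) * `|h|)).
    by apply: ler_wpM2r => //; have := ler_norm M; lra.
  rewrite -ltr_pdivlMl//; near: h; apply: cvg_within.
  by have := @nbhs0_lt R R _ (mulr_gt0 (_ : 0 < (`|M| + 1)^-1) e0); rewrite invr_gt0 => /(_ M1).
apply: DeriveDef; last by exact: cvg_lim L.
by apply/cvg_ex; exists D.
Unshelve. all: by end_near. Qed.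

Lemma step_bound f i (M : R) : smooth f -> (forall x, `|partial i f x| <= M) ->
  forall x h, `|f (h *: 'e_i + x) - f x| <= M * `|h|.
Proof.
move=> sf HM.
have H x h : 0 < h -> `|f (h *: 'e_i + x) - f x| <= M * `|h|.
  by move=> h0; have [t _ ->] := MVT_along i x sf h0; rewrite normrM mulrC ler_wpM2r.
move=> x h; have [h0|h0|->] := ltgtP h 0; last by rewrite scale0r add0r subrr !normr0 mulr0.
  have := H (h *: 'e_i + x) (- h); rewrite oppr_gt0 => /(_ h0).
  by rewrite addrA -scalerDl addNr scale0r add0r distrC normrN.
exact: H.
Qed.

Lemma cc_partial_bound f i : smooth f -> bounded_support f ->
  exists2 M, 0 <= M & forall x, `|partial i f x| <= M.
Proof.
by move=> sf bf; apply: cc_bounded; apply: ccP; [exact: smooth_partial|exact: bounded_support_partial].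
Qed.

Lemma lipschitz_bound f : smooth f -> bounded_support f ->
  exists2 M, 0 <= M & forall x y, `|f x - f y| <= M * `|x - y|.
Proof.
move=> sf bf.
have /choice[M HM] : forall i, exists M, 0 <= M /\ forall x, `|partial i f x| <= M.
  by move=> i; have [M M0 H] := cc_partial_bound i sf bf; exists M.
exists (\sum_i M i); first by apply: sumr_ge0 => i _; case: (HM i).
move=> x y; rewrite -[x](subrK y) addrK; move: (x - y) => v.
rewrite [in f (v + y)](row_sum_delta v) mulr_suml.
elim: (index_enum _) => [|i s IH]; first by rewrite !big_nil add0r subrr normr0.
rewrite !big_cons -addrA; move: (\sum_(j <- s) _ *: _ + y) IH => z IH.
rewrite -(subrK (f z) (f _)) -addrA; apply: le_trans (ler_normD _ _) _; apply: lerD => //.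
have [Mi Hi] := HM i; apply: le_trans (step_bound sf Hi z (v 0 i)) _.
by apply: ler_wpM2l => //; exact: norm_coord_le.
Qed.

Lemma taylor_bound f i : smooth f -> bounded_support f ->
  exists2 M, 0 <= M & forall x (h : R), `|f (h *: 'e_i + x) - f x - h * partial i f x| <= M * h ^+ 2.
Proof.
move=> sf bf; have sp := smooth_partial i sf.
have [M M0 HM] := cc_partial_bound i sp (bounded_support_partial i bf).
have SB := step_bound sp HM.
(* The point [s] at which the derivative is taken is left free: [s = 0] settles h > 0, and [s = - h]
   from the base point [h *: 'e_i + x] settles h < 0. *)
have H x h : 0 < h -> forall s : R, 0 <= s <= h ->
    `|f (h *: 'e_i + x) - f x - h * partial i f (s *: 'e_i + x)| <= M * h ^+ 2.
  move=> h0 s /andP[s0 sh]; have [t /andP[t0 th] ->] := MVT_along i x sf h0.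
  rewrite -mulrBr normrM (gtr0_norm h0) expr2 mulrCA ler_pM2l//.
  have := SB (s *: 'e_i + x) (t - s); rewrite addrA -scalerDl subrK => /le_trans; apply.
  by apply: ler_wpM2l => //; rewrite ler_norml; apply/andP; split; lra.
exists M => // x h; have [h0|h0|->] := ltgtP h 0; last first.
- by rewrite scale0r add0r subrr mul0r subr0 normr0 expr0n mulr0.
- by have := H x h h0 0; rewrite lexx (ltW h0) scale0r add0r; exact.
have h1 : 0 < - h by rewrite oppr_gt0.
have := H (h *: 'e_i + x) (- h) h1 (- h); rewrite lexx (ltW h1) => /(_ isT).
rewrite addrA -scalerDl addNr scale0r add0r sqrrN mulNr opprK -normrN.
by move=> Hx; rewrite (_ : _ - _ - _ = - (f x - f (h *: 'e_i + x) + h * partial i f x))//; ring.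
Qed.

End lipschitz.

Section convolution.
Variables (R : realType) (N : nat).
Local Notation V := 'rV[R]_N.
Local Notation L := (lebesgue_space R N).
Local Notation mu := (lebesgue R N).
Local Notation lintegrable := (@rintegrable _ L R mu).
Local Notation lint := (@rint _ L R mu).
Local Notation "''e_' i" := (delta_mx 0 i : V) (at level 8, i at level 2, format "''e_' i").
Implicit Types (U f k : V -> R) (x y z v : V) (i : 'I_N).

Definition convol U k x : R := lint (fun y => U y * k (x - y)).

Lemma continuous_shift k y : continuous k -> continuous (fun x => k (x - y)).
Proof.
move=> ck x; apply: (continuous_comp (f := fun x => x - y)); last exact: ck.
have : continuous (fun x => x - y); last by apply.
by apply: nonexpansive_continuous => u v; rewrite opprB addrA subrK.
Qed.

Lemma continuous_reflect k x : continuous k -> continuous (fun y => k (x - y)).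
Proof.
move=> ck y; apply: (continuous_comp (f := fun y => x - y)); last exact: ck.
have : continuous (fun y => x - y); last by apply.
apply: nonexpansive_continuous => u v.
by rewrite opprB addrC addrA subrK distrC.
Qed.

Lemma lintegrable_convol U k x : lintegrable U -> cc k -> lintegrable (fun y => U y * k (x - y)).
Proof.
move=> iU ck; have [M _ HM] := cc_bounded ck.
have [ck' _] := ck.
have mk : measurable_fun setT ((fun y => k (x - y)) : L -> R).
  exact: continuous_lebesgue (continuous_reflect ck').
exact: (@rintegrable_mul _ L R mu U _ M iU mk (fun y => HM (x - y))).
Qed.

Lemma convol_lipschitz U k : lintegrable U -> smooth k -> bounded_support k ->
  exists2 M, 0 <= M & forall x y, `|convol U k x - convol U k y| <= M * `|x - y|.
Proof.
move=> iU sk bk; have ck := ccP sk bk; have [M M0 HM] := lipschitz_bound sk bk.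
pose I := lint (fun y => `|U y|).
have I0 : 0 <= I by apply: rint_ge0.
exists (M * I) => [|x x']; first exact: mulr_ge0.
rewrite /convol -rintB; [|exact: lintegrable_convol|exact: lintegrable_convol].
rewrite mulrAC -rintZ; last exact: rintegrable_norm.
apply: normr_rint_le.
- by apply: rintegrableB; exact: lintegrable_convol.
- by apply: rintegrableZ; exact: rintegrable_norm.
- move=> y; rewrite -mulrBr normrM mulrC ler_wpM2r//.
  by apply: le_trans (HM _ _) _; rewrite opprB addrA subrK.
Qed.

(** Differentiation under the integral: the Taylor remainder M h^2 of the kernel integrates to M h^2
    times the L^1 norm of [U]. *)
Lemma is_derive_convol U k i x : lintegrable U -> smooth k -> bounded_support k ->
  is_derive x 'e_i (convol U k) (convol U (partial i k) x).
Proof.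
move=> iU sk bk; have [M M0 HM] := taylor_bound i sk bk.
pose I := lint (fun y => `|U y|).
have ck := ccP sk bk.
have cp : cc (partial i k) by apply: ccP; [exact: smooth_partial|exact: bounded_support_partial].
apply: (@is_derive_quadratic _ _ _ _ _ _ (M * I)) => h.
rewrite /convol -rintZ; last exact: lintegrable_convol.
rewrite -rintB; [|exact: lintegrable_convol|exact: lintegrable_convol].
rewrite -rintB; [|by apply: rintegrableB; exact: lintegrable_convol|by apply: rintegrableZ; exact: lintegrable_convol].
rewrite mulrAC -rintZ; last exact: rintegrable_norm.
apply: normr_rint_le.
- by apply: rintegrableB; [apply: rintegrableB|apply: rintegrableZ]; exact: lintegrable_convol.
- by apply: rintegrableZ; exact: rintegrable_norm.
- move=> y; rewrite mulrCA -!mulrBr normrM mulrC ler_wpM2r//.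
  by apply: le_trans (HM (x - y) h); rewrite -!addrA.
Qed.

Lemma partial_convol U k i : lintegrable U -> smooth k -> bounded_support k ->
  partial i (convol U k) = convol U (partial i k).
Proof. by move=> iU sk bk; apply/funext => x; apply: partial_eq; exact: is_derive_convol. Qed.

Lemma continuous_convol U k : lintegrable U -> smooth k -> bounded_support k -> continuous (convol U k).
Proof.
move=> iU sk bk; have [M M0 HM] := convol_lipschitz iU sk bk.
exact: lipschitz_continuous HM.
Qed.

Lemma smooth_convol U k : lintegrable U -> smooth k -> bounded_support k -> smooth (convol U k).
Proof.
move=> iU sk bk n; elim: n k sk bk => [|n IH] k sk bk.
  by split => //; exact: continuous_convol.
apply/class_CP; split; first exact: continuous_convol.
exists (fun i => convol U (partial i k)) => [i x|i]; first exact: is_derive_convol.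
by apply: IH; [exact: smooth_partial|exact: bounded_support_partial].
Qed.

Lemma convol_sum U (I : Type) (s : seq I) (K : I -> V -> R) x : lintegrable U -> (forall j, cc (K j)) ->
  convol U (fun z => \sum_(j <- s) K j z) x = \sum_(j <- s) convol U (K j) x.
Proof.
move=> iU cK; rewrite /convol -rint_sum; last by move=> j; exact: lintegrable_convol.
by apply: eq_rint => y; rewrite mulr_sumr.
Qed.

Lemma lap_convol U k : lintegrable U -> smooth k -> bounded_support k -> lap (convol U k) = convol U (lap k).
Proof.
move=> iU sk bk; apply/funext => x; rewrite /lap convol_sum//; last first.
  move=> j; apply: ccP; first by do 2 apply: smooth_partial.
  by do 2 apply: bounded_support_partial.
apply: eq_bigr => i _; rewrite partial_convol// partial_convol//.
  exact: smooth_partial.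
exact: bounded_support_partial.
Qed.

End convolution.

(** * Dyadic telescoping and Morrey's estimate *)

Section geometric_limit.
Variables (R : realType) (V : normedModType R).
Implicit Types (f : nat -> V -> R) (x : V).

Lemma expr_small (t e : R) : 0 <= t -> t < 1 -> 0 < e -> exists k0, forall k, (k0 <= k)%N -> t ^+ k <= e.
Proof.
move=> t0 t1 e0.
have : t ^+ k @[k --> \oo] --> (0 : R) by apply: cvg_expr; rewrite ger0_norm.
move=> /cvgrPdist_le /(_ e e0) [k0 _ H]; exists k0 => k kk.
by have := H k kk; rewrite sub0r normrN; apply: le_trans; exact: ler_norm.
Qed.

Lemma monotone_le (a : nat -> R) : (forall k, a k <= a k.+1) -> forall j k, (j <= k)%N -> a j <= a k.
Proof.
move=> H j k /subnK <-; elim: (k - j)%N => [|n IH]; first by rewrite add0n.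
by rewrite addSn; exact: le_trans IH (H _).
Qed.

(** Subtracting the geometric tail makes the sequence increasing, adding it makes it decreasing, so
    the limit is a supremum squeezed between the two with an error independent of the point. *)
Lemma geometric_uniform_limit f (C t : R) : 0 <= C -> 0 <= t -> t < 1 -> (forall k, continuous (f k)) ->
  (forall k x, `|f k.+1 x - f k x| <= C * t ^+ k) ->
  exists2 g : V -> R, continuous g &
    forall s, 0 < s -> exists k0, forall k, (k0 <= k)%N -> forall x, `|f k x - g x| <= s.
Proof.
move=> C0 t0 t1 cf H.
(* [D * t ^+ k] is the tail of the geometric series from rank k on. *)
pose D := C / (1 - t).
have D0 : 0 <= D by rewrite divr_ge0// subr_ge0 ltW.
have DE k : D * t ^+ k - D * t ^+ k.+1 = C * t ^+ k.
  by rewrite /D exprS; field; rewrite gt_eqF// subr_gt0.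
have a_mono x k : f k x - D * t ^+ k <= f k.+1 x - D * t ^+ k.+1.
  by have := H k x; have := DE k; rewrite ler_norml => + /andP[]; lra.
have b_mono x k : f k.+1 x + D * t ^+ k.+1 <= f k x + D * t ^+ k.
  by have := H k x; have := DE k; rewrite ler_norml => + /andP[]; lra.
have Dt k : 0 <= D * t ^+ k by rewrite mulr_ge0// exprn_ge0.
have ab x j k : f j x - D * t ^+ j <= f k x + D * t ^+ k.
  apply: (@le_trans _ _ (f (maxn j k) x - D * t ^+ maxn j k)).
    exact: (monotone_le (a_mono x) (leq_maxl j k)).
  apply: (@le_trans _ _ (f (maxn j k) x + D * t ^+ maxn j k)); first by have := Dt (maxn j k); lra.
  have := @monotone_le (fun k => - (f k x + D * t ^+ k)) _ _ _ (leq_maxr j k).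
  by rewrite lerN2; apply => i; rewrite lerN2.
pose A x := [set f k x - D * t ^+ k | k in [set: nat]].
pose g x := sup (A x).
have A0 x : A x !=set0 by exists (f 0%N x - D * t ^+ 0), 0%N.
have gP k x : `|f k x - g x| <= D * t ^+ k.
  have h1 : f k x - D * t ^+ k <= g x.
    apply: ub_le_sup; last by exists k.
    by exists (f 0%N x + D * t ^+ 0) => _ [j _ <-]; exact: ab.
  have h2 : g x <= f k x + D * t ^+ k.
    by apply: ge_sup => // _ [j _ <-]; exact: ab.
  by rewrite ler_norml; apply/andP; split; lra.
have unif s : 0 < s -> exists k0, forall k, (k0 <= k)%N -> forall x, `|f k x - g x| <= s.
  move=> s0; have D1 : 0 < D + 1 by rewrite ltr_wpDl.
  have [k0 Hk0] := expr_small t0 t1 (divr_gt0 s0 D1).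
  exists k0 => k kk x; apply: le_trans (gP k x) _.
  apply: (@le_trans _ _ ((D + 1) * t ^+ k)).
    by apply: ler_wpM2r; [exact: exprn_ge0|lra].
  by rewrite -ler_pdivlMl// mulrC; exact: Hk0.
exists g => // x; apply/cvgrPdist_le => e e0.
have e3 : 0 < e / 3 by rewrite divr_gt0.
have [k Hk] := unif _ e3.
near=> y.
have c : `|f k x - f k y| <= e / 3.
  by near: y; have /cvgrPdist_le := cf k x; exact.
have := Hk k (leqnn k) x; have := Hk k (leqnn k) y.
move: c; rewrite !ler_norml => /andP[? ?] /andP[? ?] /andP[? ?].
by apply/andP; split; lra.
Unshelve. all: by end_near. Qed.

End geometric_limit.

Section kernel_telescope.
Variables (R : realType) (N : nat).
Local Notation V := 'rV[R]_N.
Local Notation "''e_' i" := (delta_mx 0 i : V) (at level 8, i at level 2, format "''e_' i").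
Implicit Types (d : R) (x y z : V) (i j : 'I_N).

(* The product of bells of width [d / 2] in the coordinates below [k] and of width [d] in the
   other ones interpolates between the two mollifiers *)
Definition mixed_bell d (k : nat) j (t : R) : R := if (j < k)%N then bell (d / 2) t else bell d t.

Definition mixed_mollifier d k z : R := \prod_j mixed_bell d k j (z 0 j).

(** The primitive in coordinate i of the difference of two consecutive mixed mollifiers, [ramp]
    being a primitive of [bell]. *)
Definition telescope_kernel d i z : R :=
  \prod_j (if j == i then ramp d (z 0 j) - ramp (d / 2) (z 0 j) else mixed_bell d i j (z 0 j)).

Lemma smooth_telescope_kernel d i : smooth (telescope_kernel d i).
Proof.
apply: smooth_prod => j; have sc := @smooth_coord R N j.
case: (j == i); first by apply: smoothB; exact: smooth_ramp.
by rewrite /mixed_bell; case: (j < i)%N; exact: smooth_bell.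
Qed.

Lemma mixed_bell_ge0 d k j t : 0 < d -> 0 <= mixed_bell d k j t.
Proof. by move=> d0; rewrite /mixed_bell; case: ifP => _; apply: bell_ge0 => //; rewrite divr_gt0. Qed.

(** The two ramps agree outside [-d, d], where both are 0 or both are 1. The equal masses of the
    bells are what keeps the primitive compactly supported. *)
Lemma telescope_kernel_eq0 d i z : 0 < d -> d < `|z| -> telescope_kernel d i z = 0.
Proof.
move=> d0 dz; have d2 : 0 < d / 2 by rewrite divr_gt0.
have [j dj] : exists j, d < `|z 0 j|.
  apply/not_existsP => h; move: dz; rewrite ltNge => /negP; apply.
  by apply/norm_leP; [exact: ltW|move=> j; rewrite leNgt; exact/negP/h].
rewrite /telescope_kernel (bigD1 j)//=.
have d2j : d / 2 <= `|z 0 j| by lra.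
suff -> : (if j == i then ramp d (z 0 j) - ramp (d / 2) (z 0 j) else mixed_bell d i j (z 0 j)) = 0.
  by rewrite mul0r.
case: ifP => _; last first.
  by rewrite /mixed_bell; case: ifP => _; rewrite bell_eq0// ltW.
have [zj|zj] := leP 0 (z 0 j).
  by move: dj d2j; rewrite ger0_norm// => dj d2j; rewrite !ramp_eq1 ?subrr// ltW.
by move: dj d2j; rewrite ltr0_norm// => dj d2j; rewrite !ramp_eq0 ?subrr//; lra.
Qed.

Lemma bounded_support_telescope_kernel d i : 0 < d -> bounded_support (telescope_kernel d i).
Proof. by move=> d0; exists d => z; exact: telescope_kernel_eq0. Qed.

Lemma partial_telescope_kernel d i z :
  partial i (telescope_kernel d i) z = mixed_mollifier d i z - mixed_mollifier d i.+1 z.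
Proof.
pose C := \prod_(j | j != i) mixed_bell d i j (z 0 j).
have -> : mixed_mollifier d i z - mixed_mollifier d i.+1 z = C * (bell d (z 0 i) - bell (d / 2) (z 0 i)).
  rewrite mulrBr /mixed_mollifier (bigD1 i)//= {1}/mixed_bell ltnn mulrC; congr (_ - _).
  rewrite (bigD1 i)//= {1}/mixed_bell ltnS leqnn mulrC; congr (_ * _).
  apply: eq_bigr => j ji; rewrite /mixed_bell ltnS leq_eqVlt.
  by rewrite (negPf (_ : (j : nat) != i)).
apply: partial_eq; apply/is_derive_line.
rewrite (_ : (fun t : R => _) = (fun t : R => C * (ramp d (1 * t + z 0 i) - ramp (d / 2) (1 * t + z 0 i)))).
  have h : is_derive (0 : R) 1 (fun t : R => 1 * t + z 0 i) 1.
    have := is_deriveD (is_derive_id (0 : R) (1 : R)) (is_derive_cst (z 0 i : R) (0 : R) 1).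
    rewrite addr0; congr (is_derive _ _ _ _).
    by apply/funext => t; rewrite mul1r.
  have z0 : 1 * 0 + z 0 i = z 0 i by rewrite mulr0 add0r.
  have h1 := is_derive_comp11 h (is_derive_ramp d (1 * 0 + z 0 i)).
  have h2 := is_derive_comp11 h (is_derive_ramp (d / 2) (1 * 0 + z 0 i)).
  have := is_deriveZ C (is_deriveB h1 h2).
  by rewrite z0 !mulr1.
apply/funext => t; rewrite /telescope_kernel (bigD1 i)//= eqxx mulrC; congr (_ * _).
  apply: eq_bigr => j ji; rewrite (negPf ji) !mxE (negPf ji) andbF mulr0 add0r//.
by rewrite rowDE rowZE mxE !eqxx mulr1 mul1r.
Qed.

Lemma mollifier_telescope d z :
  mollifier d z - mollifier (d / 2) z = \sum_i partial i (telescope_kernel d i) z.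
Proof.
under eq_bigr do rewrite partial_telescope_kernel.
have := @telescope_sumr R 0 N (fun k => - mixed_mollifier d k z) (leq0n N).
rewrite opprK big_mkord => E.
rewrite (_ : \sum_i _ = \sum_(i < N) (- mixed_mollifier d i.+1 z - - mixed_mollifier d i z)).
  rewrite E [RHS]addrC; congr (_ - _).
  by apply: eq_bigr => j _; rewrite /mixed_bell ltn_ord.
by apply: eq_bigr => i _; rewrite opprK addrC.
Qed.

(** One of the N factors is a difference of ramps, at most 1, so a power of 1/d is saved; this is
    the gain that gives convergence for m > N. The bell of width d/2 doubles the constant. *)
Lemma telescope_kernel_bounded : exists2 B : R, 0 <= B & forall d i z, 0 < d ->
  `|telescope_kernel d i z| <= (B / d) ^+ N.-1.
Proof.
have [B B0 HB] := bell_bounded R; exists (2 * B); first by rewrite mulr_ge0.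
move=> d i z d0; have d2 : 0 < d / 2 by rewrite divr_gt0.
rewrite /telescope_kernel (bigD1 i)//= eqxx normrM -[leRHS]mul1r; apply: ler_pM => //.
  have := ramp_ge0 d (z 0 i); have := ramp_le1 d (z 0 i).
  have := ramp_ge0 (d / 2) (z 0 i); have := ramp_le1 (d / 2) (z 0 i).
  by rewrite ler_norml => *; apply/andP; split; lra.
rewrite normr_prod; have -> : (2 * B / d) ^+ N.-1 = \prod_(j | j != i) (2 * B / d).
  by rewrite prodr_const; congr (_ ^+ _); have := cardC1 i; rewrite card_ord => <-; apply: eq_card.
apply: ler_prod => j ji; rewrite normr_ge0 (negPf ji) ger0_norm ?mixed_bell_ge0//=.
rewrite /mixed_bell; case: ifP => _.
  by apply: le_trans (HB _ _ d2) _; rewrite invf_div mulrA mulrAC mulrC mulrA.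
apply: le_trans (HB _ _ d0) _; apply: ler_wpM2r; first by rewrite invr_ge0 ltW.
by lra.
Qed.

End kernel_telescope.

Section morrey.
Variables (R : realType) (N : nat).
Local Notation V := 'rV[R]_N.
Local Notation L := (lebesgue_space R N).
Local Notation mu := (lebesgue R N).
Local Notation lintegrable := (@rintegrable _ L R mu).
Local Notation lint := (@rint _ L R mu).
Implicit Types (U f k v : V -> R) (x y z : V) (i : 'I_N) (d t m : R).

(** When a > t, the factor (a / t)^(m - 1) is at least 1, and multiplying [a] by it gives the second
    term. *)
Lemma powR_young m t (a : R) : 1 <= m -> 0 < t -> 0 <= a -> a <= t + t / t `^ m * a `^ m.
Proof.
move=> m1 t0 a0; have m0 : 0 < m by rewrite (lt_le_trans ltr01).
have [at_|ta] := leP a t.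
  by rewrite ler_wpDr// mulr_ge0 ?powR_ge0// divr_ge0 ?powR_ge0// ltW.
apply: (@le_trans _ _ (t / t `^ m * a `^ m)); last by rewrite lerDr ltW.
rewrite -(mulr_powRB1 (ltW t0) m0) -(mulr_powRB1 a0 m0).
have T0 : 0 < t `^ (m - 1) by rewrite powR_gt0.
have -> : t / (t * t `^ (m - 1)) * (a * a `^ (m - 1)) = a * (a `^ (m - 1) / t `^ (m - 1)).
  by field; rewrite !gt_eqF.
rewrite ler_peMr// ler_pdivlMr// mul1r.
by apply: ge0_ler_powR; rewrite ?nnegrE ?subr_ge0 ?(ltW t0)// ltW.
Qed.

Lemma lintegrable_indic (A : set V) : measurable (A : set (borel_space R N)) ->
  (borel_lebesgue R N A < +oo)%E -> lintegrable (\1_A : V -> R) /\ lint (\1_A : V -> R) = fine (borel_lebesgue R N A).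
Proof.
move=> mA Afin; have mA' : measurable (A : set L) by exact: borel_lebesgue_measurable.
split.
  apply/integrableP; split; first by apply/measurable_EFinP; exact: (measurable_indic mA').
  rewrite (_ : (\int[mu]_x _)%E = (\int[mu]_(x in setT) (\1_(A : set L) x)%:E)%E).
    by rewrite integral_indic// setIT -lebesgue_borel in Afin *.
  by apply: eq_integral => x _; rewrite /= ger0_norm.
by rewrite /rint /Rintegral integral_indic// setIT lebesgue_borel.
Qed.

Lemma lintegrable_ball x d : 0 <= d -> exists A : set V, [/\ measurable (A : set (borel_space R N)),
  (forall y, A y <-> `|x - y| <= d), lintegrable (\1_A : V -> R) & lint (\1_A : V -> R) = (2 * d) ^+ N].
Proof.
move=> d0; pose A : set V := cube (fun i => x 0 i - d) (fun i => x 0 i + d).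
have mA : measurable (A : set (borel_space R N)) by exact: measurable_cube.
have [iA EA] := lintegrable_indic mA (cube_finite _ _).
exists A; split => //.
  move=> y; rewrite norm_leP// /A /cube/=; split => H i; have := H i;
    rewrite in_itv/= ?rowBE ler_norml => /andP[h1 h2]; apply/andP; split; lra.
rewrite EA borel_lebesgue_cube; last by move=> i; lra.
by rewrite /= (eq_bigr (fun=> 2 * d)) ?prodr_const ?card_ord// => i _; ring.
Qed.

(* [t] is free: the two terms balance for [t = d ^ (- N / m)], which spares Hoelder's inequality. *)
Lemma convol_concentrated v (k : V -> R) m (S : R) d t x : 1 <= m -> 0 < d -> 0 < t -> 0 <= S ->
  lintegrable v -> lintegrable (fun y => `|v y| `^ m) -> cc k -> (forall z, `|k z| <= S) -> (forall z, d < `|z| -> k z = 0) ->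
  `|convol v k x| <= S * (t * (2 * d) ^+ N + t / t `^ m * lint (fun y => `|v y| `^ m)).
Proof.
move=> m1 d0 t0 S0 iv ivm ck kS kd.
have [A [mA AP iA EA]] := lintegrable_ball x (ltW d0).
rewrite -EA -!rintZ// -rintD; [|exact: rintegrableZ|exact: rintegrableZ].
rewrite -rintZ; last by apply: rintegrableD; exact: rintegrableZ.
apply: normr_rint_le.
- exact: lintegrable_convol.
- by apply/rintegrableZ/rintegrableD; exact: rintegrableZ.
move=> y; rewrite normrM mulrC.
have q0 : 0 <= t / t `^ m * `|v y| `^ m by rewrite mulr_ge0 ?powR_ge0// divr_ge0 ?powR_ge0// ltW.
have [xy|xy] := leP `|x - y| d; last first.
  by rewrite kd// normr0 mul0r mulr_ge0// addr_ge0// mulr_ge0 ?(ltW t0)// indicE.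
have -> : \1_A y = 1 :> R by rewrite indicE mem_set//; exact/AP.
by rewrite mulr1; apply: ler_pM => //; exact: powR_young.
Qed.

(** The difference of two mollifications is a sum of convolutions of the weak derivatives [v i] with
    the telescoping kernels. With d = d0 / 2^n and the free parameter equal to b^n, both terms of
    [convol_concentrated] are of order d^(1 - N) b^n d^N, hence of order (b / 2)^n. *)
Lemma dyadic_bound (v : 'I_N -> V -> R) U (m d0 : R) (D : set V) : N%:R < m -> 0 < d0 ->
  lintegrable U -> (forall i, lintegrable (v i)) -> (forall i, lintegrable (fun y => `|v i y| `^ m)) ->
  (forall i k x, smooth k -> (forall z, d0 < `|z| -> k z = 0) -> D x ->
     convol U (partial i k) x = convol (v i) k x) ->
  exists C t : R, [/\ 0 <= C, 0 <= t, t < 1 & forall n x, D x ->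
   `|convol U (mollifier (d0 / 2 ^+ n.+1)) x - convol U (mollifier (d0 / 2 ^+ n)) x| <= C * t ^+ n].
Proof.
move=> Nm d00 iU iv ivm H.
have m0 : 0 < m by apply: le_lt_trans Nm.
have [B B0 HB] := @telescope_kernel_bounded R N.
(* N < m means b < 2, and b^m = 2^N balances the two terms. *)
pose b : R := 2 `^ (N%:R / m).
have b0 : 0 < b by rewrite powR_gt0.
have b2 : b < 2.
  rewrite /b -[ltRHS](powRr1 (ler0n _ 2)) /powR pnatr_eq0/=.
  rewrite ltr_expR ltr_pM2r ?ln_gt0 ?ltr1n//.
  by rewrite ltr_pdivrMr// mul1r.
have bm : b `^ m = 2 ^+ N by rewrite -powRrM divfK ?gt_eqF// powR_mulrn.
pose J i := lint (fun y => `|v i y| `^ m).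
have J0 i : 0 <= J i by apply: rint_ge0 => y; exact: powR_ge0.
pose C := \sum_i (B ^+ N.-1 * (2 ^+ N + J i / d0 ^+ N) * d0).
have Ci0 i : 0 <= B ^+ N.-1 * (2 ^+ N + J i / d0 ^+ N) * d0.
  rewrite mulr_ge0 ?(ltW d00)// mulr_ge0 ?exprn_ge0//.
  by rewrite addr_ge0 ?exprn_ge0// divr_ge0// exprn_ge0// ltW.
exists C, (b / 2); split.
- by apply: sumr_ge0.
- by rewrite divr_ge0// ltW.
- by rewrite ltr_pdivrMr// mul1r.
move=> n x Dx; pose d : R := d0 / 2 ^+ n.
have p0 : 0 < 2 ^+ n :> R by rewrite exprn_gt0.
have d_gt0 : 0 < d by rewrite divr_gt0.
have dd0 : d <= d0 by rewrite ler_pdivrMr// ler_peMr ?(ltW d00)// exprn_ege1// ler1n.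
have dE : d0 / 2 ^+ n.+1 = d / 2 by rewrite exprSr invfM mulrA.
have d2 : 0 < d / 2 by rewrite divr_gt0.
rewrite dE -/d distrC.
have ck i : cc (telescope_kernel d i).
  by apply: ccP; [exact: smooth_telescope_kernel|exact: bounded_support_telescope_kernel].
have cpk i : cc (partial i (telescope_kernel d i)).
  apply: ccP; first exact/smooth_partial/smooth_telescope_kernel.
  exact/bounded_support_partial/bounded_support_telescope_kernel.
have -> : convol U (mollifier d) x - convol U (mollifier (d / 2)) x =
    \sum_i convol (v i) (telescope_kernel d i) x.
  rewrite /convol -rintB; [|apply: lintegrable_convol => //; exact: cc_mollifier|apply: lintegrable_convol => //; exact: cc_mollifier].
  transitivity (convol U (fun z => \sum_i partial i (telescope_kernel d i) z) x).
    by apply: eq_rint => y; rewrite -mulrBr mollifier_telescope.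
  rewrite convol_sum//; apply: eq_bigr => i _; apply: H => //.
    exact: smooth_telescope_kernel.
  by move=> z dz; apply: telescope_kernel_eq0 => //; exact: le_lt_trans dz.
apply: (le_trans (ler_norm_sum _ _ _)); rewrite /C mulr_suml; apply: ler_sum => i _.
have N0 : (0 < N)%N := leq_ltn_trans (leq0n _) (ltn_ord i).
have m1 : 1 <= m by apply/ltW/(le_lt_trans _ Nm); rewrite ler1n.
have t0 : 0 < b ^+ n by rewrite exprn_gt0.
have := convol_concentrated x m1 d_gt0 t0 (exprn_ge0 N.-1 (divr_ge0 B0 (ltW d_gt0))) (iv i) (ivm i) (ck i)
  (fun z => HB d i z d_gt0) (fun z => telescope_kernel_eq0 i d_gt0).
move/le_trans; apply.
have bnm : (b ^+ n) `^ m = (2 ^+ n) ^+ N.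
  rewrite -powR_mulrn ?(ltW b0)// -powRrM mulrC powRrM bm -exprM mulnC exprM.
  by rewrite powR_mulrn// exprn_ge0.
rewrite bnm -/(J i) /d -(prednK N0) !exprS !exprMn !exprVn !exprMn !exprVn /=.
rewrite le_eqVlt; apply/orP; left; apply/eqP.
move: (N.-1) => K; field.
by rewrite !expf_neq0 ?gt_eqF.
Qed.

End morrey.

(** * The lemma of du Bois-Reymond *)

Section fubini_weighted.
Context d1 d2 (T1 : measurableType d1) (T2 : measurableType d2) (R : realType).
Variables (m1 : {sigma_finite_measure set T1 -> \bar R}) (m2 : {sigma_finite_measure set T2 -> \bar R}).

Lemma fin_rint d (T : measurableType d) (nu : {measure set T -> \bar R}) (f : T -> R) : rintegrable nu f ->
  (\int[nu]_x (f x)%:E = (rint nu f)%:E)%E.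
Proof. by move=> jf; rewrite /rint /Rintegral fineK//; exact: integrable_fin_num. Qed.

(** The integrand is dominated by |U| times [h], a product of two integrable functions of separate
    variables, so Tonelli gives integrability on the product. *)
Lemma fubini_weighted (U : T1 -> R) (g : T1 -> T2 -> R) (h : T2 -> R) : rintegrable m1 U -> rintegrable m2 h ->
  measurable_fun setT (fun p : T1 * T2 => g p.1 p.2) -> (forall y x, `|g y x| <= h x) ->
  rint m2 (fun x => rint m1 (fun y => U y * g y x)) = rint m1 (fun y => U y * rint m2 (g y)).
Proof.
move=> iU ih mg gh; pose f (p : T1 * T2) : R := U p.1 * g p.1 p.2.
have mf : measurable_fun setT f.
  by apply: measurable_funM => //; exact: (measurableT_comp (rintegrable_measurable iU)).
have Ef : measurable_fun setT (EFin \o f) by exact/measurable_EFinP.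
have mg1 y : measurable_fun setT (g y) := measurableT_comp mg (measurable_pair1 y).
have mg2 x : measurable_fun setT (fun y => g y x) := measurableT_comp mg (measurable_pair2 x).
have ig y : rintegrable m2 (g y).
  apply: (rintegrable_le ih (mg1 y)) => x; apply: le_trans (gh y x) (ler_norm _).
have if1 y : rintegrable m2 (fun x => f (y, x)) := rintegrableZ (U y) (ig y).
have if2 x : rintegrable m1 (fun y => f (y, x)) := rintegrable_mul iU (mg2 x) (fun y => gh y x).
have H0 : 0 <= rint m2 h by apply: rint_ge0 => x; exact: le_trans (gh point x).
have int_f : (m1 \x m2)%E.-integrable setT (EFin \o f).
  apply/integrable12ltyP => //.
  have iUH := rintegrableZ (rint m2 h) (rintegrable_norm iU).
  apply: (@le_lt_trans _ _ (\int[m1]_y (rint m2 h * `|U y|)%:E)%E); last first.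
    by rewrite fin_rint// ltry.
  apply: ge0_le_integral => //.
  - by move=> y _; exact: integral_ge0.
  - have mab : measurable_fun setT (abse \o (EFin \o f)) := measurableT_comp (@abse_measurable R setT) Ef.
    exact: (@measurable_fun_fubini_tonelli_F _ _ T1 T2 R m2 _ mab (fun=> abse_ge0 _)).
  - exact: measurable_int iUH.
  move=> y _; rewrite [leLHS](_ : _ = (rint m2 (fun x => `|f (y, x)|))%:E); last first.
    by rewrite -fin_rint//; exact: rintegrable_norm.
  rewrite lee_fin mulrC -rintZ//; apply: le_rint => [||x]; [exact: rintegrable_norm|exact: rintegrableZ|].
  by rewrite /f normrM ler_wpM2l.
have := Fubini int_f; rewrite /= => E.
have E1 : (\int[m1]_y \int[m2]_x (f (y, x))%:E = \int[m1]_y (U y * rint m2 (g y))%:E)%E.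
  apply: eq_integral => y _; rewrite fin_rint; last exact: if1.
  by congr EFin; exact: (rintZ (U y) (ig y)).
have E2 : (\int[m2]_x \int[m1]_y (f (y, x))%:E = \int[m2]_x (rint m1 (fun y => U y * g y x))%:E)%E.
  by apply: eq_integral => x _; rewrite fin_rint//; exact: if2.
by rewrite [LHS]/rint [RHS]/rint /Rintegral -E1 -E2 E.
Qed.

End fubini_weighted.

Section lebesgue_fubini.
Variables (R : realType) (N : nat).
Local Notation V := 'rV[R]_N.
Local Notation L := (lebesgue_space R N).
Local Notation B := (borel_space R N).
Local Notation mu := (lebesgue R N).
Local Notation lintegrable := (@rintegrable _ L R mu).
Local Notation lint := (@rint _ L R mu).
Implicit Types (U f k psi : V -> R) (x y z : V) (i : 'I_N).

(* An alias of [lebesgue R N] on which the sigma-finite structure can be declared. *)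
Definition lebesgue_sigma_finite : set L -> \bar R := @completed_measure_extension _ _ _ (borel_lebesgue R N).

HB.instance Definition _ := Measure.on lebesgue_sigma_finite.

Let sigmaT_finite : sigma_finite setT lebesgue_sigma_finite.
Proof. exact/completed_measure_extension_sigma_finite/(sigma_finiteT (borel_lebesgue R N)). Qed.

HB.instance Definition _ := @Measure_isSigmaFinite.Build _ _ _ lebesgue_sigma_finite sigmaT_finite.

(** Only the first factor carries the completed sigma-algebra, because [U] is merely Lebesgue
    measurable; kernels and test functions are continuous, so the second factor can remain Borel. *)
Lemma measurable_row_sub : measurable_fun setT (fun p : L * B => ((p.2 : V) - p.1 : B)).
Proof.
apply: (@measurability _ _ _ B _ _ (@coordinate_preimages R N) erefl).
move=> _ [_ [i [A mA ->]] <-]; rewrite setTI.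
have mc : measurable_fun setT (fun y : B => (y : V) 0 i).
  by move=> _ C mC; rewrite setTI; exact: (measurable_coordinate i mC).
have -> : (fun p : L * B => ((p.2 : V) - p.1 : B)) @^-1` [set x : V | A (x 0 i)] =
    (fun p : L * B => (p.2 : V) 0 i - (p.1 : V) 0 i) @^-1` A.
  by apply/seteqP; split => p /=; rewrite rowBE.
have mc' : measurable_fun setT (fun y : L => (y : V) 0 i).
  exact: (@measurable_fun_borel R N _ _ (fun y : V => y 0 i) mc).
have mm := measurable_funB (measurableT_comp mc (@measurable_snd _ _ L B)) (measurableT_comp mc' (@measurable_fst _ _ L B)).
by have := mm measurableT A mA; rewrite setTI.
Qed.

Lemma bint_convol U k psi : lintegrable U -> cc k -> cc psi ->
  bint (fun x => psi x * convol U k x) = lint (fun y => U y * bint (fun x => psi x * k (x - y))).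
Proof.
move=> iU ck cp; have [M M0 HM] := cc_bounded ck; have [ck' _] := ck; have [cp' _] := cp.
have ih : rintegrable (borel_lebesgue R N) (fun x : B => M * `|psi x|).
  exact: (rintegrableZ M (rintegrable_norm (cc_integrable cp))).
have mg : measurable_fun setT (fun p : L * B => psi p.2 * k ((p.2 : V) - p.1)).
  apply: measurable_funM; first exact: (measurableT_comp (continuous_borel cp')).
  exact: (measurableT_comp (continuous_borel ck') measurable_row_sub).
have gh (y : L) (x : B) : `|psi x * k ((x : V) - y)| <= M * `|psi x|.
  by rewrite normrM mulrC ler_wpM2r.
have := @fubini_weighted _ _ L B R lebesgue_sigma_finite (borel_lebesgue R N) U
  (fun y x => psi x * k ((x : V) - y)) _ iU ih mg gh.
rewrite /rint => <-; rewrite /bint; apply: eq_Rintegral => x _.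
have ikx : lintegrable (fun y => U y * k ((x : V) - y)) by exact: lintegrable_convol.
have := rintZ (psi x) ikx; rewrite /rint /convol /rint => <-.
by apply: eq_Rintegral => y _; rewrite mulrCA.
Qed.

End lebesgue_fubini.

Section vanishing_criteria.
Context d (T : measurableType d) (R : realType) (nu : {measure set T -> \bar R}).

Lemma rint_dominated (f : nat -> T -> R) (g h : T -> R) : rintegrable nu h ->
  (forall n, measurable_fun setT (f n)) -> measurable_fun setT g ->
  (forall n x, `|f n x| <= h x) -> (forall x, f n x @[n --> \oo] --> g x) ->
  rintegrable nu g /\ rint nu (f n) @[n --> \oo] --> rint nu g.
Proof.
move=> ih mf mg fh fg.
have [|||||ig _ cv] := @dominated_convergence _ T R nu setT measurableT (fun n x => (f n x)%:E)
    (fun x => (g x)%:E) (fun x => (h x)%:E).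
- by move=> n; exact/measurable_EFinP.
- exact/measurable_EFinP.
- by apply: aeW => x _; apply: cvg_EFin; [exact: nearW|exact: fg].
- exact: ih.
- by apply: aeW => x n _; rewrite lee_fin fh.
split=> //; move: cv; rewrite fin_rint// => /fine_cvgP[_]; apply: cvg_trans; apply: near_eq_cvg.
by apply: nearW => n.
Qed.

Lemma ae_mono (P Q : T -> Prop) : (forall x, P x -> Q x) ->
  {ae nu, forall x, P x} -> {ae nu, forall x, Q x}.
Proof. by move=> PQ; exact: filterS. Qed.

Lemma ae_mono2 (P Q S : T -> Prop) : (forall x, P x -> Q x -> S x) ->
  {ae nu, forall x, P x} -> {ae nu, forall x, Q x} -> {ae nu, forall x, S x}.
Proof. by move=> PQ; exact: filterS2. Qed.

Lemma integral_rint (F : T -> R) (A : set T) : rintegrable nu F -> measurable A ->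
  (\int[nu]_(x in A) (F x)%:E = (rint nu (fun x => F x * \1_A x))%:E)%E.
Proof.
move=> iF mA; rewrite -fin_rint; last first.
  apply: (rintegrable_mul iF (measurable_indic mA) (M := 1)) => x.
  by rewrite indicE; case: (x \in A); rewrite ?normr1 ?normr0.
rewrite integral_mkcond; apply: eq_integral => x _; rewrite patchE indicE.
by case: ifP => xA; rewrite ?mulr1 ?mulr0.
Qed.

(* Used with [j] the identity from the Lebesgue to the Borel sigma-algebra: [F] need not be Borel. *)
Lemma integral_dynkin d' (T' : measurableType d') (j : T -> T') (G : set (set T')) (F : T -> R) :
  measurable_fun setT j -> @measurable _ T' = <<s G >> -> setI_closed G ->
  rintegrable nu F -> (\int[nu]_x (F x)%:E = 0)%E -> (forall A, G A -> \int[nu]_(x in j @^-1` A) (F x)%:E = 0)%E ->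
  forall A, measurable A -> (\int[nu]_(x in j @^-1` A) (F x)%:E = 0)%E.
Proof.
move=> mj mG GI' iF F0 FG A; rewrite mG.
have mpre S : measurable S -> measurable (j @^-1` S).
  by move=> mS; rewrite -[X in measurable X]setTI; exact: mj.
apply: (@dynkin_induction _ T' G (fun A => \int[nu]_(x in j @^-1` A) (F x)%:E = 0)%E) => //.
- move=> S mS S0; have := F0; rewrite -(setUv (j @^-1` S)) integral_setU_EFin//.
  + by rewrite S0 add0e -preimage_setC.
  + exact: mpre.
  + exact/measurableC/mpre.
  + by rewrite setUv; exact: (rintegrable_measurable iF).
  + by apply/disj_setPS; rewrite setICr.
- move=> H mH tH H0; rewrite preimage_bigcup integral_bigcup//.
  + by rewrite eseries0.
  + by apply/trivIsetP => k l _ _ kl; rewrite -preimage_setI; move/trivIsetP : tH => /(_ k l I I kl) ->; rewrite preimage_set0.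
  + by move=> k; exact: mpre.
  + by apply: integrableS iF => //; apply: bigcup_measurable => k _; exact: mpre.
Qed.

Lemma measureD_eq0 (A E : set T) : measurable A -> measurable E -> E `<=` A ->
  (nu A <= nu E)%E -> (nu E < +oo)%E -> nu (A `\` E) = 0%E.
Proof.
move=> mA mE EA AE Efin; rewrite measureD//; last exact: le_lt_trans AE Efin.
rewrite (setIidr EA); apply/eqP; rewrite eq_le sube_le0 AE/= sube_ge0.
  by apply: le_measure; rewrite ?inE.
by rewrite ge0_fin_numE// Efin.
Qed.

(** The integral over the hull [A] equals that over {F > 0}, the difference being null. There [F] is
    positive, so a zero integral makes the set null. *)
Lemma ae_le0_of_hull (F : T -> R) (A : set T) : rintegrable nu F -> measurable A ->
  [set x | 0 < F x] `<=` A -> nu (A `\` [set x | 0 < F x]) = 0%E ->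
  (\int[nu]_(x in A) (F x)%:E = 0)%E -> {ae nu, forall x, F x <= 0}.
Proof.
move=> iF mA EA nuA A0; set E := [set x | 0 < F x] in EA nuA *.
have mF := rintegrable_measurable iF.
have mE : measurable E.
  rewrite (_ : E = F @^-1` `]0, +oo[); last by apply/seteqP; split => x /=; rewrite in_itv/= andbT.
  by rewrite -[X in measurable X]setTI; exact: mF.
have iFS S : measurable S -> nu.-integrable S (EFin \o F) by move=> mS; exact: integrableS iF.
have E0 : (\int[nu]_(x in E) `|(F x)%:E| = 0)%E.
  have : (\int[nu]_(x in A `\` (A `\` E)) (F x)%:E = 0)%E.
    by rewrite -negligible_integral//; [exact: measurableD|exact: iFS].
  rewrite setDD setIidr// => h; rewrite -[RHS]h; apply: eq_integral => x; rewrite inE => Ex.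
  by rewrite gee0_abs// lee_fin ltW.
have := (ae_eq_integral_abs nu mE (measurable_int _ (iFS _ mE))).1 E0.
apply: filterS => x /= h; rewrite leNgt; apply/negP => Fx.
by have [] := h Fx => F0; move: Fx; rewrite F0 ltxx.
Qed.

End vanishing_criteria.

Section measurable_hull.
Context d (T : measurableType d) (R : realType) (nu : {measure set T -> \bar R}).

(** Covers of measure within 1/(n+1) of the outer measure are intersected over n. *)
Lemma measurable_hull (E : set T) : (nu^* E < +oo)%mu%E ->
  exists B, [/\ measurable B, E `<=` B & (nu B <= nu^* E)%mu%E].
Proof.
move=> Efin; have Efn : (nu^* E)%mu \is a fin_num by rewrite ge0_fin_numE ?mu_ext_ge0.
have /choice[B HB] : forall n : nat, exists B, [/\ measurable B, E `<=` B & (nu B <= nu^* E + (n.+1%:R^-1)%:E)%mu%E].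
  move=> n; have n0 : 0 < n.+1%:R^-1 :> R by rewrite invr_gt0.
  have [_ [F [mF EF] <-] FE] := lb_ereal_inf_adherent n0 Efn.
  exists (\bigcup_k F k); split => //; first exact: bigcup_measurable.
  apply: le_trans (ltW FE); apply: measure_sigma_subadditive => //.
  exact: bigcup_measurable.
exists (\bigcap_n B n); split.
- by apply: bigcapT_measurable => n; have [] := HB n.
- by move=> x Ex n _; have [_ EB _] := HB n; exact: EB.
apply/lee_addgt0Pr => e e0.
have [n ne] : exists n : nat, n.+1%:R^-1 <= e.
  exists (Num.bound e^-1); rewrite invf_ple ?posrE//.
  apply/ltW/(lt_trans (archi_boundP _)); [by rewrite invr_ge0 ltW|by rewrite ltr_nat].
have [mB EB nB] := HB n.
apply: (@le_trans _ _ (nu (B n))).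
  apply: le_measure; rewrite ?inE//; first by apply: bigcapT_measurable => k; have [] := HB k.
  by move=> x; apply.
by apply: le_trans nB _; rewrite leeD2l// lee_fin.
Qed.

End measurable_hull.

Section du_bois_reymond.
Variables (R : realType) (N : nat).
Local Notation V := 'rV[R]_N.
Local Notation L := (lebesgue_space R N).
Local Notation B := (borel_space R N).
Local Notation mu := (lebesgue R N).
Local Notation lintegrable := (@rintegrable _ L R mu).
Local Notation lint := (@rint _ L R mu).
Implicit Types (U f k psi F : V -> R) (x y z : V) (i : 'I_N) (a b c : 'I_N -> R).

(** Orthants are stable under intersection and generate the Borel sets, as Dynkin's theorem
    requires. *)
Definition orthant c : set V := [set x | forall i, c i < x 0 i].
Definition orthants : set (set V) := [set A | exists c, A = orthant c].
Definition open_box a b : set V := [set x | forall i, a i < x 0 i /\ x 0 i < b i].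

Lemma measurable_orthant c : measurable (orthant c : set B).
Proof.
have := @measurable_forall_coordinate R N (fun i => `]c i, +oo[%classic) (fun i => measurable_itv _).
by congr measurable; apply/seteqP; split => x /= H i; have := H i; rewrite /= in_itv/= andbT.
Qed.

Lemma measurable_open_box a b : measurable (open_box a b : set B).
Proof.
have := @measurable_forall_coordinate R N (fun i => `]a i, b i[%classic) (fun i => measurable_itv _).
by congr measurable; apply/seteqP; split => x /= H i; have := H i; rewrite /= in_itv/= => /andP.
Qed.

Lemma orthantsI : setI_closed orthants.
Proof.
move=> _ _ [c ->] [c' ->]; exists (fun i => Num.max (c i) (c' i)).
apply/seteqP; split => [x [/= h h'] i|x /= h]; first by rewrite gt_max h h'.
by split => i; have := h i; rewrite gt_max => /andP[].
Qed.

Lemma borel_orthants : @measurable _ B = <<s orthants >>.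
Proof.
apply/seteqP; split; last first.
  apply: smallest_sub; first exact: (@sigma_algebra_measurable _ B).
  by move=> _ [c ->]; exact: measurable_orthant.
apply: smallest_sub; first exact: smallest_sigma_algebra.
move=> _ [i [A mA ->]].
pose T' := g_sigma_algebraType orthants.
suff mi : measurable_fun setT (fun x : T' => (x : V) 0 i).
  by have := mi measurableT A mA; rewrite setTI.
apply: (measurability _ (RGenOInfty.measurableE R)) => _ [_ [t ->] <-]; rewrite setTI.
rewrite (_ : _ @^-1` _ = \bigcup_n (orthant (fun j => if j == i then t else - n%:R) : set T')).
  by apply: bigcup_measurable => n _; apply: sub_sigma_algebra; exists (fun j => if j == i then t else - n%:R).
apply/seteqP; split => [x|x [n _ /(_ i)]]; rewrite /= in_itv/= andbT.
  move=> tx; exists (Num.bound `|x : V|) => // j; case: eqP => [->//|_].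
  rewrite ltrNl; apply: le_lt_trans (archi_boundP (normr_ge0 _)).
  by apply: le_trans (ler_norm _) _; rewrite normrN; exact: norm_coord_le.
by rewrite eqxx.
Qed.

(** The ramp is rescaled to rise on [0, 1]; since it is 0 up to 0, the products in [soft_box]
    approach the indicator of an open box from inside. *)
Definition soft (t : R) : R := ramp 1 (2 * t + -1).

Definition soft_box c b (n : nat) x : R := \prod_i (soft (n%:R * (x 0 i + - c i)) * soft (n%:R * (b i - x 0 i))).

Lemma smooth_soft_box c b n : smooth (soft_box c b n).
Proof.
have s f : smooth f -> smooth (fun x : V => soft (f x)).
  move=> sf; apply: smooth_ramp; apply: smoothD; last exact: smooth_cst.
  exact: smoothZ.
have sc i := @smooth_coord R N i.
apply: smooth_prod => i; apply: smoothM; apply: s; apply: smoothZ.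
  by apply: smoothD => //; exact: smooth_cst.
by apply: smoothB => //; exact: smooth_cst.
Qed.

Lemma soft01 (t : R) : 0 <= soft t <= 1.
Proof. by rewrite /soft ramp_ge0 ramp_le1. Qed.

Lemma soft_eq0 (t : R) : t <= 0 -> soft t = 0.
Proof. by move=> t0; apply: ramp_eq0 => //; lra. Qed.

Lemma soft_eq1 (t : R) : 1 <= t -> soft t = 1.
Proof. by move=> t0; apply: ramp_eq1 => //; lra. Qed.

Lemma soft_box01 c b n x : 0 <= soft_box c b n x <= 1.
Proof.
apply/andP; split; first by apply: prodr_ge0 => i _; rewrite mulr_ge0// ramp_ge0.
apply: prodr_ile1 => i _; have /andP[h1 h2] := soft01 (n%:R * (x 0 i + - c i)).
have /andP[h3 h4] := soft01 (n%:R * (b i - x 0 i)).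
by rewrite mulr_ge0//= mulr_ile1.
Qed.

Lemma soft_box_eq0 c b n x : ~ open_box c b x -> soft_box c b n x = 0.
Proof.
move=> /existsNP[i /not_andP h]; rewrite /soft_box (bigD1 i)//=.
case: h => /negP; rewrite -leNgt => h.
  by rewrite soft_eq0 ?mul0r// mulr_ge0_le0// subr_le0.
by rewrite (@soft_eq0 (_ * (b i - _))) ?mulr0 ?mul0r// mulr_ge0_le0// subr_le0.
Qed.

Lemma soft_box_cvg c b x : soft_box c b n x @[n --> \oo] --> (\1_(open_box c b) x : R).
Proof.
have [xb|xb] := pselect (open_box c b x); last first.
  rewrite indicE memNset//; apply: (@cvg_trans _ (0 @[n --> \oo])); last exact: cvg_cst.
  by apply: near_eq_cvg; apply: nearW => n; rewrite soft_box_eq0.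
rewrite indicE mem_set//.
have /choice[k Hk] : forall i, exists k : nat, forall n, (k <= n)%N ->
    1 <= n%:R * (x 0 i + - c i) /\ 1 <= n%:R * (b i - x 0 i).
  move=> i; have [h1 h2] := xb i.
  have p1 : 0 < x 0 i - c i by rewrite subr_gt0.
  have p2 : 0 < b i - x 0 i by rewrite subr_gt0.
  exists (maxn (Num.bound (x 0 i - c i)^-1) (Num.bound (b i - x 0 i)^-1)) => n.
  rewrite geq_max => /andP[k1 k2].
  have q (t : R) : 0 < t -> (Num.bound t^-1 <= n)%N -> 1 <= n%:R * t.
    move=> t0 tn; rewrite -ler_pdivrMr// mul1r; apply: (@le_trans _ _ (Num.bound t^-1)%:R).
      by apply/ltW/archi_boundP; rewrite invr_ge0 ltW.
    by rewrite ler_nat.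
  by split; exact: q.
apply: (@cvg_trans _ (1 @[n --> \oo])); last exact: cvg_cst.
apply: near_eq_cvg; exists (\max_i k i)%N => // n /= kn.
rewrite /soft_box big1// => i _; have ki : (k i <= n)%N.
  by apply: leq_trans kn; exact: (@leq_bigmax _ _ i).
by have [h1 h2] := Hk i n ki; rewrite !soft_eq1// mulr1.
Qed.

Lemma integral_open_box0 F a b c : lintegrable F -> (forall i, a i <= c i) ->
  (forall psi, smooth psi -> (forall x, 0 <= psi x <= 1) ->
     (forall x, ~ open_box a b x -> psi x = 0) -> lint (fun x => F x * psi x) = 0) ->
  lint (fun x => F x * \1_(open_box c b) x) = 0.
Proof.
move=> iF ac H.
have mo : measurable (open_box c b : set L) := borel_lebesgue_measurable (measurable_open_box c b).
have bd n x : `|F x * soft_box c b n x| <= `|F x|.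
  rewrite normrM ler_piMr//; have /andP[h1 h2] := soft_box01 c b n x.
  by rewrite ger0_norm.
have cvp x : F x * soft_box c b n x @[n --> \oo] --> F x * \1_(open_box c b) x.
  by apply: cvgM; [exact: cvg_cst|exact: soft_box_cvg].
have [_ cv] := @rint_dominated _ L R mu (fun n x => F x * soft_box c b n x)
  (fun x => F x * \1_(open_box c b) x) (fun x => `|F x|) (rintegrable_norm iF)
  (fun n => measurable_funM (rintegrable_measurable iF) (continuous_lebesgue (smooth_continuous (smooth_soft_box c b n))))
  (measurable_funM (rintegrable_measurable iF) (measurable_indic mo))
  bd cvp.
have := cvg_lim (@Rhausdorff R) cv; rewrite /= => <-.
apply: cvg_lim => //; apply: (@cvg_trans _ (0 @[n --> \oo])); last exact: cvg_cst.
apply: near_eq_cvg; apply: nearW => n; rewrite H//.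
- exact: smooth_soft_box.
- by move=> x; exact: soft_box01.
- move=> x xab; apply: soft_box_eq0 => xcb; apply: xab => i; have [h1 h2] := xcb i.
  by split => //; exact: le_lt_trans h1.
Qed.

(** Smooth tests approximate indicators of boxes. As [F] lives in one box, an orthant acts on it as
    a box does, and Dynkin's theorem extends the vanishing of integrals to all Borel sets, in
    particular to a Borel hull of {F > 0}. *)
Lemma ae_le0_test F a b : lintegrable F -> (forall x, ~ open_box a b x -> F x = 0) ->
  (forall psi, smooth psi -> (forall x, 0 <= psi x <= 1) ->
     (forall x, ~ open_box a b x -> psi x = 0) -> lint (fun x => F x * psi x) = 0) ->
  {ae mu, forall x, F x <= 0}.
Proof.
move=> iF F0 H.
have mB A : measurable (A : set B) -> measurable (A : set L) := @borel_lebesgue_measurable R N A.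
have orth c : (\int[mu]_(x in (orthant c : set L)) (F x)%:E = 0)%E.
  rewrite (@integral_rint _ L R mu F _ iF); last exact: (mB _ (measurable_orthant _)).
  (* Raising the corner to [Num.max (c i) (a i)] keeps the test functions inside the given box and
     does not change the part of the orthant that [F] sees. *)
  have ac i : a i <= Num.max (c i) (a i) by rewrite le_max lexx orbT.
  have h0 := @integral_open_box0 F a b (fun i => Num.max (c i) (a i)) iF ac H.
  rewrite -[RHS]/((0:R)%:E) -h0; congr EFin; apply: eq_rint => x; rewrite !indicE.
  have [xab|xab] := pselect (open_box a b x); last by rewrite F0// !mul0r.
  congr (F x * (nat_of_bool _)%:R); apply/asboolP/asboolP => h i; have := h i; have [h1 h2] := xab i.
    by move=> ci; split => //; rewrite gt_max ci h1.
  by case; rewrite gt_max => /andP[].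
have tot : (\int[mu]_x (F x)%:E = 0)%E.
  rewrite -(orth a) (@integral_rint _ L R mu F (orthant a) iF); last exact: (mB _ (measurable_orthant _)).
  rewrite (fin_rint iF); congr EFin; apply: eq_rint => x; rewrite indicE.
  have [xab|xab] := pselect (open_box a b x); last by rewrite F0// mul0r.
  by rewrite mem_set ?mulr1// => i; case: (xab i).
have mid : measurable_fun setT (id : L -> B).
  exact: (@measurable_fun_borel R N _ _ (id : V -> B) (@measurable_id _ B setT)).
have dyn := @integral_dynkin _ L R mu _ B id orthants F mid borel_orthants orthantsI iF tot.
have {}dyn A : measurable (A : set B) -> (\int[mu]_(x in (A : set L)) (F x)%:E = 0)%E.
  by apply: dyn => _ [c ->]; exact: orth.
pose E : set V := [set x | 0 < F x].
have Eab : E `<=` open_box a b.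
  by move=> x Fx; apply: contrapT => h; move: Fx; rewrite /E/= F0// ltxx.
have mE : measurable (E : set L).
  rewrite (_ : E = (F : L -> R) @^-1` `]0, +oo[); last by apply/seteqP; split => x /=; rewrite in_itv/= andbT.
  by rewrite -[X in measurable X]setTI; exact: (rintegrable_measurable iF).
have Efin : (mu E < +oo)%E.
  apply: (@le_lt_trans _ _ (mu (open_box a b))).
    by apply: le_measure; rewrite ?inE//; exact: (mB _ (measurable_open_box _ _)).
  rewrite lebesgue_borel; last exact: measurable_open_box.
  apply: le_lt_trans (cube_finite a b); apply: le_measure; rewrite ?inE.
  - exact: measurable_open_box.
  - exact: measurable_cube.
  - by move=> x xab i; have [h1 h2] := xab i; rewrite in_itv/= !ltW.
(* {F > 0} is only Lebesgue measurable, whereas [dyn] speaks of Borel sets; its Lebesgue measure is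
   by construction the outer measure for which the hull is taken. *)
have [A [mA EA nA]] := @measurable_hull _ B R (borel_lebesgue R N) E Efin.
apply: (ae_le0_of_hull iF (mB _ mA) EA) (dyn _ mA).
apply: measureD_eq0 => //; first exact: mB.
by rewrite lebesgue_borel.
Qed.

Lemma ae_eq0_test F a b : lintegrable F -> (forall x, ~ open_box a b x -> F x = 0) ->
  (forall psi, smooth psi -> (forall x, 0 <= psi x <= 1) ->
     (forall x, ~ open_box a b x -> psi x = 0) -> lint (fun x => F x * psi x) = 0) ->
  {ae mu, forall x, F x = 0}.
Proof.
move=> iF F0 H; have h1 := ae_le0_test iF F0 H.
have h2 : {ae mu, forall x, -1 * F x <= 0}.
  apply: (@ae_le0_test _ a b); first exact: rintegrableZ.
    by move=> x /F0 ->; rewrite mulr0.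
  move=> psi sp p01 p0; have jf : lintegrable (fun x => F x * psi x).
    apply: (@rintegrable_mul _ L R mu F psi 1 iF (continuous_lebesgue (smooth_continuous sp))) => x.
    by have /andP[q1 q2] := p01 x; rewrite ger0_norm.
  rewrite -[RHS](mulr0 (-1)) -(H psi sp p01 p0) -rintZ//; apply: eq_rint => x.
  by rewrite mulrA.
apply: (ae_mono2 _ h1 h2) => x {}h1; rewrite mulN1r oppr_le0 => {}h2.
by apply/eqP; rewrite eq_le h1 h2.
Qed.

End du_bois_reymond.

(** * The weak equation *)

Section integrable_restriction.
Context d (T : measurableType d) (R : realType) (nu : {measure set T -> \bar R}).
Implicit Types (u f : T -> R) (K D : set T).

Lemma rintegrable_patchP K u : measurable K -> rintegrable nu (u \_ K) <->
  measurable_fun K u /\ (\int[nu]_(x in K) `|u x|%:E < +oo)%E.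
Proof.
move=> mK; rewrite /rintegrable -restrict_EFin; split.
  move=> /(integrable_mkcond _ mK)/integrableP[m1 m2]; split => //.
  exact/measurable_EFinP.
move=> [m1 m2]; apply/(integrable_mkcond _ mK)/integrableP; split => //.
exact/measurable_EFinP.
Qed.

Lemma rint_patch D K u f : K `<=` D -> (forall x, ~ K x -> f x = 0) ->
  \int[nu]_(x in D) (u x * f x) = rint nu (fun x => (u \_ K) x * f x).
Proof.
move=> KD f0; rewrite Rintegral_mkcond; apply: eq_Rintegral => x _; rewrite !patchE.
case: ifPn => xD; case: ifPn => xK //.
- by rewrite f0 ?mulr0//; move: xK; rewrite notin_setE.
- by move: xD; rewrite notin_setE => xD; exfalso; apply/xD/KD; rewrite -inE.
- by rewrite mul0r.
Qed.

End integrable_restriction.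

Section multi_partial.
Variables (R : realType) (N : nat).
Local Notation V := 'rV[R]_N.
Implicit Types (phi : V -> R) (i j : 'I_N) (a b : {ffun 'I_N -> nat}) (s : seq 'I_N).

Lemma smooth_iter i k phi : smooth phi -> smooth (iter k (partial i) phi).
Proof. by move=> sp; elim: k => //= k; exact: smooth_partial. Qed.

Lemma iter_partialC i j k phi : smooth phi ->
  partial i (iter k (partial j) phi) = iter k (partial j) (partial i phi).
Proof.
move=> sp; elim: k => //= k IH.
by rewrite partialC ?IH//; exact: smooth_iter.
Qed.

Lemma iter_iter_partialC i j k l phi : smooth phi ->
  iter l (partial i) (iter k (partial j) phi) = iter k (partial j) (iter l (partial i) phi).
Proof.
move=> sp; elim: l => //= l ->; rewrite iter_partialC//.
exact: smooth_iter.
Qed.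

Definition seq_partial a s phi := foldr (fun i f => iter (a i) (partial i) f) phi s.

Lemma smooth_seq_partial a s phi : smooth phi -> smooth (seq_partial a s phi).
Proof. by move=> sp; elim: s => //= i s; exact: smooth_iter. Qed.

Lemma seq_partialC a s i k phi : smooth phi ->
  iter k (partial i) (seq_partial a s phi) = seq_partial a s (iter k (partial i) phi).
Proof.
move=> sp; elim: s => //= j s IH; rewrite -IH iter_iter_partialC//.
exact: smooth_seq_partial.
Qed.

Lemma multi_partialD a b phi : smooth phi ->
  multi_partial [ffun i => (a i + b i)%N] phi = multi_partial a (multi_partial b phi).
Proof.
move=> sp; rewrite /multi_partial -![foldr _ _ _]/(seq_partial _ _ _).
elim: (enum _) => //= i s ->; rewrite ffunE iterD; congr iter.
by rewrite seq_partialC//; exact: smooth_seq_partial.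
Qed.

Lemma multi_partial1 i k phi : multi_partial [ffun j => if j == i then k else 0%N] phi = iter k (partial i) phi.
Proof.
rewrite /multi_partial.
have H s : foldr (fun j f => iter ([ffun j => if j == i then k else 0%N] j) (partial j) f) phi s =
    if (i \in s) then iter (k * count_mem i s) (partial i) phi else phi.
  elim: s => //= j s ->; rewrite ffunE inE [i == j]eq_sym.
  case: eqP => [->|_]/=; last by rewrite add0n.
  case: ifP => ins; first by rewrite mulnDr muln1 iterD.
  have /count_memPn -> : i \notin s by rewrite ins.
  by rewrite muln1.
by rewrite H mem_enum/= count_uniq_mem ?enum_uniq// mem_enum muln1.
Qed.

Lemma multi_order1 i k : multi_order [ffun j => if j == i then k else 0%N] = k.
Proof.
rewrite /multi_order (bigD1 i)//= ffunE eqxx big1 ?addn0// => j ji.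
by rewrite ffunE (negPf ji).
Qed.

Lemma doubleE i : [ffun j : 'I_N => (j == i).*2] = [ffun j => if j == i then 2%N else 0%N].
Proof. by apply/ffunP => j; rewrite !ffunE; case: (j == i). Qed.

Lemma multi_partial_eq0 a phi (U : set V) : open U -> (forall x, U x -> phi x = 0) ->
  forall x, U x -> multi_partial a phi x = 0.
Proof.
move=> oU; rewrite /multi_partial.
have it i k f : (forall x, U x -> f x = 0) -> forall x, U x -> iter k (partial i) f x = 0.
  by move=> f0; elim: k => //= k IH x Ux; exact: (partial0_open _ oU IH).
move=> p0; elim: (enum _) => //= i s IH x Ux; exact: it.
Qed.

End multi_partial.

Section weak_derivatives.
Variables (R : realType) (N : nat).
Local Notation V := 'rV[R]_N.
Local Notation L := (lebesgue_space R N).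
Local Notation mu := (lebesgue R N).
Local Notation lintegrable := (@rintegrable _ L R mu).
Local Notation lint := (@rint _ L R mu).
Variable Omega : set V.
Hypothesis openO : open Omega.
Implicit Types (u v w phi : V -> R) (i j : 'I_N) (a b : {ffun 'I_N -> nat}) (K : set V).

Lemma compact_rV_closed K : compact K -> closed K.
Proof. apply: compact_closed; exact: norm_hausdorff. Qed.

Lemma closed_lebesgue K : closed K -> measurable (K : set L).
Proof.
move=> cK; apply: borel_lebesgue_measurable.
rewrite -(setCK K); apply: (@measurableC _ (borel_space R N)); apply: open_borel.
exact: closed_openC.
Qed.

Lemma compact_lebesgue K : compact K -> measurable (K : set L).
Proof. by move=> /compact_rV_closed/closed_lebesgue. Qed.

Lemma measurable_Omega : measurable (Omega : set L).
Proof. exact: (borel_lebesgue_measurable (open_borel openO)). Qed.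

Lemma Lp_loc1P u : lebesgue_measurable_fun Omega u ->
  Lp_loc Omega 1 u <-> forall K, compact K -> K `<=` Omega -> lintegrable (u \_ K).
Proof.
move=> mu'; split => [[_ H] K cK KO|H].
  apply/(rintegrable_patchP _ _ (compact_lebesgue cK)); split.
    exact: (measurable_funS measurable_Omega KO mu').
  have := H K cK KO; congr (_ < _)%E; apply: eq_integral => x _.
  by rewrite powRr1.
split=> // K cK KO; have /(rintegrable_patchP _ _ (compact_lebesgue cK))[_] := H K cK KO.
by congr (_ < _)%E; apply: eq_integral => x _; rewrite powRr1.
Qed.

Lemma Lp_loc1_LI u K : Lp_loc Omega 1 u -> compact K -> K `<=` Omega -> lintegrable (u \_ K).
Proof. by move=> Lu; have [mu' _] := Lu; move: Lu => /(Lp_loc1P mu'); apply. Qed.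

Lemma Lp_loc1_sum (I : Type) (s : seq I) (F : I -> V -> R) :
  (forall l, Lp_loc Omega 1 (F l)) -> Lp_loc Omega 1 (fun x => \sum_(l <- s) F l x).
Proof.
move=> H.
have mS : lebesgue_measurable_fun Omega (fun x => \sum_(l <- s) F l x).
  by apply: (@measurable_sum _ L R _ _ _ (fun l x => F l x)) => l; case: (H l).
apply/(Lp_loc1P mS) => K cK KO.
rewrite (_ : _ \_ K = fun x => \sum_(l <- s) (F l \_ K) x).
  by apply: (@rintegrable_sum _ L R mu) => i; exact: Lp_loc1_LI.
apply/funext => x; rewrite patchE; case: ifPn => xK.
  by apply: eq_bigr => i _; rewrite patchE xK.
by rewrite big1// => i _; rewrite patchE (negPf xK).
Qed.

Lemma patch_sum (I : Type) (s : seq I) (F : I -> V -> R) K x :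
  ((fun x => \sum_(l <- s) F l x) \_ K) x = \sum_(l <- s) (F l \_ K) x.
Proof.
rewrite patchE; case: ifPn => xK; first by apply: eq_bigr => i _; rewrite patchE xK.
by rewrite big1// => i _; rewrite patchE (negPf xK).
Qed.

(** Truncating to a compact [K] that carries the test function turns integrals over [Omega] of
    locally integrable functions into integrals of integrable ones over the whole space. *)
Definition weak_on a u v := forall K phi, compact K -> K `<=` Omega -> smooth phi ->
  (forall x, ~ K x -> phi x = 0) ->
  lint (fun x => (u \_ K) x * multi_partial a phi x) = (-1) ^+ multi_order a * lint (fun x => (v \_ K) x * phi x).

Lemma test_functionP phi : test_function Omega phi <->
  exists K, [/\ compact K, K `<=` Omega, smooth phi & forall x, ~ K x -> phi x = 0].
Proof.
split=> [[sp cK KO]|[K [cK KO sp p0]]].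
  exists (closure [set x | phi x != 0]); split => // x xK; apply/eqP/negPn/negP => px.
  by apply: xK; exact: subset_closure.
have KK : closure [set x | phi x != 0] `<=` K.
  rewrite [X in _ `<=` X](closure_id K).1; last exact: compact_rV_closed.
  by apply: closureS => x /= px; apply: contrapT => /p0 e; rewrite e eqxx in px.
split => //; last exact: subset_trans KO.
exact: (subclosed_compact (@closed_closure _ _) cK).
Qed.

Lemma is_weak_partialP a u v : Lp_loc Omega 1 u -> Lp_loc Omega 1 v ->
  is_weak_partial Omega a u v <-> weak_on a u v.
Proof.
move=> Lu Lv; split => [[_ _ H] K phi cK KO sp p0|H].
  have tp : test_function Omega phi by apply/test_functionP; exists K.
  have := H phi tp.
  rewrite (@rint_patch _ L R mu Omega K v phi KO p0).
  rewrite (@rint_patch _ L R mu Omega K u (multi_partial a phi) KO)//.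
  move=> x; apply: (@multi_partial_eq0 _ _ a phi (~` K)) => //.
  exact: (closed_openC (compact_rV_closed cK)).
split => // phi /test_functionP[K [cK KO sp p0]].
rewrite (@rint_patch _ L R mu Omega K v phi KO p0).
rewrite (@rint_patch _ L R mu Omega K u (multi_partial a phi) KO) ?H//.
move=> x; apply: (@multi_partial_eq0 _ _ a phi (~` K)) => //.
exact: (closed_openC (compact_rV_closed cK)).
Qed.

Lemma weak_partialP a u : (exists v, is_weak_partial Omega a u v) ->
  is_weak_partial Omega a u (weak_partial Omega a u).
Proof. exact: (@xgetPex _ (fun=> 0) [set v | is_weak_partial Omega a u v]). Qed.

Lemma cc_compact_support K phi : compact K -> smooth phi -> (forall x, ~ K x -> phi x = 0) -> cc phi.
Proof.
move=> cK sp p0; apply: (ccP sp); have [M [_ HM]] := compact_bounded cK.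
exists (M + 1) => x Mx; apply: p0 => Kx.
have := HM (M + 1); rewrite ltrDl ltr01 => /(_ isT x Kx) /= h.
by move: Mx; rewrite ltNge h.
Qed.

Lemma lintegrable_patch_cc u K phi : Lp_loc Omega 1 u -> compact K -> K `<=` Omega -> cc phi ->
  lintegrable (fun x => (u \_ K) x * phi x).
Proof.
move=> Lu cK KO cp; have [M _ HM] := cc_bounded cp; have [cp' _] := cp.
exact: (@rintegrable_mul _ L R mu _ _ M (Lp_loc1_LI Lu cK KO) (continuous_lebesgue cp') HM).
Qed.

Lemma partial_out K phi i : closed K -> (forall x, ~ K x -> phi x = 0) ->
  forall x, ~ K x -> partial i phi x = 0.
Proof. by move=> cK p0 x Kx; exact: (@partial0_open _ _ i phi (~` K) x (closed_openC cK) p0 Kx). Qed.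

Local Notation ei k i := [ffun j : 'I_N => if j == i then k else 0%N].

Lemma weak_on_laplacian u (D : 'I_N -> V -> R) K phi : Lp_loc Omega 1 u ->
  (forall i, is_weak_partial Omega (ei 2%N i) u (D i)) -> compact K -> K `<=` Omega -> smooth phi ->
  (forall x, ~ K x -> phi x = 0) ->
  lint (fun x => (u \_ K) x * lap phi x) = lint (fun x => ((fun x => \sum_i D i x) \_ K) x * phi x).
Proof.
move=> Lu HD cK KO sp p0; have cp := cc_compact_support cK sp p0.
have LD i : Lp_loc Omega 1 (D i) by have [] := HD i.
transitivity (\sum_i lint (fun x => (D i \_ K) x * phi x)); last first.
  rewrite -(@rint_sum _ L R mu) => [|i]; last exact: (lintegrable_patch_cc (LD i) cK KO cp).
  by apply: eq_rint => x; rewrite patch_sum mulr_suml.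
transitivity (lint (fun x => \sum_i (u \_ K) x * partial i (partial i phi) x)).
  by apply: eq_rint => x; rewrite mulr_sumr.
rewrite (@rint_sum _ L R mu) => [|i]; last first.
  apply: lintegrable_patch_cc => //; apply: (@cc_compact_support K _ cK).
    by do 2 apply: smooth_partial.
  by have cK' := compact_rV_closed cK; apply: (partial_out i cK'); apply: (partial_out i cK').
apply: eq_bigr => i _; have := (is_weak_partialP (ei 2%N i) Lu (LD i)).1 (HD i) K phi cK KO sp p0.
by rewrite multi_order1 multi_partial1 /= sqrrN expr1n mul1r.
Qed.

Section sobolev_bilaplacian.
Variables (m : R) (u : V -> R).
Hypothesis uW : sobolev_loc Omega 4 m u.

Lemma sobolev_Lp1 : Lp_loc Omega 1 u.
Proof.
have [|v [Lu _ _] _] := uW (a := [ffun=> 0%N]) => //.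
by rewrite /multi_order big1// => i _; rewrite ffunE.
Qed.

Lemma sobolev_first_order i : exists v, [/\ Lp_loc Omega 1 v, Lp_loc Omega m v &
  forall K phi, compact K -> K `<=` Omega -> smooth phi -> (forall x, ~ K x -> phi x = 0) ->
  lint (fun x => (u \_ K) x * partial i phi x) = - lint (fun x => (v \_ K) x * phi x)].
Proof.
have [|v Hv Lm] := uW (a := ei 1%N i); first by rewrite multi_order1.
have [Lu Lv _] := Hv; exists v; split => // K phi cK KO sp p0.
have := (is_weak_partialP _ Lu Lv).1 Hv K phi cK KO sp p0.
by rewrite multi_order1 multi_partial1 expr1 mulN1r.
Qed.

(** The iterated operator is meaningful only if the weak Laplacian of [u] has weak second
    derivatives itself; these come from the fourth-order derivatives of [u]. Both Laplacians can
    then be moved to the test function. *)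
Lemma weak_bilaplacian : Lp_loc Omega 1 (weak_laplacian Omega (weak_laplacian Omega u)) /\
  forall K phi, compact K -> K `<=` Omega -> smooth phi -> (forall x, ~ K x -> phi x = 0) ->
  lint (fun x => (u \_ K) x * lap (lap phi) x) =
  lint (fun x => ((weak_laplacian Omega (weak_laplacian Omega u)) \_ K) x * phi x).
Proof.
have Lu := sobolev_Lp1; set w := weak_laplacian Omega u.
have wE : w = fun x => \sum_i weak_partial Omega (ei 2%N i) u x.
  by apply/funext => x; apply: eq_bigr => i _; rewrite doubleE.
have HD i : is_weak_partial Omega (ei 2%N i) u (weak_partial Omega (ei 2%N i) u).
  apply: weak_partialP; have [|v Hv _] := uW (a := ei 2%N i); first by rewrite multi_order1.
  by exists v.
have LD i : Lp_loc Omega 1 (weak_partial Omega (ei 2%N i) u) by have [] := HD i.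
have Lw : Lp_loc Omega 1 w by rewrite wE; exact: Lp_loc1_sum.
(* Without such a witness [weak_partial] would be its default value 0. The witness is the sum over j
   of the weak derivatives of [u] of multi-index 2 e_j + 2 e_i, checked by testing with the second
   derivative of [phi]. *)
have HDw i : is_weak_partial Omega (ei 2%N i) w (weak_partial Omega (ei 2%N i) w).
  apply: weak_partialP.
  have o4 j : multi_order [ffun k => (ei 2%N j k + ei 2%N i k)%N] = 4%N.
    rewrite /multi_order (eq_bigr (fun k => ei 2%N j k + ei 2%N i k)%N) => [|k _]; last by rewrite ffunE.
    by rewrite big_split/= -![(\sum_(k < N) _)%N]/(multi_order _) !multi_order1.
  have /choice[v Hv] : forall j, exists v, is_weak_partial Omega [ffun k => (ei 2%N j k + ei 2%N i k)%N] u v.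
    by move=> j; have [|v Hv _] := uW (a := [ffun k => (ei 2%N j k + ei 2%N i k)%N]); [rewrite o4|exists v].
  have Lv j : Lp_loc Omega 1 (v j) by have [] := Hv j.
  exists (fun x => \sum_j v j x); apply/(is_weak_partialP (ei 2%N i) Lw (Lp_loc1_sum _ Lv)).
  move=> K phi cK KO sp p0; rewrite multi_order1 multi_partial1 sqrrN expr1n mul1r.
  have si := smooth_iter i 2 sp.
  have pi0 : forall x, ~ K x -> iter 2 (partial i) phi x = 0.
    by have cK' := compact_rV_closed cK; apply: (partial_out i cK'); apply: (partial_out i cK').
  have cp := cc_compact_support cK sp p0; have cpi := cc_compact_support cK si pi0.
  transitivity (\sum_j lint (fun x => (weak_partial Omega (ei 2%N j) u \_ K) x * iter 2 (partial i) phi x)).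
    rewrite -(@rint_sum _ L R mu) => [|j]; last exact: (lintegrable_patch_cc (LD j) cK KO cpi).
    by apply: eq_rint => x; rewrite wE patch_sum mulr_suml.
  transitivity (\sum_j lint (fun x => (v j \_ K) x * phi x)); last first.
    rewrite -(@rint_sum _ L R mu) => [|j]; last exact: (lintegrable_patch_cc (Lv j) cK KO cp).
    by apply: eq_rint => x; rewrite patch_sum mulr_suml.
  apply: eq_bigr => j _.
  have := (is_weak_partialP _ Lu (LD j)).1 (HD j) K _ cK KO si pi0.
  rewrite multi_order1 sqrrN expr1n mul1r => <-.
  have := (is_weak_partialP _ Lu (Lv j)).1 (Hv j) K phi cK KO sp p0.
  have s4 : (-1) ^+ 4 = 1 :> R by rewrite -signr_odd.
  by rewrite o4 multi_partialD// !multi_partial1 s4 mul1r.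
split.
  rewrite (_ : weak_laplacian _ _ = fun x => \sum_i weak_partial Omega (ei 2%N i) w x).
    by apply: Lp_loc1_sum => i; have [] := HDw i.
  by apply/funext => x; apply: eq_bigr => i _; rewrite doubleE.
move=> K phi cK KO sp p0.
have sl := smooth_lap sp.
have l0 x : ~ K x -> lap phi x = 0.
  by move=> Kx; apply: (@lap0_open _ _ phi (~` K)) => //; exact: (closed_openC (compact_rV_closed cK)).
rewrite (weak_on_laplacian Lu HD cK KO sl l0) -wE (weak_on_laplacian Lw HDw cK KO sp p0).
apply: eq_rint => x; rewrite !patchE; case: ifP => // _; congr (_ * _).
by apply: eq_bigr => i _; rewrite doubleE.
Qed.

End sobolev_bilaplacian.

End weak_derivatives.

(** * The continuous representative *)

Section mollified_solution.
Variables (R : realType) (N : nat).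
Local Notation V := 'rV[R]_N.
Local Notation L := (lebesgue_space R N).
Local Notation mu := (lebesgue R N).
Local Notation lintegrable := (@rintegrable _ L R mu).
Local Notation lint := (@rint _ L R mu).
Implicit Types (f g u v phi k U psi : V -> R) (x y z c : V) (i : 'I_N) (K : set V).

Lemma rad2_le_norm c x : rad2 c x <= N%:R * `|x - c| ^+ 2.
Proof.
rewrite /rad2 -[N in N%:R]card_ord -sum1_card natr_sum mulr_suml; apply: ler_sum => i _.
rewrite mul1r -[leLHS]real_normK ?num_real// ler_sqr ?nnegrE//.
by rewrite -rowBE; exact: norm_coord_le.
Qed.

Lemma closed_ball_compact c (d : R) : compact [set y : V | `|y - c| <= d].
Proof.
apply: bounded_closed_compact.
  exists (`|c| + d); split; first exact: num_real.
  move=> M cM y /= yc; apply: le_trans (ltW cM).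
  by have := ler_normD (y - c) c; rewrite subrK; lra.
rewrite (_ : [set _ | _] = (fun y => `|y - c|) @^-1` [set t | t <= d])//.
apply: closed_comp; last exact: closed_le.
by move=> y _; exact: (continuous_shift (@norm_continuous _ _)).
Qed.

Lemma normr_bint_le f g : cc f -> cc g -> (forall x, `|f x| <= g x) -> `|bint f| <= bint g.
Proof.
move=> cf cg; exact: (@normr_rint_le _ (borel_space R N) R (borel_lebesgue R N) f g (cc_integrable cf) (cc_integrable cg)).
Qed.

Lemma mollify_error psi (M d : R) y : 0 < d -> 0 <= M -> cc psi -> (forall x y, `|psi x - psi y| <= M * `|x - y|) ->
  `|psi y - bint (fun x => psi x * mollifier d (x - y))| <= M * d.
Proof.
move=> d0 M0 cp HM.
have cm : cc (fun x => mollifier d (x - y)).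
  apply: ccP; last first.
    exists (`|y| + d) => x xd; apply: mollifier_eq0 => //.
    by have := ler_normD (x - y) y; rewrite subrK; lra.
  rewrite (_ : (fun x => _) = fun x => mollifier d (1 *: x + - y)).
    by apply: smooth_affine; exact: smooth_mollifier.
  by apply/funext => x; rewrite scale1r.
have [cp' _] := cp; have [cm' _] := cm.
have E : psi y = bint (fun x => psi y * mollifier d (x - y)) by rewrite bintZ// bint_mollifier// mulr1.
rewrite {1}E -bintB; [|exact: ccZ|exact: ccMl].
rewrite -[leRHS]mulr1 -(bint_mollifier y d0) -bintZ//.
have H x : `|psi y * mollifier d (x - y) - psi x * mollifier d (x - y)| <= M * d * mollifier d (x - y).
  rewrite -mulrBl normrM (ger0_norm (mollifier_ge0 _ d0)).
  have [xd|xd] := leP `|x - y| d; last by rewrite mollifier_eq0// !mulr0.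
  apply: ler_wpM2r; first exact: mollifier_ge0.
  by apply: le_trans (HM y x) _; rewrite distrC; apply: ler_wpM2l.
by apply: normr_bint_le => //; [apply: ccB; [exact: ccZ|exact: ccMl]|exact: ccZ].
Qed.

#[local] Opaque lap partial.

Lemma dist_le_thirds (a b a' b' s : R) : `|a' - a| <= s / 3 -> `|b' - b| <= s / 3 -> `|a' - b'| <= s / 3 ->
  `|a - b| <= s.
Proof.
by rewrite !ler_norml => /andP[? ?] /andP[? ?] /andP[? ?]; apply/andP; split; lra.
Qed.

Lemma dist_le_halves (a b e s : R) : `|a - e| <= s / 2 -> `|e - b| <= s / 2 -> `|a - b| <= s.
Proof.
by rewrite !ler_norml => /andP[? ?] /andP[? ?]; apply/andP; split; lra.
Qed.

Section representative.
Variables (Omega : set V) (m : R) (u : V -> R) (c : V) (rho : R).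
Hypotheses (openO : open Omega) (Nm : N%:R < m) (uW : sobolev_loc Omega 4 m u).
Hypotheses (rho0 : 0 < rho) (KO : forall y, `|y - c| <= rho -> Omega y).

Definition ball_set : set V := [set y | `|y - c| <= rho].
Definition local_part v : V -> R := v \_ ball_set.
(** Starting at rho / 2, a kernel centred within rho / 2 of [c] never leaves [ball_set]. *)
Definition width (n : nat) : R := rho / 2 / 2 ^+ n.

Let cK : compact ball_set := @closed_ball_compact c rho.
Let KO' : ball_set `<=` Omega := KO.

Lemma width_gt0 n : 0 < width n.
Proof. by rewrite !divr_gt0// exprn_gt0. Qed.

Lemma width_le n : width n <= rho / 2.
Proof.
have r2 : 0 <= rho / 2 by rewrite divr_ge0// ltW.
by rewrite ler_pdivrMr ?exprn_gt0// ler_peMr// exprn_ege1// ler1n.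
Qed.

Lemma width_small (e : R) : 0 < e -> exists n0, forall n, (n0 <= n)%N -> width n <= e.
Proof.
move=> e0; have r2 : 0 < rho / 2 by rewrite divr_gt0.
have i0 : 0 <= 2^-1 :> R by rewrite invr_ge0.
have i1 : 2^-1 < 1 :> R by rewrite invf_lt1// ltr1n.
have [n0 H] := expr_small i0 i1 (divr_gt0 e0 r2); exists n0 => n nn.
by have := H n nn; rewrite exprVn ler_pdivlMr// mulrC.
Qed.

Lemma lintegrable_local v : Lp_loc Omega 1 v -> lintegrable (local_part v).
Proof. by move=> Lv; exact: (Lp_loc1_LI openO Lv cK KO'). Qed.

Lemma lintegrable_local_m v : Lp_loc Omega 1 v -> Lp_loc Omega m v -> lintegrable (fun y => `|local_part v y| `^ m).
Proof.
move=> Lv [mv Hv]; have m0 : 0 < m by apply: le_lt_trans Nm.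
rewrite (_ : (fun y => _) = (fun y => `|v y| `^ m) \_ ball_set); last first.
  by apply/funext => y; rewrite /local_part !patchE; case: ifP => //; rewrite normr0 powR0// gt_eqF.
apply/(rintegrable_patchP _ _ (compact_lebesgue cK)); split.
  apply: (measurableT_comp (measurable_powR m)); apply: (measurableT_comp (@normr_measurable R setT)).
  exact: (measurable_funS (measurable_Omega openO) KO' mv).
have := Hv _ cK KO'; congr (_ < _)%E; apply: eq_integral => y _.
by congr EFin; rewrite [RHS]ger0_norm ?powR_ge0.
Qed.

Lemma reflect_out k x : (forall z, rho / 2 < `|z| -> k z = 0) -> `|x - c| <= rho / 2 ->
  forall y, ~ ball_set y -> k (x - y) = 0.
Proof.
move=> k0 xc y yK; apply: k0; rewrite ltNge; apply/negP => xy; apply: yK; rewrite /ball_set/=.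
rewrite (_ : y - c = x - c - (x - y)); last by rewrite opprB [RHS]addrC addrA subrK.
by apply: le_trans (ler_normB _ _) _; lra.
Qed.

Lemma reflectE k x : (fun y => k (x - y)) = (fun y => k (-1 *: y + x)).
Proof. by apply/funext => y; rewrite scaleN1r addrC. Qed.

Lemma smooth_reflect k x : smooth k -> smooth (fun y => k (x - y)).
Proof. by move=> sk; rewrite reflectE; exact: smooth_affine. Qed.

(** The reflected kernel y |-> k (x - y) is an admissible test function; the sign from the
    reflection cancels that of the integration by parts. *)
Lemma convol_first_order v i k x : (forall K phi, compact K -> K `<=` Omega -> smooth phi ->
    (forall x, ~ K x -> phi x = 0) ->
    lint (fun x => (u \_ K) x * partial i phi x) = - lint (fun x => (v \_ K) x * phi x)) ->
  smooth k -> (forall z, rho / 2 < `|z| -> k z = 0) -> `|x - c| <= rho / 2 ->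
  convol (local_part u) (partial i k) x = convol (local_part v) k x.
Proof.
move=> H sk k0 xc.
have Hk := H _ _ cK KO' (smooth_reflect x sk) (reflect_out k0 xc).
transitivity (- lint (fun y => local_part u y * partial i (fun z => k (x - z)) y)); last first.
  by rewrite /local_part Hk opprK.
rewrite -mulN1r -(@rintZ _ L R mu); last first.
  apply: (@lintegrable_patch_cc _ _ Omega) => //; first exact: sobolev_Lp1 uW.
  rewrite reflectE; have cr := cc_compact_support cK (smooth_reflect x sk) (reflect_out k0 xc).
  rewrite -reflectE; apply: ccP; first exact/smooth_partial/smooth_reflect.
  by apply: bounded_support_partial; case: cr.
apply: eq_rint => y.
have -> : partial i (fun z => k (x - z)) y = - partial i k (x - y).
  by rewrite reflectE partial_affine// mulN1r scaleN1r (addrC (- y)).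
by rewrite mulrN mulN1r opprK.
Qed.

Lemma convol_bilaplacian k x : smooth k -> (forall z, rho / 2 < `|z| -> k z = 0) -> `|x - c| <= rho / 2 ->
  convol (local_part u) (lap (lap k)) x = convol (local_part (weak_laplacian Omega (weak_laplacian Omega u))) k x.
Proof.
move=> sk k0 xc; have [_ H] := weak_bilaplacian openO uW.
have e f : smooth f -> lap (fun y => f (x - y)) = fun y => lap f (x - y).
  move=> sf; apply/funext => z; rewrite reflectE lap_affine// sqrrN expr1n mul1r.
  by rewrite scaleN1r (addrC (- z)).
have := H _ _ cK KO' (smooth_reflect x sk) (reflect_out k0 xc).
have e2 : lap (lap (fun y => k (x - y))) = fun y => lap (lap k) (x - y).
  rewrite (e k sk); exact: (e (lap k) (smooth_lap sk)).
rewrite e2 => h; rewrite /convol /local_part; exact: h.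
Qed.

(** The cutoff vanishes beyond rho / 2, where the telescoping bound stops holding, and so makes the
    convergence uniform on the whole space. *)
Definition localized n x : R := cutoff c (rho / 4) x * convol (local_part u) (mollifier (width n)) x.

Let r4 : 0 < rho / 4. Proof. by rewrite divr_gt0. Qed.

Lemma smooth_localized n : smooth (localized n).
Proof.
apply: smoothM; first exact: smooth_cutoff.
apply: smooth_convol; [exact/lintegrable_local/(sobolev_Lp1 uW)|exact: smooth_mollifier|].
by case: (cc_mollifier N (width_gt0 n)).
Qed.

Lemma cc_localized n : cc (localized n).
Proof.
apply: (ccP (smooth_localized n)); apply: bounded_supportMl; exact: bounded_support_cutoff.
Qed.

Lemma localized_limit : exists2 ut : V -> R, continuous ut &
  forall s, 0 < s -> exists n0, forall n, (n0 <= n)%N -> forall x, `|localized n x - ut x| <= s.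
Proof.
have /choice[v Hv] := sobolev_first_order uW.
have r2 : 0 < rho / 2 by rewrite divr_gt0.
have L1 i : lintegrable (local_part (v i)) by have [h _ _] := Hv i; exact: lintegrable_local.
have Lm i : lintegrable (fun y => `|local_part (v i) y| `^ m) by have [h h' _] := Hv i; exact: lintegrable_local_m.
have Lo i k x : smooth k -> (forall z, rho / 2 < `|z| -> k z = 0) -> `|x - c| <= rho / 2 ->
    convol (local_part u) (partial i k) x = convol (local_part (v i)) k x.
  by move=> sk k0 xc; have [_ _ h] := Hv i; exact: (convol_first_order h).
have [C [t [C0 t0 t1 H]]] := @dyadic_bound R N (fun i => local_part (v i)) (local_part u) m (rho / 2)
  [set x | `|x - c| <= rho / 2] Nm r2 (lintegrable_local (sobolev_Lp1 uW)) L1 Lm Lo.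
apply: (@geometric_uniform_limit _ _ localized C t C0 t0 t1).
  by move=> n; apply: smooth_continuous; exact: smooth_localized.
move=> n x; rewrite /localized -mulrBr normrM (ger0_norm (cutoff_ge0 _ _ _)).
have [xc|xc] := leP `|x - c| (rho / 2).
  apply: le_trans (H n x xc); rewrite ler_piMl//; exact: cutoff_le1.
rewrite cutoff_eq0// ?mul0r ?mulr_ge0 ?exprn_ge0//.
apply: le_trans (norm_le_rad2 c x).
have -> : 2 * (rho / 4) = rho / 2 by field.
by rewrite ler_sqr ?nnegrE// ltW.
Qed.

Section limit.
Variable ut : V -> R.
Hypothesis cut : continuous ut.
Hypothesis ut_lim : forall s, 0 < s -> exists n0, forall n, (n0 <= n)%N -> forall x, `|localized n x - ut x| <= s.

Lemma limit_out x : (rho / 2) ^+ 2 <= rad2 c x -> ut x = 0.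
Proof.
move=> xc; apply/eqP; rewrite -normr_le0; apply/ler_addgt0Pr => s s0; rewrite add0r.
have [n0 /(_ n0 (leqnn _) x)] := ut_lim s0.
by rewrite /localized cutoff_eq0// ?mul0r ?sub0r ?normrN// (_ : 2 * (rho / 4) = rho / 2)//; field.
Qed.

Lemma cc_limit : cc ut.
Proof.
split=> //; exists (`|c| + rho) => x xr; apply: limit_out; apply: le_trans (norm_le_rad2 c x).
rewrite ler_sqr ?nnegrE// ?divr_ge0 ?(ltW rho0)//.
have := ler_normD (x - c) c; rewrite subrK; have := rho0; lra.
Qed.

(** Uniform continuity is inherited from one smooth, compactly supported approximant, which is
    Lipschitz. *)
Lemma limit_equicontinuous (s : R) : 0 < s -> exists n1, forall n, (n1 <= n)%N ->
  forall x y, `|x - y| <= width n -> `|ut x - ut y| <= s.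
Proof.
move=> s0; have s3 : 0 < s / 3 by rewrite divr_gt0.
have [n0 /(_ n0 (leqnn _)) H] := ut_lim s3.
have [_ bl] := cc_localized n0.
have [M M0 HM] := lipschitz_bound (smooth_localized n0) bl.
have M1 : 0 < M + 1 by rewrite ltr_wpDl.
have [n1 Hn] := width_small (divr_gt0 s3 M1); exists n1 => n nn x y xy.
have h : `|localized n0 x - localized n0 y| <= s / 3.
  apply: le_trans (HM x y) _; apply: (@le_trans _ _ ((M + 1) * (s / 3 / (M + 1)))); last first.
    by rewrite mulrC divfK// gt_eqF.
  by apply: ler_pM; [exact: M0|exact: normr_ge0|rewrite lerDl|exact: le_trans xy (Hn n nn)].
exact: dist_le_thirds (H x) (H y) h.
Qed.

(** The norm is the maximum norm: dividing by N + 1, which exceeds the square root of N, places this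
    cube inside the Euclidean ball of radius rho / 4, where the cutoff is 1. *)
Definition core_radius : R := rho / (4 * (N%:R + 1)).
Definition core : set V := open_box (fun i => c 0 i - core_radius) (fun i => c 0 i + core_radius).

Let N1 : 0 < N%:R + 1 :> R. Proof. by rewrite ltr_wpDl. Qed.

Lemma core_radius_gt0 : 0 < core_radius.
Proof. by rewrite divr_gt0// mulr_gt0. Qed.

Lemma core_norm x : core x -> `|x - c| <= core_radius.
Proof.
move=> h; apply/norm_leP => [|i]; first exact/ltW/core_radius_gt0.
by have [h1 h2] := h i; rewrite rowBE ler_norml; apply/andP; split; lra.
Qed.

Lemma norm_core x : `|x - c| < core_radius -> core x.
Proof.
move=> h i; have := le_lt_trans (norm_coord_le (x - c) i) h.
by rewrite rowBE ltr_norml => /andP[h1 h2]; split; lra.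
Qed.

Lemma core_cutoff x : core x -> cutoff c (rho / 4) x = 1.
Proof.
move=> /core_norm xc; apply: cutoff_eq1 => //; apply: le_trans (rad2_le_norm c x) _.
apply: (@le_trans _ _ (N%:R * core_radius ^+ 2)).
  by apply: ler_wpM2l => //; rewrite ler_sqr ?nnegrE// ltW// core_radius_gt0.
have -> : core_radius = rho / 4 / (N%:R + 1) by rewrite /core_radius invfM mulrA.
rewrite expr_div_n mulrCA ler_piMr ?sqr_ge0// ler_pdivrMr ?exprn_gt0// mul1r expr2.
have : 0 <= N%:R :> R by [].
move: (N%:R : R) => t t0; nra.
Qed.

Lemma core_ball x : core x -> ball_set x.
Proof.
move=> /core_norm h; apply: le_trans h _; rewrite /core_radius ler_pdivrMr ?mulr_gt0//.
rewrite ler_peMr ?(ltW rho0)//; have : 0 <= N%:R :> R by []; lra.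
Qed.

(** Fubini moves the mollifier from [u], which is only integrable, to [psi], which is Lipschitz. The
    integrals of [u] and of its mollification against [psi] then differ by O(width), and uniform
    convergence settles the other half. *)
Lemma limit_test psi : smooth psi -> (forall x, 0 <= psi x <= 1) -> (forall x, ~ core x -> psi x = 0) ->
  lint (fun x => (local_part u x - ut x) * psi x) = 0.
Proof.
move=> sp p01 p0; have cp : cc psi.
  by apply: (cc_compact_support cK sp) => x xK; apply: p0 => /core_ball.
have iU : lintegrable (local_part u) := lintegrable_local (sobolev_Lp1 uW).
have [M M0 HM] := lipschitz_bound sp (proj2 cp).
have cup : cc (fun x => ut x * psi x) := ccMr cut cp.
have pb x : `|psi x| <= 1 by have /andP[h1 h2] := p01 x; rewrite ger0_norm.
have iUp : lintegrable (fun x => local_part u x * psi x).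
  exact: (rintegrable_mul iU (continuous_lebesgue (proj1 cp)) pb).
have -> : lint (fun x => (local_part u x - ut x) * psi x) =
    lint (fun x => local_part u x * psi x) - bint (fun x => ut x * psi x).
  rewrite -lint_bint; last exact: (continuous_borel (proj1 cup)).
  rewrite -(@rintB _ L R mu)//; last exact: lintegrable_cc.
  by apply: eq_rint => x; rewrite mulrBl.
pose J := lint (fun x => `|local_part u x|); pose P := bint psi.
have J0 : 0 <= J by apply: rint_ge0.
have P0 : 0 <= P by apply: bint_ge0 => x; case/andP: (p01 x).
apply/eqP; rewrite -normr_le0; apply/ler_addgt0Pr => s s0; rewrite add0r.
have s2 : 0 < s / 2 by rewrite divr_gt0.
have MJ : 0 < M * J + 1 by rewrite ltr_wpDl// mulr_ge0.
have P1 : 0 < P + 1 by rewrite ltr_wpDl.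
have [n1 H1] := width_small (divr_gt0 s2 MJ).
have [n2 H2] := ut_lim (divr_gt0 s2 P1).
pose n := maxn n1 n2; have {}H1 := H1 n (leq_maxl _ _); have {}H2 := H2 n (leq_maxr _ _).
pose k := mollifier (width n) : V -> R.
have ck : cc k := cc_mollifier N (width_gt0 n).
have cpk y : cc (fun x => psi x * k (x - y)).
  by apply: ccMl => //; exact: (continuous_shift (proj1 ck)).
have Eb : bint (fun x => psi x * convol (local_part u) k x) = bint (fun x => psi x * localized n x).
  apply: eq_bint => x; have [xc|xc] := pselect (core x); last by rewrite p0// !mul0r.
  by rewrite /localized core_cutoff// mul1r.
have h1 : `|lint (fun x => local_part u x * psi x) - bint (fun x => psi x * localized n x)| <= s / 2.
  have me y : `|psi y - bint (fun x => psi x * k (x - y))| <= M * width n.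
    exact: mollify_error (width_gt0 n) M0 cp HM.
  have bd y : `|bint (fun x => psi x * k (x - y))| <= 1 + M * width n.
    have := ler_normD (bint (fun x => psi x * k (x - y)) - psi y) (psi y); rewrite subrK.
    by move=> /le_trans; apply; rewrite addrC; apply: lerD (pb y) _; rewrite distrC.
  have cb : continuous (fun y => bint (fun x => psi x * k (x - y))).
    rewrite (_ : (fun y => _) = convol psi k).
      exact: (@continuous_convol R N psi k (lintegrable_cc cp) (@smooth_mollifier R N (width n)) (proj2 ck)).
    apply/funext => y; rewrite -lint_bint; last exact: (continuous_borel (proj1 (cpk y))).
    by apply: eq_rint => x; rewrite /k -mollifier_sym opprB.
  have iUb : lintegrable (fun y => local_part u y * bint (fun x => psi x * k (x - y))).
    exact: (rintegrable_mul iU (continuous_lebesgue cb) bd).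
  rewrite -Eb bint_convol// -(@rintB _ L R mu)//.
  apply: (@le_trans _ _ (M * width n * J)).
    rewrite -(@rintZ _ L R mu); last exact: rintegrable_norm.
    apply: (@normr_rint_le _ L R mu); [exact: rintegrableB|exact/rintegrableZ/rintegrable_norm|] => y.
    by rewrite -mulrBr normrM mulrC; apply: ler_wpM2r.
  apply: (@le_trans _ _ (s / 2 / (M * J + 1) * (M * J + 1))); last by rewrite divfK// gt_eqF.
  rewrite mulrAC mulrC; apply: ler_pM => //; [exact/ltW/width_gt0|exact: mulr_ge0|by rewrite lerDl].
have h2 : `|bint (fun x => psi x * localized n x) - bint (fun x => ut x * psi x)| <= s / 2.
  rewrite -bintB; [|exact: (ccMl cp (proj1 (cc_localized n)))|exact: cup].
  apply: (@le_trans _ _ (bint (fun x => (s / 2 / (P + 1)) * psi x))); last first.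
    rewrite bintZ// mulrAC ler_pdivrMr//; apply: ler_wpM2l; [exact: ltW|by rewrite -/P; lra].
  apply: normr_bint_le; [exact: (ccB (ccMl cp (proj1 (cc_localized n))) cup)|exact: ccZ|] => x.
  rewrite (mulrC (ut x)) -mulrBr normrM mulrC; have /andP[q1 q2] := p01 x.
  by rewrite (ger0_norm q1); apply: ler_wpM2r.
exact: dist_le_halves h1 h2.
Qed.

Lemma limit_ae : {ae mu, forall x, core x -> u x = ut x}.
Proof.
(* [ae_eq0_test] requires a function that vanishes off an open box, hence the restriction to
   [core]. *)
pose F x := (local_part u x - ut x) * \1_core x.
have iU : lintegrable (local_part u) := lintegrable_local (sobolev_Lp1 uW).
have mc : measurable (core : set L) := borel_lebesgue_measurable (measurable_open_box _ _).
have iF : lintegrable F.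
  apply: (@rintegrable_mul _ L R mu _ _ 1 (rintegrableB iU (lintegrable_cc cc_limit)) (measurable_indic mc)) => x.
  by rewrite indicE; case: (x \in core); rewrite ?normr1 ?normr0.
have F0 x : ~ core x -> F x = 0 by move=> xc; rewrite /F indicE memNset// mulr0.
have Ft psi : smooth psi -> (forall x, 0 <= psi x <= 1) -> (forall x, ~ core x -> psi x = 0) ->
    lint (fun x => F x * psi x) = 0.
  move=> sp p01 p0; rewrite -(limit_test sp p01 p0); apply: eq_rint => x.
  have [xc|xc] := pselect (core x); last by rewrite p0// !mulr0.
  by rewrite /F indicE mem_set// mulr1.
apply: (ae_mono _ (ae_eq0_test iF F0 Ft)) => x Fx xc; apply/eqP; rewrite -subr_eq0.
have xb : x \in ball_set by rewrite inE; exact: core_ball.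
by move: Fx; rewrite /F indicE mem_set// mulr1 /local_part patchE xb => ->.
Qed.

End limit.

End representative.

End mollified_solution.

#[local] Transparent partial lap.

(** * The differential inequality near a point of infinite-order vanishing *)

Section local_uniqueness.
Variables (R : realType) (N : nat).
Local Notation V := 'rV[R]_N.
Local Notation L := (lebesgue_space R N).
Local Notation mu := (lebesgue R N).
Local Notation lintegrable := (@rintegrable _ L R mu).
Local Notation lint := (@rint _ L R mu).
Implicit Types (f g v phi k U psi : V -> R) (x y z : V) (i : 'I_N) (K : set V).
Variables (Omega : set V) (m p C : R) (u : V -> R) (c : V) (rho : R).
Hypotheses (openO : open Omega) (Nm : N%:R < m) (uW : sobolev_loc Omega 4 m u).
Hypotheses (rho0 : 0 < rho) (KO : forall y, `|y - c| <= rho -> Omega y).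
Hypotheses (p1 : 1 < p) (C0 : 0 < C).
Local Notation bilap := (weak_laplacian Omega (weak_laplacian Omega u)).
Hypothesis bilap_bound : {ae mu, forall x, Omega x -> `|bilap x| <= C * `|u x| `^ p}.
Variable ut : V -> R.
Hypothesis cut : continuous ut.
Hypothesis ut_lim : forall s, 0 < s -> exists n0, forall n, (n0 <= n)%N -> forall x,
  `|localized u c rho n x - ut x| <= s.
Local Notation core := (core c rho).
Hypothesis ut_ae : {ae mu, forall x, core x -> u x = ut x}.
Variable B : R.
Hypothesis (utB : forall x, `|ut x| <= B).

#[local] Opaque lap partial rad2 cutoff.

Lemma lint_mollifier (d : R) x : 0 < d -> lint (fun y => mollifier d (x - y)) = 1.
Proof.
move=> d0; rewrite -(bint_mollifier x d0) lint_bint.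
  by apply: eq_bint => y; rewrite -mollifier_sym opprB.
exact: (continuous_borel (continuous_reflect (proj1 (cc_mollifier N d0)))).
Qed.

Lemma lintegrable_mollifier (d : R) x : 0 < d -> lintegrable (fun y => mollifier d (x - y)).
Proof.
move=> d0; apply: lintegrable_cc; split; first exact: (continuous_reflect (proj1 (cc_mollifier N d0))).
exists (`|x| + d) => y yd; apply: mollifier_eq0 => //.
by have := ler_normB x (x - y); rewrite opprB addrC subrK; lra.
Qed.

(** Here p > 1 enters: |a|^p = |a|^(p-1) |a| with a bounded first factor, so the nonlinearity
    becomes linear with M = C B^(p-1). *)
Lemma power_bound (a : R) : `|a| <= B -> `|a| `^ p <= B `^ (p - 1) * `|a|.
Proof.
move=> aB; have pp : 0 < p by rewrite (lt_trans ltr01).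
rewrite -(mulr_powRB1 (normr_ge0 a) pp) mulrC; apply: ler_wpM2r => //.
apply: ge0_ler_powR; rewrite ?nnegrE//; first by rewrite subr_ge0 ltW.
exact: le_trans aB.
Qed.

(** The mollifier is a probability density, so an almost everywhere bound on [bilap] near [x] passes
    to the average; [w] is the oscillation of [ut] at the scale of the kernel. *)
Lemma mollified_bound n x (w : R) : 0 <= w -> (forall y, `|x - y| <= width rho n -> core y) ->
  (forall y, `|x - y| <= width rho n -> `|ut x - ut y| <= w) ->
  `|convol (local_part c rho bilap) (mollifier (width rho n)) x| <= C * B `^ (p - 1) * (`|ut x| + w).
Proof.
move=> w0 xc xw; have d0 := width_gt0 rho0 n; set d := width rho n in xc xw d0 *.
have [Lz _] := weak_bilaplacian openO uW.
have iZ : lintegrable (local_part c rho bilap) by apply: (lintegrable_local openO KO).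
have iZm : lintegrable (fun y => local_part c rho bilap y * mollifier d (x - y)).
  by apply: lintegrable_convol => //; exact: cc_mollifier.
apply: le_trans (normr_rint iZm) _; set T := C * _ * _.
rewrite -[leRHS]mulr1 -(lint_mollifier x d0) -(@rintZ _ L R mu); last exact: lintegrable_mollifier.
apply: ae_le_rint.
- exact: rintegrable_norm.
- exact/rintegrableZ/lintegrable_mollifier.
apply: (ae_mono2 _ bilap_bound ut_ae) => y zy uy.
rewrite normrM (ger0_norm (mollifier_ge0 _ d0)).
have [xy|xy] := leP `|x - y| d; last by rewrite mollifier_eq0// !mulr0.
apply: ler_wpM2r; first exact: mollifier_ge0.
have yc := xc y xy; have yb := core_ball rho0 yc.
rewrite /local_part patchE mem_set//; apply: le_trans (zy (KO yb)) _.
rewrite /T -mulrA uy//; apply: ler_wpM2l; first exact: ltW.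
apply: le_trans (power_bound (utB y)) _; apply: ler_wpM2l; first exact: powR_ge0.
have := xw y xy; have := ler_normB (ut x) (ut x - ut y); rewrite subKr; lra.
Qed.

Lemma core_radius_le : core_radius N rho <= rho / 4.
Proof.
rewrite /core_radius invfM mulrA ler_pdivrMr ?ltr_wpDl// ler_peMr ?lerDr//.
by rewrite divr_ge0// ltW.
Qed.

(** The margin 16 r leaves room for points at distance 8 r and kernels of width at most r to remain
    in [core]. The approximant is the mollification without cutoff, whose bilaplacian is exactly the
    mollification of [bilap]; on [core] the cutoff is 1 anyway. *)
Lemma solution_approx (r : R) : 0 < r -> 16 * r <= core_radius N rho ->
  forall s, 0 < s -> exists2 f, smooth f & forall x, rad2 c x <= (8 * r) ^+ 2 ->
     `|f x - ut x| <= s /\ `|lap (lap f) x| <= C * B `^ (p - 1) * `|ut x| + s.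
Proof.
move=> r0 rc s s0; pose M := C * B `^ (p - 1).
have M0 : 0 <= M by rewrite mulr_ge0 ?powR_ge0// ltW.
have M1 : 0 < M + 1 by rewrite ltr_wpDl.
have [n1 H1] := ut_lim s0.
have [n2 H2] := limit_equicontinuous openO uW rho0 KO ut_lim (divr_gt0 s0 M1).
have [n3 H3] := width_small rho0 r0.
pose n := maxn n1 (maxn n2 n3).
have {}H1 := H1 n (leq_maxl _ _).
have {}H2 := H2 n (leq_trans (leq_maxl _ _) (leq_maxr _ _)).
have {}H3 := H3 n (leq_trans (leq_maxr _ _) (leq_maxr _ _)).
have d0 := width_gt0 rho0 n.
have iU : lintegrable (local_part c rho u) := lintegrable_local openO KO (sobolev_Lp1 uW).
have sm := @smooth_mollifier R N (width rho n).
have bm := proj2 (cc_mollifier N d0).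
exists (convol (local_part c rho u) (mollifier (width rho n))); first exact: smooth_convol.
move=> x xr.
have xc : `|x - c| <= 8 * r.
  rewrite -ler_sqr ?nnegrE ?mulr_ge0 ?(ltW r0)//; exact: le_trans (norm_le_rad2 c x) xr.
have nearc y : `|x - y| <= width rho n -> core y.
  move=> xy; apply: norm_core; rewrite (_ : y - c = x - c - (x - y)); last by rewrite opprB [RHS]addrC addrA subrK.
  apply: le_lt_trans (ler_normB _ _) _; lra.
have xcore : core x by apply: nearc; rewrite subrr normr0 ltW.
split.
  by have := H1 x; rewrite /localized core_cutoff// mul1r.
rewrite (lap_convol iU sm bm) (lap_convol iU (smooth_lap sm) (bounded_support_lap bm)).
have -> : convol (local_part c rho u) (lap (lap (mollifier (width rho n)))) x =
    convol (local_part c rho bilap) (mollifier (width rho n)) x.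
  apply: (convol_bilaplacian openO uW KO sm) => [z zr|].
    by apply: mollifier_eq0 => //; exact: le_lt_trans (width_le rho0 n) zr.
  by apply: le_trans xc _; have := core_radius_le; lra.
have sM0 : 0 <= s / (M + 1) by rewrite divr_ge0// ltW.
apply: le_trans (mollified_bound sM0 nearc (H2 x)) _.
by rewrite mulrDr lerD2l -/M mulrA ler_pdivrMr// mulrC ler_pM2l// lerDl.
Qed.

(** Passes from the unknown exponent [e] of the vanishing condition to squares: where a > l, the
    bounded quantity a^2 <= B^2 is multiplied by (a / l)^e >= 1. *)
Lemma square_le_powR (a l e : R) : 0 < e -> 0 < l -> 0 <= a -> a <= B ->
  a ^+ 2 <= l ^+ 2 + B ^+ 2 / l `^ e * a `^ e.
Proof.
move=> e0 l0 a0 aB; have B0 : 0 <= B := le_trans a0 aB.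
have l2 : 0 < l `^ e by rewrite powR_gt0.
have [al|la] := leP a l.
  have q0 : 0 <= B ^+ 2 / l `^ e * a `^ e.
    by apply: mulr_ge0; [apply: divr_ge0; [exact: sqr_ge0|exact: ltW]|exact: powR_ge0].
  by rewrite ler_wpDr// ler_sqr ?nnegrE// ltW.
apply: (@le_trans _ _ (B ^+ 2 / l `^ e * a `^ e)); last by rewrite lerDr sqr_ge0.
apply: (@le_trans _ _ (B ^+ 2)); first by rewrite ler_sqr ?nnegrE.
rewrite mulrAC -mulrA ler_peMr ?sqr_ge0// ler_pdivlMr// mul1r.
by apply: ge0_ler_powR; rewrite ?nnegrE ?(ltW e0) ?(ltW l0)// ltW.
Qed.

Lemma euclidean_ballE (r : R) : euclidean_ball c r = [set y | rad2 c y < r ^+ 2].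
Proof. by []. Qed.

Lemma open_euclidean_ball (r : R) : open (euclidean_ball c r).
Proof.
rewrite euclidean_ballE (_ : [set _ | _] = (rad2 c) @^-1` [set t | t < r ^+ 2])//.
apply: open_comp => [y _|]; last exact: open_lt.
by apply: smooth_continuous; exact: smooth_rad2.
Qed.

(** The threshold is l = t^(k+1) and the ball has radius 4t. In [q], the part (k+1) e pays for l^-e,
    and the other k + 1 leaves one factor t beyond t^k, which makes the constant arbitrarily
    small. *)
Lemma vanishing_scalar (t s V0 e X : R) (k : nat) : 0 < t -> t <= 1 -> 0 <= V0 ->
  let q := k.+1%:R * e + k.+1%:R in
  X <= (t ^+ k.+1) ^+ 2 * V0 + B ^+ 2 / (t ^+ k.+1) `^ e * (4 * t) `^ q ->
  t * (V0 + B ^+ 2 * 4 `^ q) <= s -> X <= s * t ^+ k.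
Proof.
move=> t0 t1 V00 q h1 h2; apply: le_trans h1 _.
have tp : 0 < t ^+ k by rewrite exprn_gt0.
have -> : (t ^+ k.+1) `^ e = t `^ (k.+1%:R * e) by rewrite powRrM powR_mulrn// ltW.
have tn : t != 0 by rewrite gt_eqF.
have tq : t `^ q = t `^ (k.+1%:R * e) * t ^+ k.+1.
  by rewrite /q powRD ?tn ?implybT// powR_mulrn// ltW.
rewrite powRM ?(ltW t0)// tq.
have T0 : t `^ (k.+1%:R * e) != 0 by rewrite gt_eqF// powR_gt0.
have -> : B ^+ 2 / t `^ (k.+1%:R * e) * (4 `^ q * (t `^ (k.+1%:R * e) * t ^+ k.+1)) =
    t ^+ k * (t * (B ^+ 2 * 4 `^ q)).
  by rewrite (exprS t k); move: (t `^ _) T0 (4 `^ q) => T T0 Q; field.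
have -> : (t ^+ k.+1) ^+ 2 * V0 = t ^+ k * (t ^+ k.+2 * V0) by rewrite expr2 !exprS; ring.
rewrite -mulrDr [leRHS]mulrC ler_pM2l//; apply: le_trans h2.
rewrite mulrDr lerD2r; apply: ler_wpM2r => //.
by rewrite exprS ler_piMr ?(ltW t0)// exprn_ile1// ltW.
Qed.

(** The quotient tends to 0 in the extended reals, so it is eventually finite and below 1; an
    infinite integral would make it infinite. *)
Lemma ball_integral_small (q : R) : 0 < q -> vanishes_infinite_order u c ->
  exists2 e : R, 0 < e & forall k : R, 0 < k ->
  \forall r \near 0^'+, (\int[mu]_(x in euclidean_ball c r) (`|u x| `^ e)%:E <= (r `^ k)%:E)%E.
Proof.
move=> q0 [e e0 van]; exists e => // k k0; have /fine_cvgP[fin] := van k k0.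
move=> /cvgrPdist_lt /(_ 1 ltr01) lim1.
near=> r.
have r0 : 0 < r by near: r; exact: nbhs_right_gt.
have rk : 0 < r `^ k by rewrite powR_gt0.
have f1 : ((\int[mu]_(x in euclidean_ball c r) (`|u x| `^ e)%:E) * ((r `^ k)^-1)%:E)%E \is a fin_num.
  by near: r.
have f2 : `|0 - fine ((\int[mu]_(x in euclidean_ball c r) (`|u x| `^ e)%:E) * ((r `^ k)^-1)%:E)%E| < 1.
  by near: r.
have I0 : (0 <= \int[mu]_(x in euclidean_ball c r) (`|u x| `^ e)%:E)%E.
  by apply: integral_ge0 => x _; rewrite lee_fin powR_ge0.
move: f1 f2 I0; case: (\int[mu]_(x in _) _)%E => [t| |] //=.
  move=> _; rewrite sub0r normrN !lee_fin => h t0.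
  by have := le_lt_trans (ler_norm _) h; rewrite ltr_pdivrMr// mul1r => /ltW.
by rewrite gt0_mulye// lte_fin invr_gt0.
Unshelve. all: by end_near. Qed.

Lemma solution_vanishes : vanishes_infinite_order u c ->
  forall (k : nat) (s d : R), 0 < s -> 0 < d -> exists r, [/\ 0 < r, r <= d &
     bint (fun x => cutoff c (2 * r) x * ut x ^+ 2) <= s * r ^+ k].
Proof.
move=> van k s d s0 d0; have [e e0 small] := ball_integral_small ltr01 van.
pose q : R := k.+1%:R * e + k.+1%:R.
have q0 : 0 < q by rewrite addr_gt0// mulr_gt0.
have mcore : measurable (core : set (borel_space R N)) := measurable_open_box _ _.
have fcore : (borel_lebesgue R N core < +oo)%E.
  apply: le_lt_trans (cube_finite (fun i => c 0 i - core_radius N rho) (fun i => c 0 i + core_radius N rho)).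
  apply: le_measure; rewrite ?inE//; first exact: measurable_cube.
  by move=> x xc i; have [h1 h2] := xc i; rewrite in_itv/= !ltW.
have [iV _] := lintegrable_indic mcore fcore.
pose V0 := lint (\1_core : V -> R).
have V00 : 0 <= V0 by apply: rint_ge0.
pose W := V0 + B ^+ 2 * 4 `^ q.
have W0 : 0 <= W by rewrite addr_ge0// mulr_ge0 ?sqr_ge0 ?powR_ge0.
have W1 : 0 < W + 1 by rewrite ltr_wpDl.
have cr := core_radius_gt0 N rho0.
pose d1 := Num.min (Num.min 1 d) (Num.min (core_radius N rho / 4) (s / (W + 1))).
have d10 : 0 < d1 by rewrite !lt_min ltr01 d0 !divr_gt0.
have d40 : 0 < 4 * d1 by rewrite mulr_gt0.
have /filter_ex[r [r0 rd hr]] : \forall r \near 0^'+, [/\ 0 < r, r < 4 * d1 &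
    (\int[mu]_(x in euclidean_ball c r) (`|u x| `^ e)%:E <= (r `^ q)%:E)%E].
  near=> r; split; near: r; [exact: nbhs_right_gt|exact: nbhs_right_lt|exact: small].
(* The cutoff of radius 2t vanishes beyond 4t = r, so the integral sees only the ball on which [hr]
   is available. *)
pose t := r / 4; have t0 : 0 < t by rewrite divr_gt0.
have td : t < d1 by rewrite ltr_pdivrMr// mulrC.
have rE : r = 4 * t by rewrite /t mulrC divfK.
have [[t1 t2] [t3 t4]] : (t < 1 /\ t < d) /\ (t < core_radius N rho / 4 /\ t < s / (W + 1)).
  by move: td; rewrite !lt_min => /andP[/andP[? ?] /andP[? ?]].
exists t; split => //; first exact: ltW.
have rcore : r <= core_radius N rho by rewrite rE; lra.
pose A := euclidean_ball c r.
have Acore : A `<=` core.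
  move=> x Ax; apply: norm_core; apply: lt_le_trans rcore.
  rewrite -ltr_sqr ?nnegrE ?(ltW r0)//; exact: le_lt_trans (norm_le_rad2 c x) Ax.
have AO : A `<=` Omega by move=> x /Acore /(core_ball rho0)/KO.
have mA : measurable (A : set L) := borel_lebesgue_measurable (open_borel (open_euclidean_ball (r := r))).
pose G : V -> R := (fun x => `|u x| `^ e) \_ A.
have iG : lintegrable G.
  apply/(rintegrable_patchP mu _ mA); split.
    have [mu' _] := sobolev_Lp1 uW.
    apply: (measurableT_comp (measurable_powR e)); apply: (measurableT_comp (@normr_measurable R setT)).
    exact: (measurable_funS (measurable_Omega openO) AO mu').
  apply: le_lt_trans (ltry (r `^ q)); apply: le_trans hr.
  by rewrite le_eqVlt; apply/orP; left; apply/eqP; apply: eq_integral => x _; rewrite ger0_norm ?powR_ge0.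
have GE : lint G <= r `^ q.
  rewrite -lee_fin -(fin_rint iG); apply: le_trans hr; rewrite [leRHS]integral_mkcond.
  rewrite le_eqVlt; apply/orP; left; apply/eqP; apply: eq_integral => x _.
  by rewrite /G !patchE; case: ifP.
pose l := t ^+ k.+1; have l0 : 0 < l by rewrite exprn_gt0.
have cfu : cc (fun x => cutoff c (2 * t) x * ut x ^+ 2).
  have cu2 : continuous (fun x => ut x ^+ 2) by move=> x; have h := cvgM (cut (x := x)) (cut (x := x)); exact: h.
  by apply: ccMl => //; apply: cc_cutoff; rewrite mulr_gt0.
have bl : 0 <= B ^+ 2 / l `^ e by rewrite divr_ge0 ?sqr_ge0 ?powR_ge0.
have key : bint (fun x => cutoff c (2 * t) x * ut x ^+ 2) <= l ^+ 2 * V0 + B ^+ 2 / l `^ e * lint G.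
  rewrite -lint_bint; last exact: (continuous_borel (proj1 cfu)).
  rewrite -!(@rintZ _ L R mu)// -(@rintD _ L R mu); [|exact: rintegrableZ|exact: rintegrableZ].
  apply: ae_le_rint; [exact: lintegrable_cc|by apply: rintegrableD; exact: rintegrableZ|].
  apply: (ae_mono _ ut_ae) => x ux.
  have [xA|xA] := pselect (A x); last first.
    rewrite cutoff_eq0 ?mul0r ?mulr_gt0//.
      by rewrite addr_ge0// mulr_ge0 ?sqr_ge0// ?indicE// /G patchE; case: ifP => // _; exact: powR_ge0.
    move/negP: xA; rewrite -leNgt rE; congr (_ <= _); congr (_ ^+ 2); ring.
  have xc := Acore x xA.
  rewrite indicE mem_set// mulr1 /G patchE mem_set// ux//.
  apply: (@le_trans _ _ (`|ut x| ^+ 2)); last exact: square_le_powR.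
  by rewrite real_normK ?num_real// ler_piMl ?sqr_ge0// cutoff_le1.
apply: (vanishing_scalar t0 (ltW t1) V00 (e := e)) => /=; last first.
  rewrite -/q -/W; apply: (@le_trans _ _ (s / (W + 1) * (W + 1))); last by rewrite divfK// gt_eqF.
  by apply: ler_pM; [exact: ltW|exact: W0|exact: ltW|rewrite lerDl].
apply: le_trans key _; rewrite -/l lerD2l -/q -rE; exact: ler_wpM2l.
Unshelve. all: by end_near. Qed.

End local_uniqueness.

Section local_vanishing_theorem.
Variables (R : realType) (N : nat).
Local Notation V := 'rV[R]_N.
Local Notation mu := (lebesgue R N).
Variables (Omega : set V) (m p C : R) (u : V -> R).
Hypotheses (openO : open Omega) (Nm : N%:R < m) (uW : sobolev_loc Omega 4 m u).
Hypotheses (p1 : 1 < p) (C0 : 0 < C).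
Hypothesis bilap_bound : {ae mu, forall x, Omega x ->
  `|weak_laplacian Omega (weak_laplacian Omega u) x| <= C * `|u x| `^ p}.

Lemma min_radius (a r : R) : 0 < a -> r = Num.min (1 / 4) (a / 16) -> [/\ 0 < r, r <= 1 / 4 & 16 * r <= a].
Proof.
move=> a0 ->; split; first by rewrite lt_min !divr_gt0.
  by rewrite ge_min lexx.
by rewrite mulrC -ler_pdivlMr// ge_min lexx orbT.
Qed.

(** The radius comes from [core_radius], hence from [rho] and N alone: the bound B on [ut], which
    depends on [c], affects only M, and [local_vanishing] gives the same radius for every M. *)
Lemma local_ae_vanishing (rho : R) : 0 < rho -> exists2 r : R, 0 < r &
  forall c : V, (forall y, `|y - c| <= rho -> Omega y) -> vanishes_infinite_order u c ->
  {ae mu, forall x, `|x - c| <= r -> u x = 0}.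
Proof.
move=> rho0; have cr0 := core_radius_gt0 N rho0.
have [r0 r4 r16] := min_radius cr0 erefl.
set r := Num.min _ _ in r0 r4 r16.
have N1 : 0 < 8 * (N%:R + 1) :> R by rewrite mulr_gt0// ltr_wpDl.
(* The factor N + 1 again passes from the maximum norm to the Euclidean ball of radius r / 8 of
   [local_vanishing]. *)
exists (r / (8 * (N%:R + 1))); first exact: divr_gt0.
move=> c KO van.
have [ut cut ut_lim] := localized_limit openO Nm uW rho0 KO.
have ut_ae := limit_ae openO uW rho0 KO cut ut_lim.
have [B0 B00 HB0] := cc_bounded (cc_limit rho0 cut ut_lim).
have HB x : `|ut x| <= B0 + 1 by apply: le_trans (HB0 x) _; rewrite lerDl.
have ap := solution_approx openO uW rho0 KO p1 C0 bilap_bound ut_lim ut_ae HB r0 r16.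
have va := solution_vanishes openO uW rho0 KO cut ut_ae HB van.
have V0 := local_vanishing r0 r4 cut ap va.
apply: (ae_mono _ ut_ae) => x ux xr.
have xr8 : `|x - c| <= r / 8 / (N%:R + 1) by apply: le_trans xr _; rewrite invfM mulrA.
have xc : core c rho x.
  apply: norm_core; apply: le_lt_trans xr _; rewrite ltr_pdivrMr//; apply: (@lt_le_trans _ _ (16 * r)).
    by rewrite ltr_pMl// ltr1n.
  apply: le_trans r16 _; rewrite ler_peMr ?(ltW cr0)//.
  by have : 0 <= N%:R :> R by []; lra.
rewrite ux//; apply: V0; apply: le_trans (rad2_le_norm c x) _.
apply: (@le_trans _ _ (N%:R * (r / 8 / (N%:R + 1)) ^+ 2)).
  apply: ler_wpM2l => //; rewrite ler_sqr ?nnegrE//; exact: le_trans xr8.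
rewrite expr_div_n mulrCA ler_piMr ?sqr_ge0// ler_pdivrMr ?exprn_gt0 ?ltr_wpDl// mul1r expr2.
have : 0 <= N%:R :> R by [].
move: (N%:R : R) => t t0; nra.
Qed.

End local_vanishing_theorem.

#[local] Transparent partial lap rad2 cutoff.
(** * Propagation along a connected set *)

Section null_integral.
Context d (T : measurableType d) (R : realType) (nu : {measure set T -> \bar R}).

Lemma ae_eq0_integral (f : T -> R) (A : set T) : measurable A -> measurable_fun A f -> (forall x, 0 <= f x) ->
  {ae nu, forall x, A x -> f x = 0} -> (\int[nu]_(x in A) (f x)%:E = 0)%E.
Proof.
move=> mA mf f0 H.
have mE : measurable_fun A (EFin \o f) by exact/measurable_EFinP.
have := (ae_eq_integral_abs nu mA mE).2; rewrite (eq_integral (fun x => (f x)%:E)) => [|x _].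
  by apply; apply: filterS H => x h Ax; rewrite /= h.
by rewrite /= ger0_norm.
Qed.

Lemma ae_forall_nat (P : nat -> T -> Prop) : (forall n, {ae nu, forall x, P n x}) ->
  {ae nu, forall x, forall n, P n x}.
Proof. by move=> H; apply/ae_foralln. Qed.

End null_integral.

Section unique_continuation.
Variables (R : realType) (N : nat).
Local Notation V := 'rV[R]_N.
Local Notation L := (lebesgue_space R N).
Local Notation mu := (lebesgue R N).
Variables (Omega : set V) (u : V -> R).
Implicit Types (x y c : V).

Definition vanishes_near x := exists2 e : R, 0 < e & {ae mu, forall y, `|y - x| < e -> u y = 0}.

Lemma open_nbhs_ball x : open Omega -> Omega x -> exists2 r : R, 0 < r & forall y, `|y - x| < r -> Omega y.
Proof.
move=> oO Ox; have /nbhs_ballP[r /= r0 H] : nbhs x Omega by exact: open_nbhs_nbhs.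
exists r => // y yx; apply: H; rewrite -ball_normE /ball_/= distrC; exact: yx.
Qed.

(** For small radii the integrals are zero, with exponent 1. This restarts the local theorem from a
    new centre. *)
Lemma vanishes_near_infinite_order x : open Omega -> lebesgue_measurable_fun Omega u -> Omega x ->
  vanishes_near x -> vanishes_infinite_order u x.
Proof.
move=> oO mu' Ox [e e0 ue]; have [r r0 rO] := open_nbhs_ball oO Ox.
exists 1 => // k k0.
apply: (@cvg_trans _ ((fun=> 0%E : \bar R) @ 0^'+)); last exact: cvg_cst.
apply: near_eq_cvg; near=> t.
have t0 : 0 < t by near: t; exact: nbhs_right_gt.
have te : t < e by near: t; exact: nbhs_right_lt.
have tr : t < r by near: t; exact: nbhs_right_lt.
have inb y : euclidean_ball x t y -> `|y - x| < t.
  by move=> h; rewrite -ltr_sqr ?nnegrE ?(ltW t0)//; exact: le_lt_trans (norm_le_rad2 x y) h.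
have mA : measurable (euclidean_ball x t : set L) := borel_lebesgue_measurable (open_borel (@open_euclidean_ball R N x t)).
have mf : measurable_fun (euclidean_ball x t : set L) (fun y : L => `|u y| `^ 1 : R).
  apply: (measurableT_comp (measurable_powR 1)); apply: (measurableT_comp (@normr_measurable R setT)).
  apply: (measurable_funS (measurable_Omega oO) _ mu') => y /inb h.
  by apply: rO; exact: lt_trans tr.
have f0 : {ae mu, forall y, euclidean_ball x t y -> `|u y| `^ 1 = 0}.
  apply: (ae_mono _ ue) => y h /inb yt.
  by rewrite h ?normr0 ?powR0 ?oner_eq0//; exact: lt_trans te.
have I0 := @ae_eq0_integral _ L R mu _ _ mA mf (fun y => powR_ge0 _ 1) f0.
by rewrite I0 mul0e.
Unshelve. all: by end_near. Qed.

Lemma rational_point x (e : R) : 0 < e -> exists q : 'rV[rat]_N, `|x - map_mx ratr q| < e.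
Proof.
move=> e0.
have /choice[q Hq] : forall i, exists q : rat, x 0 i - e / 2 < ratr q < x 0 i.
  move=> i; have /rat_in_itvoo[q qi] : x 0 i - e / 2 < x 0 i by rewrite ltrBlDr ltrDl divr_gt0.
  by exists q; move: qi; rewrite in_itv.
exists (\row_i q i).
apply: (@le_lt_trans _ _ (e / 2)); last by rewrite ltr_pdivrMr// ltr_pMr// ltr1n.
apply/norm_leP => [|i]; first by rewrite divr_ge0// ltW.
rewrite rowBE !mxE; have /andP[h1 h2] := Hq i.
by rewrite ler_norml; apply/andP; split; lra.
Qed.

(** Almost everywhere statements combine only countably, so arbitrary balls are replaced by balls
    with rational centres and radii 1/(n+1), on each of which [u] vanishes almost everywhere. *)
Lemma ae_of_vanishes_near : (forall x, Omega x -> vanishes_near x) -> {ae mu, forall x, Omega x -> u x = 0}.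
Proof.
move=> H.
pose Q (i : 'rV[rat]_N * nat) y := `|y - map_mx ratr i.1| < i.2.+1%:R^-1 :> R.
pose good i := {ae mu, forall y, Q i y -> u y = 0}.
(* The pairs (centre, radius) are enumerated through [unpickle]; codes of no pair make the condition
   empty. *)
pose P (n : nat) y := forall i, unpickle n = Some i -> good i -> Q i y -> u y = 0.
have aeP n : {ae mu, forall y, P n y}.
  rewrite /P; case: (unpickle n) => [i|]; last by apply: aeW => y i.
  have [gi|gi] := pselect (good i); last by apply: aeW => y j [<-].
  by apply: (ae_mono _ gi) => y h j [<-] _; exact: h.
apply: (ae_mono _ (ae_forall_nat aeP)) => x Px Ox.
have [e e0 ue] := H x Ox.
have e2 : 0 < e / 2 by rewrite divr_gt0.
have [n ne] : exists n : nat, n.+1%:R^-1 < e / 2.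
  exists (Num.bound (e / 2)^-1); rewrite invf_plt ?posrE//.
  apply: (lt_trans (archi_boundP _)); [by rewrite invr_ge0 ltW|by rewrite ltr_nat].
have n0 : 0 < n.+1%:R^-1 :> R by rewrite invr_gt0.
have [q xq] := rational_point x n0.
apply: (Px (pickle (q, n)) (q, n)); [by rewrite pickleK| |exact: xq].
apply: (ae_mono _ ue) => y h yq; apply: h.
rewrite (_ : y - x = (y - map_mx ratr q) - (x - map_mx ratr q)); last by rewrite opprB addrA subrK.
apply: le_lt_trans (ler_normB _ _) _; apply: lt_trans (ltrD yq xq) _.
by rewrite /= (splitr e); exact: ltrD.
Qed.

(** The set of points near which [u] vanishes is open, meets [Omega] at [x0], and is relatively
    closed in [Omega] because the vanishing radius is uniform for centres at a fixed distance from
    the complement. *)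
Lemma unique_continuation x0 : open Omega -> connected Omega -> lebesgue_measurable_fun Omega u ->
  (forall rho : R, 0 < rho -> exists2 r : R, 0 < r &
     forall c, (forall y, `|y - c| <= rho -> Omega y) -> vanishes_infinite_order u c ->
     {ae mu, forall x, `|x - c| <= r -> u x = 0}) ->
  Omega x0 -> vanishes_infinite_order u x0 -> {ae mu, forall x, Omega x -> u x = 0}.
Proof.
move=> oO cO mu' loc Ox0 van.
have near_of rho r c : 0 < r -> (forall c, (forall y, `|y - c| <= rho -> Omega y) -> vanishes_infinite_order u c ->
     {ae mu, forall x, `|x - c| <= r -> u x = 0}) -> (forall y, `|y - c| <= rho -> Omega y) ->
     vanishes_infinite_order u c -> forall x, `|x - c| < r / 2 -> vanishes_near x.
  move=> r0 locr cO' vc x xc; exists (r / 2); first by rewrite divr_gt0.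
  apply: (ae_mono _ (locr c cO' vc)) => y h yx; apply: h.
  by have := ler_normD (y - x) (x - c); rewrite addrA subrK; lra.
pose Z := [set x | Omega x /\ vanishes_near x].
suff ZO : Z = Omega by apply: ae_of_vanishes_near => x; rewrite -{1}ZO => -[].
apply: cO.
- exists x0; split => //; have [e e0 eO] := open_nbhs_ball oO Ox0.
  have e2 : 0 < e / 2 by rewrite divr_gt0.
  have [r r0 locr] := loc _ e2.
  apply: (near_of (e / 2) r x0 r0 locr) => //; last by rewrite subrr normr0 divr_gt0.
  by move=> y h; apply: eO; apply: le_lt_trans h _; rewrite ltr_pdivrMr// ltr_pMr// ltr1n.
- exists [set x | vanishes_near x]; last by [].
  rewrite openE => x [e e0 ue]; apply/nbhs_ballP; exists (e / 2) => /=; first by rewrite divr_gt0.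
  move=> y; rewrite -ball_normE /ball_/= => xy; exists (e / 2); first by rewrite divr_gt0.
  apply: (ae_mono _ ue) => z h zy; apply: h.
  by have := ler_normD (z - y) (y - x); rewrite addrA subrK (distrC y x); lra.
- exists (closure Z); first exact: closed_closure.
  apply/seteqP; split => [x Zx|x [Ox clx]]; first by split; [case: Zx|exact: subset_closure].
  split => //; have [e e0 eO] := open_nbhs_ball oO Ox.
  have e2 : 0 < e / 2 by rewrite divr_gt0.
  have [r r0 locr] := loc _ e2.
  (* A centre [c] within e/2 of [x] keeps its closed ball of radius e/2 in [Omega], so it has the
     same radius [r]; being within r/2 of [x], it reaches a neighbourhood of [x]. *)
  pose s := Num.min (e / 2) (r / 2).
  have s0 : 0 < s by rewrite lt_min e2 divr_gt0.
  have [c [[Oc Zc]]] : Z `&` ball x s !=set0 by apply: clx; exact: nbhsx_ballx.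
  rewrite -ball_normE /ball_/= lt_min => /andP[xc1 xc2].
  apply: (near_of (e / 2) r c r0 locr) => //.
    move=> y yc; apply: eO; have := ler_normD (y - c) (c - x).
    by rewrite addrA subrK (distrC c x); lra.
  exact: vanishes_near_infinite_order.
Qed.

End unique_continuation.

Theorem theorem1p6 (R : realType) (N : nat) (Omega : set 'rV[R]_N)
    (m p C : R) (g : 'rV[R]_N -> R -> R -> R) (u : 'rV[R]_N -> R)
    (x0 : 'rV[R]_N)
    (openO : open Omega) (connectedO : connected Omega)
    (Nm : N%:R < m) (p1 : 1 < p) (C0 : 0 < C)
    (gC : forall x t1 t2, Omega x -> `|g x t1 t2| <= C * `|t1| `^ p)
    (uW : sobolev_loc Omega 4 m u)
    (eqn : {ae lebesgue R N, forall x, Omega x ->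
      weak_laplacian Omega (weak_laplacian Omega u) x =
      g x (u x) (weak_laplacian Omega u x)})
    (Ox0 : Omega x0)
    (vanish : vanishes_infinite_order u x0) :
  {ae lebesgue R N, forall x, Omega x -> u x = 0}.
Proof.
have [mu' _] := sobolev_Lp1 uW.
have bound : {ae lebesgue R N, forall x, Omega x ->
    `|weak_laplacian Omega (weak_laplacian Omega u) x| <= C * `|u x| `^ p}.
  by apply: (ae_mono _ eqn) => x h Ox; rewrite h//; exact: gC.
apply: (unique_continuation openO connectedO mu' _ Ox0 vanish) => rho rho0.
exact: (local_ae_vanishing openO Nm uW p1 C0 bound rho0).
Qed.
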